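(* Let $0<\alpha\le1$, $\nu>0$, $\xi_0>0$, and let $f$ be any probability distribution on $\mathbb{N}=\{1,2,\dots\}$ (so $f(0)=0$), not depending on the scaling parameter $\xi$, with generating function $\bar f(u)=\sum_{k\ge1}f(k)u^k$. For $\xi>0$ put $$\bar\theta_{\xi}(u)=\bar f(u)\,\frac{\xi^{\nu}}{(\xi+(1-u)^{\alpha})^{\nu}},\qquad |u|\le1 .$$ Then $\bar\theta_\xi$ is the generating function of a waiting-time probability distribution $\theta(\cdot,\xi)$ on $\mathbb{N}_0$ with $\theta(0,\xi)=0$. Moreover, under the scaling $\xi=\xi_0h^{\alpha}$ with time step $h>0$, its well-scaled continuous-time limit exists and is the Prabhakar-Mittag-Leffler density: $$\lim_{h\to0}\frac1h\,\theta\!\left(\frac th,\xi_0h^{\alpha}\right)=\xi_0^{\nu}\,t^{\alpha\nu-1}E^{\nu}_{\alpha,\alpha\nu}(-\xi_0t^{\alpha}),\qquad t\in\mathbb{R}^{+}.$$ In particular the limit does not depend on $f$.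
   Context: The Prabhakar function is $E_{a,b}^c(z)=\sum_{m=0}^{\infty}\frac{(c)_m}{m!}\frac{z^m}{\Gamma(am+b)}$, where $(c)_0=1$ and $(c)_m=c(c+1)\cdots(c+m-1)$. The function $\xi_0^{\nu}t^{\alpha\nu-1}E^{\nu}_{\alpha,\alpha\nu}(-\xi_0t^{\alpha})$, $t>0$, is the Prabhakar-Mittag-Leffler waiting-time density; its Laplace transform is $\xi_0^\nu/(\xi_0+s^\alpha)^\nu$. For a distribution $g(k,\xi)$, $k\in\mathbb{N}_0$, the scaled discrete-time density with time step $h$ is $\sum_{k\ge0}g(k,\xi)\,\delta_h(t-kh)=\frac1h g(\frac th,\xi)$ for $t\in h\mathbb{N}_0$, where $\delta_h(0)=1/h$ and $\delta_h(t)=0$ for other $t\in h\mathbb{Z}$. The well-scaled continuous-time limit is the limit $h\to0$ of this scaled density with $\xi=\xi_0h^\alpha$, where $t=hk$ is kept finite (so $k=t/h\to\infty$).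
   Formalization: The pointwise limit for every f fails if αν<1 (e.g. f(2^n)=c/n²: unbounded along t/h=2^n). Proved instead: for every f the limit holds weakly and in L¹(0,∞); pointwise at each t>0 (h→0 with t in hN) if αν≥1 or k f(k) is bounded. *)

(* Defs.v *)
From mathcomp Require Import all_boot all_order all_algebra.
From mathcomp Require Import complex.
From mathcomp Require Import all_classical all_reals all_analysis.

Set Implicit Arguments.
Unset Strict Implicit.
Unset Printing Implicit Defensive.

Import Order.TTheory GRing.Theory Num.Theory.
Import numFieldNormedType.Exports.

Local Open Scope classical_set_scope.
Local Open Scope ring_scope.

Definition is_distribution (R : realType) (p : nat -> R) : Prop :=
  (forall k, 0 <= p k) /\ series p @ \oo --> (1 : R).

(* The principal argument, in ]-pi, pi], for z != 0; its value at z = 0 plays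
   no role in cpow below, where it is multiplied by the modulus 0. *)
Definition carg (R : realType) (z : R[i]) : R :=
  let a :=
    acos (complex.Re z / Num.sqrt (complex.Re z ^+ 2 + complex.Im z ^+ 2)) in
  if 0 <= complex.Im z then a else - a.

(* Principal branch of z ^ p for a real exponent p, with 0 ^ p = 0 if p != 0.
   For the powers in theta_bar both bases lie in the closed right half-plane,
   away from the cut. *)
Definition cpow (R : realType) (z : R[i]) (p : R) : R[i] :=
  (Num.sqrt (complex.Re z ^+ 2 + complex.Im z ^+ 2) `^ p)%:C%C *
  (cos (p * carg z) +i* sin (p * carg z))%C.

(* R[i]^o is R[i] with the topology given by the modulus. *)
Definition genfun_term (R : realType) (p : nat -> R) (u : R[i]) (k : nat) :
    R[i]^o :=
  (p k)%:C%C * u ^+ k.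

Definition genfun (R : realType) (p : nat -> R) (u : R[i]) : R[i] :=
  limn (series (genfun_term p u)).

(* On the whole closed unit disc the series converges and its sum is G u. *)
Definition is_genfun (R : realType) (p : nat -> R) (G : R[i] -> R[i]) : Prop :=
  forall u : R[i], `|u| <= 1 ->
    series (genfun_term p u) @ \oo --> (G u : R[i]^o).

Definition theta_bar (R : realType) (alpha nu : R) (f : nat -> R) (xi : R)
    (u : R[i]) : R[i] :=
  genfun f u * ((xi `^ nu)%:C%C / cpow (xi%:C%C + cpow (1 - u) alpha) nu).

(* Euler's integral; meaningful for x > 0, the only case used. *)
Definition Gamma (R : realType) (x : R) : R :=
  \int[@lebesgue_measure R]_(t in `]0, +oo[) (t `^ (x - 1) * expR (- t)).

(* (c)_m = c (c + 1) ... (c + m - 1) *)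
Definition rising (R : realType) (c : R) (m : nat) : R :=
  \prod_(i < m) (c + i%:R).

(* E_{a,b}^c (z) *)
Definition prabhakar (R : realType) (a b c z : R) : R :=
  limn (series (fun m : nat =>
    rising c m / m`!%:R * (z ^+ m / Gamma (a * m%:R + b)))).

Definition prabhakar_ML_density (R : realType) (alpha nu xi0 t : R) : R :=
  xi0 `^ nu * t `^ (alpha * nu - 1) *
  prabhakar alpha (alpha * nu) nu (- xi0 * t `^ alpha).

Definition delta (R : realType) (h t : R) : R := if t == 0 then h^-1 else 0.

(* \sum_k g(k) delta_h(t - k h), i.e. g(t / h) / h at the points t of h N_0 *)
Definition scaled_density (R : realType) (h : R) (g : nat -> R) (t : R) : R :=
  limn (series (fun k : nat => g k * delta h (t - k%:R * h))).

(* Three senses in which a family w h of densities on the lattices h N_0 can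
   converge, as h -> 0+, to a density p on the half-line ]0, +oo[. On h N_0
   integration is summation with weight h. When alpha * nu < 1 a heavy-tailed
   lacunary f (say f(2^n) proportional to n^-2) makes the pointwise limit
   diverge along t / h = 2^n, while the other two hold for every f. *)

(* As generalized functions: h \sum_(t in h N_0) w h t phi(t) tends to the
   integral of p phi for every bounded continuous test function phi. *)
Definition limit_weak (R : realType) (w : R -> R -> R) (p : R -> R) : Prop :=
  forall phi : R -> R, continuous phi ->
    (exists M : R, forall t, `|phi t| <= M) ->
    h * limn (series (fun k : nat => w h (k%:R * h) * phi (k%:R * h)))
      @[h --> (0 : R)^'+] -->
    \int[@lebesgue_measure R]_(t in `]0, +oo[) (p t * phi t).

(* In mean, w h being extended to ]0, +oo[ as a step function. *)
Definition limit_in_mean (R : realType) (w : R -> R -> R) (p : R -> R) : Prop :=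
  (\int[@lebesgue_measure R]_(t in `]0%R, +oo[)
     (`|w h ((Num.floor (t / h))%:~R * h) - p t|%:E))%E
    @[h --> (0 : R)^'+] --> 0%E.

(* Pointwise at t = h k, which is kept fixed while h -> 0+ and k -> oo. *)
Definition limit_at (R : realType) (w : R -> R -> R) (p : R -> R) (t : R) :
    Prop :=
  w h t @[h --> within [set h | exists k : nat, t = k%:R * h] (0 : R)^'+]
    --> p t.

(* Main.v *)
(** The generating function xi^nu / (xi + (1 - u)^alpha)^nu belongs to a
    negative binomial compound of the Sibuya law 1 - (1 - u)^alpha, hence to a
    probability distribution g_xi, and theta_xi = f * g_xi.  Expanding in powers
    of xi (1 - u)^(-alpha) gives
      g_xi(k) = \sum_m (-1)^m (nu)_m / m! xi^(nu + m) c_(alpha (nu + m))(k),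
    where c_b(k) = (b)_k / k! ~ k^(b - 1) / Gamma(b).  For xi = xi0 h^alpha and
    h k -> t, g_xi(k) / h then tends, term by term and with a uniform bound, to
    the Prabhakar-Mittag-Leffler density p.  Fatou's lemma and the Laplace
    transform of g_xi show that p has mass 1, so that Scheffe's lemma turns the
    pointwise convergence into convergence in mean.  A summable average over the
    delays j with weights f(j) transfers this to theta_xi; weak convergence
    follows.  At a fixed point t the delays close to t / h are the only
    obstruction: they are harmless if alpha nu >= 1, where g_xi(k) / h is bounded,
    and k f(k) bounded makes their contribution small otherwise. *)

Require Import Defs.
From mathcomp Require Import all_boot all_order all_algebra.
From mathcomp Require Import complex.
From mathcomp Require Import all_classical all_reals all_analysis.
From mathcomp Require Import measurable_realfun.
From mathcomp Require Import ring lra zify.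

Import Order.TTheory GRing.Theory Num.Theory.
Import numFieldNormedType.Exports.

Local Open Scope classical_set_scope.
Local Open Scope ring_scope.

Set Implicit Arguments.
Unset Strict Implicit.
Unset Printing Implicit Defensive.

(** * Convolutions and negative binomial coefficients *)

(** Two descriptions of g_xi are needed, since neither does both jobs. The compound form, with
    weights proportional to [nbin nu n * (1 + xi)^-1 ^+ n] on the Sibuya convolution powers, shows
    nonnegativity and gives the generating function up to the boundary of the disc; the alternating
    expansion carries the asymptotics but hides the sign. They are linked by (1 - u)^(-alpha y) = (1
    - S(u))^(-y), S(u) = 1 - (1 - u)^alpha, read on coefficients: for each k a polynomial identity
    in y, checked at negative integers. The analytic obstacle is domination in m. Bounding c_b(k) by
    a multiple of k^(b - 1), without the gain 1 / Gamma(b), leaves powers of xi0 t^alpha, whose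
    series diverges for large t. [nbin_bound] therefore has a free parameter c: it replaces the time
    t by about t / c at a cost expR (2 c) independent of m, so that a large c makes the series
    geometric on any bounded time interval. Complex powers are handled by real analysis along rays:
    only the real and imaginary parts of (1 - s z)^b, as functions of a real s, are
    differentiated. *)

Definition conv (S : comNzRingType) (p q : nat -> S) (n : nat) : S :=
  \sum_(i < n.+1) p i * q (n - i)%N.

(** A partial sum of the Cauchy product runs over the triangle i + j < N. This triangle lies in the
    square of side N, which lies in the triangle of size 2N; hence [series_conv_le] and
    [series_conv_ge]. *)
Lemma sum_conv (S : comNzRingType) (p q : nat -> S) N :
  \sum_(0 <= n < N) conv p q n =
  \sum_(i < N) \sum_(j < N | (i + j < N)%N) p i * q j.
Proof.
rewrite big_mkord.
transitivity (\sum_(n < N) \sum_(i < N | (i <= n)%N) p i * q (n - i)%N).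
  apply: eq_bigr => n _; rewrite /conv (big_ord_widen N (fun i => p i * q (n - i)%N))//.
rewrite (exchange_big_dep xpredT) //=; apply: eq_bigr => i _.
have leiN : (i <= N)%N by apply: ltnW.
rewrite -(big_mkord (fun n => (i <= n)%N) (fun n => p i * q (n - i)%N)).
rewrite -(big_mkord (fun n => (i + n < N)%N) (fun n => p i * q n)).
rewrite (@big_cat_nat _ _ _ i)//= [X in X + _]big1_seq ?add0r; last first.
  by move=> j /andP[ij]; rewrite mem_index_iota ltnNge ij andbF.
rewrite (@big_cat_nat _ _ _ (N - i) 0 N)//= ?leq_subr//.
rewrite [X in _ + X]big1_seq ?addr0; last first.
  move=> j /andP[ij]; rewrite mem_index_iota => /andP[ji _].
  by move: ij ji; lia.
rewrite -{1}[nat_of_ord i]add0n big_addn.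
rewrite [LHS]big_seq_cond [RHS]big_seq_cond; apply: eq_big => [j|j].
  rewrite mem_index_iota; have := ltn_ord i; lia.
by move=> _; rewrite addnK.
Qed.

Section real_sequences.
Context {R : realType}.
Implicit Types (p q : nat -> R) (b r : R).

Lemma conv_ge0 p q : (forall n, 0 <= p n) -> (forall n, 0 <= q n) ->
  forall n, 0 <= conv p q n.
Proof. by move=> p0 q0 n; apply: sumr_ge0 => i _; rewrite mulr_ge0. Qed.

Lemma series_conv_le p q N : (forall n, 0 <= p n) -> (forall n, 0 <= q n) ->
  series (conv p q) N <= series p N * series q N.
Proof.
move=> p0 q0; rewrite /series /= sum_conv !big_mkord mulr_suml ler_sum// => i _.
rewrite mulr_sumr [leRHS](bigID (fun j : 'I_N => (i + j < N)%N)) /= lerDl.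
by apply: sumr_ge0 => j _; rewrite mulr_ge0.
Qed.

Lemma series_conv_ge p q N : (forall n, 0 <= p n) -> (forall n, 0 <= q n) ->
  series p N * series q N <= series (conv p q) N.*2.
Proof.
move=> p0 q0; rewrite /series /= sum_conv !big_mkord mulr_suml.
have le2 : (N <= N.*2)%N by lia.
rewrite (big_ord_widen _ (fun i => p i * (\sum_(j < N) q j)) le2) [leRHS](bigID (fun j : 'I_N.*2 => (j < N)%N)) /=.
rewrite -[leLHS]addr0 lerD//; last first.
  by apply: sumr_ge0 => i _; apply: sumr_ge0 => j _; rewrite mulr_ge0.
apply: ler_sum => i iN; rewrite (big_ord_widen _ q le2) mulr_sumr.
rewrite [leRHS](bigID (fun j : 'I_N.*2 => (j < N)%N)) /=.
rewrite -[leLHS]addr0 lerD//; last first.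
  by apply: sumr_ge0 => j _; rewrite mulr_ge0.
rewrite le_eqVlt; apply/orP; left; apply/eqP; apply: eq_bigl => j.
by apply/idP/idP; lia.
Qed.

Lemma series_nneg_nd p : (forall n, 0 <= p n) -> nondecreasing_seq (series p).
Proof.
by move=> p0; apply/nondecreasing_seqP => n; rewrite seriesSr lerDl.
Qed.

Lemma is_cvg_series_bounded p M : (forall n, 0 <= p n) ->
  (forall N, series p N <= M) -> cvgn (series p).
Proof.
move=> p0 pM; apply: nondecreasing_is_cvgn; first exact: series_nneg_nd.
by exists M => _ [n _ <-].
Qed.

Lemma series_le_lim p : (forall n, 0 <= p n) -> cvgn (series p) ->
  forall N, series p N <= limn (series p).
Proof. by move=> p0 pc N; apply: nondecreasing_cvgn_le => //; exact: series_nneg_nd. Qed.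

(* The coefficient of u^n in (1 - u)^(-b). *)
Definition nbin b (n : nat) : R := locked (rising b n / n`!%:R).

Lemma nbinE b n : nbin b n = rising b n / n`!%:R.
Proof. by rewrite /nbin -lock. Qed.

Lemma nbin0 b : nbin b 0 = 1.
Proof. by rewrite nbinE /rising big_ord0 fact0 divr1. Qed.

Lemma nbinS b n : n.+1%:R * nbin b n.+1 = (b + n%:R) * nbin b n.
Proof.
rewrite !nbinE /rising big_ord_recr /= factS natrM invfM.
have : n.+1%:R != 0 :> R by rewrite pnatr_eq0.
have : n`!%:R != 0 :> R by rewrite pnatr_eq0 -lt0n fact_gt0.
by move=> h1 h2; field; rewrite h1 nat1r h2.
Qed.

Lemma nbinSE b n : nbin b n.+1 = (b + n%:R) / n.+1%:R * nbin b n.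
Proof. by rewrite mulrAC -nbinS mulrC mulKf // pnatr_eq0. Qed.

Lemma nbin_ge0 b n : 0 <= b -> 0 <= nbin b n.
Proof.
move=> b0; elim: n => [|n IH]; first by rewrite nbin0.
by rewrite nbinSE mulr_ge0// divr_ge0// addr_ge0.
Qed.

Lemma ler_nbin b b' n : 0 <= b <= b' -> nbin b n <= nbin b' n.
Proof.
move=> /andP[b0 bb']; elim: n => [|n IH]; first by rewrite !nbin0.
rewrite !nbinSE ler_pM ?nbin_ge0//; first by rewrite divr_ge0// addr_ge0.
by rewrite ler_pM2r ?invr_gt0// lerD2r.
Qed.

Lemma nbin_norm b n : `|nbin b n| <= nbin `|b| n.
Proof.
elim: n => [|n IH]; first by rewrite !nbin0 normr1.
rewrite !nbinSE normrM ler_pM//.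
rewrite normrM normfV [`|n.+1%:R|]normr_nat ler_pM2r ?invr_gt0//.
by rewrite (le_trans (ler_normD _ _))// normr_nat.
Qed.

(** Coefficient form of d/du (1 - u)^(-b) = b (1 - u)^(-(b + 1)). *)
Lemma nbin_shift b n : n.+1%:R * nbin b n.+1 = b * nbin (b + 1) n.
Proof.
rewrite nbinS; elim: n => [|n IH]; first by rewrite !nbin0 addr0.
apply: (mulfI (_ : n.+1%:R != 0)); first by rewrite pnatr_eq0.
have -> : n.+1%:R * (b * nbin (b + 1) n.+1) = b * ((b + 1 + n%:R) * nbin (b + 1) n).
  by rewrite -nbinS mulrCA.
have -> : n.+1%:R * ((b + n.+1%:R) * nbin b n.+1) = (b + n.+1%:R) * (n.+1%:R * nbin b n.+1).
  by rewrite mulrCA.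
by rewrite nbinS IH -natr1; ring.
Qed.

(** Coefficient form of (1 - u)^(-b) = (1 - u) (1 - u)^(-(b + 1)). *)
Lemma nbin_pascal b n : nbin (b + 1) n.+1 = nbin b n.+1 + nbin (b + 1) n.
Proof.
apply: (mulfI (_ : n.+1%:R != 0)); first by rewrite pnatr_eq0.
by rewrite mulrDr nbinS nbin_shift -natr1; ring.
Qed.

Lemma series_nbin b N : series (nbin b) N.+1 = nbin (b + 1) N.
Proof.
elim: N => [|N IH]; first by rewrite /series /= big_nat1 !nbin0.
by rewrite seriesSr IH nbin_pascal addrC.
Qed.

Lemma nbin1 n : nbin 1 n = 1.
Proof. by elim: n => [|n IH]; rewrite ?nbin0// nbinSE IH nat1r mulr1 divff. Qed.

Lemma conv_nbin a b : conv (nbin a) (nbin b) = nbin (a + b).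
Proof.
apply/funext; elim => [|n IH].
  by rewrite /conv big_ord1 subnn !nbin0 mulr1.
apply: (mulfI (_ : n.+1%:R != 0)); first by rewrite pnatr_eq0.
rewrite nbinS -IH /conv.
(* Leibniz rule: the weight n + 1 splits as i + (n + 1 - i), [nbinS] lowers one index in each part,
   and the factors recombine as (a + i) + (b + n - i) = a + b + n. *)
transitivity (\sum_(i < n.+2) (i%:R * nbin a i * nbin b (n.+1 - i)%N) +
   \sum_(i < n.+2) (nbin a i * ((n.+1 - i)%N%:R * nbin b (n.+1 - i)%N))).
  rewrite -big_split mulr_sumr; apply: eq_bigr => i _ /=.
  rewrite natrB; last by rewrite -ltnS.
  by ring.
rewrite big_ord_recl mul0r mul0r add0r [X in _ + X]big_ord_recr /= subnn mul0r mulr0 addr0.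
rewrite -big_split mulr_sumr; apply: eq_bigr => i _ /=.
have ni : (i <= n)%N by rewrite -ltnS.
rewrite /bump leq0n add1n subSS nbinS subSn// nbinS natrB//; ring.
Qed.

(** For an integer exponent the series is an m-fold product of geometric series, so bounds on
    partial sums suffice. A real exponent b is then dominated by an integer above |b|, through
    [nbin_norm] and [ler_nbin]. *)
Lemma series_nbin_bounded (m : nat) r : 0 <= r < 1 -> forall N,
  series (fun n => nbin m%:R n * r ^+ n) N <= (1 - r)^-1 ^+ m.
Proof.
move=> /andP[r0 r1] N; elim: m => [|m IH].
  have nbin00 n : nbin (0 : R) n = (n == 0%N)%:R.
    by elim: n => [|n IHn]; rewrite ?nbin0// nbinSE IHn; case: n {IHn} => //= *; rewrite ?mulr0// add0r !mul0r.
  rewrite expr0 /series /= mulr0n; case: N => [|N]; first by rewrite big_nil.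
  rewrite big_nat_recl// nbin0 expr0 mulr1 big1 ?addr0// => i _.
  by rewrite nbin00 mul0r.
have nn n : 0 <= nbin m%:R n * r ^+ n by rewrite mulr_ge0 ?nbin_ge0 ?exprn_ge0.
have -> : (fun n => nbin m.+1%:R n * r ^+ n) =
    conv (fun n => nbin m%:R n * r ^+ n) (fun n => r ^+ n).
  apply/funext => n; rewrite -natr1 -conv_nbin /conv mulr_suml.
  apply: eq_bigr => i _; rewrite nbin1 mulr1 -[RHS]mulrA; congr (_ * _).
  rewrite -exprD subnKC//.
  by have := ltn_ord i; rewrite ltnS.
rewrite exprSr (le_trans (series_conv_le _ _ _)) => // [n|]; first exact: exprn_ge0.
rewrite ler_pM//.
- by apply: sumr_ge0.
- by apply: sumr_ge0 => n _; exact: exprn_ge0.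
have [->|rN0] := eqVneq r 0.
  rewrite subr0 invr1 /series /=.
  case: N {IH} => [|N]; first by rewrite big_nil.
  by rewrite big_nat_recl// expr0 big1 ?addr0// => i _; rewrite expr0n.
have := @geometric_le_lim R N 1 r ler01.
rewrite mul1r ger0_norm// => /(_ _ r1); rewrite lt_def rN0 r0 => /(_ isT).
by rewrite /series /=; under eq_bigr do rewrite mul1r.
Qed.

Lemma is_cvg_series_nbin_norm b r : 0 <= r < 1 ->
  cvgn (series (fun n => `|nbin b n| * r ^+ n)).
Proof.
move=> r01; have /andP[r0 r1] := r01.
pose m := (Num.truncn `|b|).+1.
have bm : `|b| <= m%:R by apply/ltW; rewrite truncnS_gt.
apply: (@is_cvg_series_bounded _ ((1 - r)^-1 ^+ m)) => [n|N].
  by rewrite mulr_ge0// exprn_ge0.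
apply: le_trans (series_nbin_bounded m r01 N).
apply: ler_sum => n _; rewrite ler_wpM2r ?exprn_ge0//.
by rewrite (le_trans (nbin_norm _ _))// ler_nbin// normr_ge0 bm.
Qed.

(** The bounded factors [c] stand for the real or imaginary parts of z^n with |z| <= 1. *)
Lemma is_cvg_pseries_nbin b c r : (forall n, `|c n| <= 1) -> 0 <= r < 1 ->
  cvgn (pseries (fun n => nbin b n * c n) r).
Proof.
move=> c1 r01; have /andP[r0 r1] := r01; apply: normed_cvg.
have h := @is_cvg_series_nbin_norm b r r01.
apply: (series_le_cvg _ _ _ h) => n /=; first exact: normr_ge0.
  by rewrite mulr_ge0// exprn_ge0.
rewrite !normrM normrX (ger0_norm r0) ler_wpM2r ?exprn_ge0//.
by rewrite ler_piMr.
Qed.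

End real_sequences.

(** * Dominated convergence of series *)

Section tannery.
Context {R : realType}.
Implicit Types (a M : nat -> R).

Lemma is_cvg_series_dominated a M : cvgn (series M) ->
  (forall n, `|a n| <= M n) -> cvgn (series a).
Proof.
move=> cM aM; apply: normed_cvg; rewrite /normed_series_of /=.
apply: (series_le_cvg _ _ _ cM) => n //=.
exact: le_trans (aM n).
Qed.

Lemma series_tail_le a M N : cvgn (series M) -> (forall n, `|a n| <= M n) ->
  `|limn (series a) - series a N| <= limn (series M) - series M N.
Proof.
move=> cM aM; have ca := is_cvg_series_dominated cM aM.
have h : \forall n \near \oo, `|series a n - series a N| <= series M n - series M N.
  near=> n; have Nn : (N <= n)%N by near: n; exact: nbhs_infty_ge.
  rewrite !sub_series_geq// (le_trans (ler_norm_sum _ _ _))//.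
  exact: ler_sum.
apply: (ler_cvg_to _ _ h).
  by apply: cvg_norm; apply: cvgB => //; exact: cvg_cst.
by apply: cvgB => //; exact: cvg_cst.
Unshelve. all: end_near. Qed.

(** The tails are bounded by those of [M] uniformly in x, and a finite sum passes to the limit. An
    arbitrary filter is allowed: partial sums, steps h -> 0+, and steps dividing a fixed t all occur
    below. *)
Lemma tannery (T : Type) (F : set_system T) {FF : Filter F}
    (a : T -> nat -> R) (A M : nat -> R) : cvgn (series M) ->
  (forall n, `|A n| <= M n) ->
  (\forall x \near F, forall n, `|a x n| <= M n) ->
  (forall n, a x n @[x --> F] --> A n) ->
  limn (series (a x)) @[x --> F] --> limn (series A).
Proof.
move=> cM AM aM aA; apply/cvgrPdist_lt => e e0.
have [N hN] : exists N, limn (series M) - series M N < e / 3.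
  have /cvgrPdist_lt/(_ (e / 3)) : series M @ \oo --> limn (series M) by [].
  have e3 : 0 < e / 3 by rewrite divr_gt0.
  move=> /(_ e3) [N _ /(_ N (leqnn _)) hN]; exists N.
  exact: le_lt_trans (ler_norm _) hN.
have sN : series (a x) N @[x --> F] --> series A N.
  rewrite /series /=; elim: N {hN} => [|N IH].
    by under eq_fun do rewrite big_nil; rewrite big_nil; exact: cvg_cst.
  under eq_fun do rewrite big_nat_recr//=.
  by rewrite big_nat_recr//=; apply: cvgD.
move/cvgrPdist_lt : sN => /(_ (e / 3)) sN.
have {}sN := sN (divr_gt0 e0 (ltr0Sn _ 2)).
near=> x.
have h1 : `|limn (series A) - series A N| < e / 3.
  exact: le_lt_trans (series_tail_le N cM AM) hN.
have h2 : `|limn (series (a x)) - series (a x) N| < e / 3.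
  apply: le_lt_trans hN; apply: series_tail_le => //; near: x; exact: aM.
have h3 : `|series A N - series (a x) N| < e / 3 by near: x; exact: sN.
have -> : limn (series A) - limn (series (a x)) = (limn (series A) - series A N) +
   ((series A N - series (a x) N) - (limn (series (a x)) - series (a x) N)) by ring.
rewrite (le_lt_trans (ler_normD _ _))//.
have := ler_normB (series A N - series (a x) N) (limn (series (a x)) - series (a x) N).
lra.
Unshelve. all: end_near. Qed.

Lemma lim_series_finite a N : (forall n, (N <= n)%N -> a n = 0) ->
  limn (series a) = series a N.
Proof.
move=> a0; apply: (@cvg_lim _ (@Rhausdorff R)).
apply: cvg_near_cst; near=> n.
have Nn : (N <= n)%N by near: n; exact: nbhs_infty_ge.
apply/eqP; rewrite -subr_eq0 sub_series_geq// big_nat big1// => i /andP[Ni _].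
exact: a0.
Unshelve. all: end_near. Qed.

Lemma cvg_continuous_comp (T : Type) (F : set_system T) {FF : Filter F}
    (f : T -> R) (g : R -> R) (l : R) : {for l, continuous g} ->
  f x @[x --> F] --> l -> g (f x) @[x --> F] --> g l.
Proof. by move=> cg fl; apply: (cvg_comp _ _ fl cg). Qed.

End tannery.

(** * The binomial series on the unit disc *)

Section binomial_series.
Context {R : realType}.
Implicit Types (b s a d : R) (z : R[i]).

(** With [is_derive_expsin], the real and imaginary parts of the derivative of exp (b (L + i A)),
    that is of a power of base with log-modulus L and argument A. *)
Lemma is_derive_expcos b (L A : R -> R) s l a :
  is_derive s 1 L l -> is_derive s 1 A a ->
  is_derive s 1 (fun s => expR (b * L s) * cos (b * A s))
    (b * (l * (expR (b * L s) * cos (b * A s)) - a * (expR (b * L s) * sin (b * A s)))).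
Proof.
move=> dL dA.
have h1 : is_derive s 1 (fun s => expR (b * L s)) (expR (b * L s) * (b * l)).
  exact: (@is_derive1_comp _ expR (fun s => b * L s)).
have h2 : is_derive s 1 (fun s => cos (b * A s)) (- sin (b * A s) * (b * a)).
  exact: (@is_derive1_comp _ cos (fun s => b * A s)).
apply: (is_derive_eq (is_deriveM h1 h2)).
by rewrite /GRing.scale /=; ring.
Qed.

Lemma is_derive_expsin b (L A : R -> R) s l a :
  is_derive s 1 L l -> is_derive s 1 A a ->
  is_derive s 1 (fun s => expR (b * L s) * sin (b * A s))
    (b * (l * (expR (b * L s) * sin (b * A s)) + a * (expR (b * L s) * cos (b * A s)))).
Proof.
move=> dL dA.
have h1 : is_derive s 1 (fun s => expR (b * L s)) (expR (b * L s) * (b * l)).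
  exact: (@is_derive1_comp _ expR (fun s => b * L s)).
have h2 : is_derive s 1 (fun s => sin (b * A s)) (cos (b * A s) * (b * a)).
  exact: (@is_derive1_comp _ sin (fun s => b * A s)).
apply: (is_derive_eq (is_deriveM h1 h2)).
by rewrite /GRing.scale /=; ring.
Qed.

Lemma affine_gt0 a s : `|a| <= 1 -> `|s| < 1 -> 0 < 1 - s * a.
Proof.
move=> a1 s1; rewrite subr_gt0 (le_lt_trans (ler_norm _))// normrM.
by rewrite (le_lt_trans _ s1)// ler_piMr.
Qed.

Lemma is_derive_affine a s : is_derive s 1 (fun s => 1 - s * a) (- a).
Proof.
apply: is_derive_eq; rewrite /GRing.scale /=; ring.
Qed.

(** Here and in [is_derive_argument]: the real and imaginary parts of d/ds log (1 - s z) = - z / (1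
    - s z), where z = a + i d. The arctangent is the argument because 1 - s z stays in the right
    half-plane. *)
Lemma is_derive_modulus a d s : 0 < 1 - s * a ->
  is_derive s 1 (fun s => 2^-1 * ln ((1 - s * a) ^+ 2 + (- (s * d)) ^+ 2))
    ((- (1 - s * a) * a - (- (s * d)) * d) / ((1 - s * a) ^+ 2 + (- (s * d)) ^+ 2)).
Proof.
move=> x0.
have D0 : 0 < (1 - s * a) ^+ 2 + (- (s * d)) ^+ 2.
  by rewrite ltr_pwDl ?sqr_ge0// exprn_gt0.
have h1 : is_derive s 1 (fun s => (1 - s * a) ^+ 2 + (- (s * d)) ^+ 2)
    (2 * ((- (1 - s * a) * a - (- (s * d)) * d))).
  by apply: is_derive_eq; rewrite /GRing.scale /=; ring.
have h2 : is_derive s 1 (fun s => ln ((1 - s * a) ^+ 2 + (- (s * d)) ^+ 2))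
   (((1 - s * a) ^+ 2 + (- (s * d)) ^+ 2)^-1 * (2 * ((- (1 - s * a) * a - (- (s * d)) * d)))).
  apply: (@is_derive1_comp _ (@ln R) (fun s => (1 - s * a) ^+ 2 + (- (s * d)) ^+ 2)).
  exact: is_derive1_ln.
apply: is_derive_eq.
by rewrite /GRing.scale /=; field; rewrite gt_eqF.
Qed.

Lemma is_derive_argument a d s : 0 < 1 - s * a ->
  is_derive s 1 (fun s => atan (- (s * d) / (1 - s * a)))
    ((- (1 - s * a) * d + (- (s * d)) * a) / ((1 - s * a) ^+ 2 + (- (s * d)) ^+ 2)).
Proof.
move=> x0.
have D0 : 0 < (1 - s * a) ^+ 2 + (- (s * d)) ^+ 2.
  by rewrite ltr_pwDl ?sqr_ge0// exprn_gt0.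
have xN0 : (1 - s * a) != 0 by rewrite gt_eqF.
have h0 : is_derive s 1 (fun s => (1 - s * a)^-1) (- (1 - s * a) ^- 2 *: (- a)).
  exact: (@is_deriveV _ (fun s => 1 - s * a) s (- a) 1 xN0 (is_derive_affine a s)).
have h1 : is_derive s 1 (fun s => - (s * d) / (1 - s * a))
    ((- d * (1 - s * a) - s * d * a) / (1 - s * a) ^+ 2).
  apply: is_derive_eq; rewrite /GRing.scale /=.
  by field.
have h2 := @is_derive1_comp _ atan _ s _ _ (is_derive1_atan _) h1.
apply: (is_derive_eq h2).
rewrite /GRing.scale /=; field.
by rewrite xN0 andbT gt_eqF.
Qed.

Definition re_pow (a d : R) n : R := complex.Re ((a +i* d)%C ^+ n).
Definition im_pow (a d : R) n : R := complex.Im ((a +i* d)%C ^+ n).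

Lemma re_powS a d n : re_pow a d n.+1 = a * re_pow a d n - d * im_pow a d n.
Proof. by rewrite /re_pow /im_pow exprS; case: (_ ^+ n) => x y /=. Qed.

Lemma im_powS a d n : im_pow a d n.+1 = a * im_pow a d n + d * re_pow a d n.
Proof. by rewrite /re_pow /im_pow exprS; case: (_ ^+ n) => x y /=; rewrite addrC. Qed.

Lemma re_im_pow_norm a d n : a ^+ 2 + d ^+ 2 <= 1 -> (re_pow a d n) ^+ 2 + (im_pow a d n) ^+ 2 <= 1.
Proof.
move=> ad1; elim: n => [|n IH]; first by rewrite /re_pow /im_pow expr0 /=; lra.
rewrite re_powS im_powS.
have -> : (a * re_pow a d n - d * im_pow a d n) ^+ 2 + (a * im_pow a d n + d * re_pow a d n) ^+ 2 =
  (a ^+ 2 + d ^+ 2) * (re_pow a d n ^+ 2 + im_pow a d n ^+ 2) by ring.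
by rewrite mulr_ile1// addr_ge0// sqr_ge0.
Qed.

Lemma re_pow_norm a d n : a ^+ 2 + d ^+ 2 <= 1 -> `|re_pow a d n| <= 1.
Proof.
move=> /(re_im_pow_norm n) h; rewrite -(@ler_pXn2r _ 2)// ?nnegrE// expr1n real_normK ?num_real//.
by apply: le_trans h; rewrite lerDl sqr_ge0.
Qed.

Lemma im_pow_norm a d n : a ^+ 2 + d ^+ 2 <= 1 -> `|im_pow a d n| <= 1.
Proof.
move=> /(re_im_pow_norm n) h; rewrite -(@ler_pXn2r _ 2)// ?nnegrE// expr1n real_normK ?num_real//.
by apply: le_trans h; rewrite lerDr sqr_ge0.
Qed.

Lemma is_cvg_pseries_nbin_lt1 b (c : nat -> R) s : (forall n, `|c n| <= 1) -> `|s| < 1 ->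
  cvgn (pseries (fun n => nbin b n * c n) s).
Proof.
move=> c1 s1.
apply: (@is_cvg_pseries_inside _ _ ((1 + `|s|) / 2)).
  have ?: 0 <= `|s| by [].
  by apply: is_cvg_pseries_nbin => //; apply/andP; split; lra.
have ?: 0 <= `|s| by [].
by rewrite [ltRHS]ger0_norm; lra.
Qed.

(** For [c] equal to [re_pow a d] or [im_pow a d], this will be the real or imaginary part of (1 - s
    z)^(-b), z = a + i d. *)
Definition nbin_sum b (c : nat -> R) s : R := limn (pseries (fun n => nbin b n * c n) s).

Lemma diffs_nbin b (c : nat -> R) :
  pseries_diffs (fun n => nbin b n * c n) = (fun n => b * (nbin (b + 1) n * c n.+1)).
Proof. by apply/funext => n; rewrite /pseries_diffs mulrA nbin_shift mulrA. Qed.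

Lemma is_cvg_pseriesZ k (c : nat -> R) s : cvgn (pseries c s) ->
  cvgn (pseries (fun n => k * c n) s) /\
  limn (pseries (fun n => k * c n) s) = k * limn (pseries c s).
Proof.
move=> h; have h2 : pseries (fun n => k * c n) s @ \oo --> k * limn (pseries c s).
  have -> : pseries (fun n => k * c n) s = (fun N => k * pseries c s N).
    apply/funext => N; rewrite /pseries /series /= mulr_sumr.
    by apply: eq_bigr => i _; rewrite mulrA.
  exact: cvgMl_tmp.
by split; [apply/cvg_ex; eexists; exact: h2 | exact: cvg_lim].
Qed.

Lemma is_derive_nbin_sum b (c : nat -> R) s : (forall n, `|c n| <= 1) -> `|s| < 1 ->
  is_derive s 1 (nbin_sum b c) (b * nbin_sum (b + 1) (fun n => c n.+1) s).
Proof.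
move=> c1 s1; have s0 : 0 <= `|s| by [].
(* [pseries_snd_diffs] asks that the series and its first two derived series converge at a point of
   modulus larger than |s|; the midpoint of |s| and 1 is such a point. *)
pose K := (1 + `|s|) / 2.
have K01 : 0 <= K < 1 by rewrite /K; apply/andP; split; lra.
have sK : `|s| < `|K| by rewrite [ltRHS]ger0_norm /K; lra.
have h1 := @is_cvg_pseries_nbin _ b c K c1 K01.
have h2 := @is_cvg_pseries_nbin _ (b + 1) (fun n => c n.+1) K (fun n => c1 n.+1) K01.
have h3 := @is_cvg_pseries_nbin _ (b + 1 + 1) (fun n => c n.+2) K (fun n => c1 n.+2) K01.
have g1 : cvgn (pseries (pseries_diffs (fun n => nbin b n * c n)) K).
  by rewrite diffs_nbin; exact: (is_cvg_pseriesZ b h2).1.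
have g2 : cvgn (pseries (pseries_diffs (pseries_diffs (fun n => nbin b n * c n))) K).
  rewrite diffs_nbin (_ : pseries_diffs _ = (fun n => (b * (b + 1)) * (nbin (b + 1 + 1) n * c n.+2))).
    exact: (is_cvg_pseriesZ _ h3).1.
  apply/funext => n; rewrite /pseries_diffs.
  by rewrite mulrCA [_.+1%:R * (nbin _ _ * _)]mulrA nbin_shift !mulrA.
have := pseries_snd_diffs h1 g1 g2 sK.
rewrite diffs_nbin (is_cvg_pseriesZ _ _).2//.
exact: (@is_cvg_pseries_nbin_lt1 (b + 1) (fun n => c n.+1)).
Qed.

Lemma nbin_sum_cvg b (c : nat -> R) s : (forall n, `|c n| <= 1) -> `|s| < 1 ->
  pseries (fun n => nbin b n * c n) s @ \oo --> nbin_sum b c s.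
Proof. by move=> c1 s1; exact: (@is_cvg_pseries_nbin_lt1 b c s). Qed.

(** Pascal's rule summed: it raises the exponent to b + 1, the one that the derivative produces. *)
Lemma nbin_sum_shift b (c : nat -> R) s : (forall n, `|c n| <= 1) -> `|s| < 1 ->
  nbin_sum b c s = nbin_sum (b + 1) c s - s * nbin_sum (b + 1) (fun n => c n.+1) s.
Proof.
move=> c1 s1.
have h1 := @nbin_sum_cvg b c s c1 s1.
have h2 := @nbin_sum_cvg (b + 1) c s c1 s1.
have h3 := @nbin_sum_cvg (b + 1) (fun n => c n.+1) s (fun n => c1 n.+1) s1.
have h4 : (fun N => pseries (fun n => nbin (b + 1) n * c n) s N.+1 -
   s * pseries (fun n => nbin (b + 1) n * c n.+1) s N) @ \oo -->
   nbin_sum (b + 1) c s - s * nbin_sum (b + 1) (fun n => c n.+1) s.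
  apply: cvgB; last exact: cvgMl_tmp.
  by move: h2; rewrite -(cvg_shiftS (pseries _ s)).
move: h1; rewrite -(cvg_shiftS (pseries _ s)) => h1.
rewrite -(cvg_lim (@Rhausdorff R) h1) -(cvg_lim (@Rhausdorff R) h4); congr (lim (_ @ \oo)).
apply/funext => N /=; rewrite /pseries /series /= !big_nat_recl// !nbin0.
rewrite mulr_sumr -addrA; congr (_ + _); rewrite -sumrB; apply: eq_bigr => i _.
by rewrite nbin_pascal exprS; ring.
Qed.

Lemma nbin_sum_lin b (k l : R) (c1 c2 : nat -> R) s :
  (forall n, `|c1 n| <= 1) -> (forall n, `|c2 n| <= 1) -> `|s| < 1 ->
  (forall n, `|k * c1 n + l * c2 n| <= 1) ->
  nbin_sum b (fun n => k * c1 n + l * c2 n) s = k * nbin_sum b c1 s + l * nbin_sum b c2 s.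
Proof.
move=> h1 h2 s1 h3.
have H1 := @nbin_sum_cvg b c1 s h1 s1.
have H2 := @nbin_sum_cvg b c2 s h2 s1.
have H3 := @nbin_sum_cvg b _ s h3 s1.
rewrite -(cvg_lim (@Rhausdorff R) H3); apply: (@cvg_lim _ (@Rhausdorff R)).
have -> : pseries (fun n => nbin b n * (k * c1 n + l * c2 n)) s =
  (fun N => k * pseries (fun n => nbin b n * c1 n) s N + l * pseries (fun n => nbin b n * c2 n) s N).
  apply/funext => N; rewrite /pseries /series /= !mulr_sumr -big_split.
  by apply: eq_bigr => i _ /=; ring.
by apply: cvgD; exact: cvgMl_tmp.
Qed.

Lemma nbin_sum0 b (c : nat -> R) : nbin_sum b c 0 = c 0%N.
Proof.
apply: (@cvg_lim _ (@Rhausdorff R)); rewrite -(cvg_shiftS (pseries _ 0)).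
rewrite (_ : (fun n => _) = (fun=> c 0%N)); first exact: cvg_cst.
apply/funext => N /=; rewrite /pseries /series /= big_nat_recl// nbin0 expr0 mulr1 mul1r.
by rewrite big1 ?addr0// => i _; rewrite expr0n mulr0.
Qed.

Definition log_norm (a d s : R) : R := 2^-1 * ln ((1 - s * a) ^+ 2 + (- (s * d)) ^+ 2).
Definition arg_frac (a d s : R) : R := atan (- (s * d) / (1 - s * a)).

Lemma cst_on_unit (f : R -> R) s : (forall t : R, `|t| < 1 -> is_derive t (1 : R) f 0) -> `|s| < 1 ->
  f s = f 0.
Proof.
move=> df s1.
have H a b : `|a| < 1 -> `|b| < 1 -> a <= b -> f b = f a.
  move=> a1 b1 ab.
  have ab1 x : x \in `[a, b] -> `|x| < 1.
    by rewrite in_itv /= => /andP[ax xb]; move: a1 b1; rewrite !ltr_norml; lra.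
  have [||c _] := @MVT_segment R f (fun=> 0) a b ab.
  - by move=> x xab; apply: df; apply: ab1; exact: subset_itv_oo_cc xab.
  - apply: derivable_within_continuous => x /ab1 x1.
    by have [] := df _ x1.
  by rewrite mul0r => /eqP; rewrite subr_eq0 => /eqP.
have [s0|/ltW s0] := lerP 0 s.
  by apply: H => //; rewrite normr0.
by apply/esym; apply: H => //; rewrite normr0.
Qed.

(* With z = a + i d, the product of the series of (1 - s z)^(-b) by (1 - s z)^b,
   split into real and imaginary parts, has derivative 0 in s. *)
Lemma binomial_ode b a d s : a ^+ 2 + d ^+ 2 <= 1 -> `|s| < 1 ->
  nbin_sum b (re_pow a d) s * (expR (b * log_norm a d s) * cos (b * arg_frac a d s)) -
  nbin_sum b (im_pow a d) s * (expR (b * log_norm a d s) * sin (b * arg_frac a d s)) = 1 /\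
  nbin_sum b (re_pow a d) s * (expR (b * log_norm a d s) * sin (b * arg_frac a d s)) +
  nbin_sum b (im_pow a d) s * (expR (b * log_norm a d s) * cos (b * arg_frac a d s)) = 0.
Proof.
move=> ad1 s1.
have a1 : `|a| <= 1.
  by rewrite -(@ler_pXn2r _ 2)// ?nnegrE// expr1n real_normK ?num_real//; nra.
have e1 n := @re_pow_norm a d n ad1. have o1 n := @im_pow_norm a d n ad1.
(* Shifting the index multiplies z^n by z, which mixes real and imaginary parts. *)
have eS1 t : `|t| < 1 -> nbin_sum (b + 1) (fun n => re_pow a d n.+1) t =
   a * nbin_sum (b + 1) (re_pow a d) t + (- d) * nbin_sum (b + 1) (im_pow a d) t.
  move=> t1; rewrite -nbin_sum_lin//; last by move=> n; rewrite mulNr -re_powS.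
  by congr nbin_sum; apply/funext => n; rewrite re_powS mulNr.
have oS1 t : `|t| < 1 -> nbin_sum (b + 1) (fun n => im_pow a d n.+1) t =
   a * nbin_sum (b + 1) (im_pow a d) t + d * nbin_sum (b + 1) (re_pow a d) t.
  move=> t1; rewrite -nbin_sum_lin//; last by move=> n; rewrite -im_powS.
  by congr nbin_sum; apply/funext => n; rewrite im_powS.
have dU t (t1 : `|t| < 1) := is_derive_nbin_sum b e1 t1.
have dV t (t1 : `|t| < 1) := is_derive_nbin_sum b o1 t1.
have dC t (t1 : `|t| < 1) := is_derive_expcos b (is_derive_modulus d (affine_gt0 a1 t1)) (is_derive_argument d (affine_gt0 a1 t1)).
have dS t (t1 : `|t| < 1) := is_derive_expsin b (is_derive_modulus d (affine_gt0 a1 t1)) (is_derive_argument d (affine_gt0 a1 t1)).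
have DN0 t : `|t| < 1 -> (1 - t * a) ^+ 2 + (- (t * d)) ^+ 2 != 0.
  by move=> t1; have x0 := affine_gt0 a1 t1; rewrite gt_eqF// ltr_pwDl ?sqr_ge0// exprn_gt0.
have L0 : log_norm a d 0 = 0 by rewrite /log_norm !mul0r subr0 oppr0 expr0n addr0 expr1n ln1 mulr0.
have A0 : arg_frac a d 0 = 0 by rewrite /arg_frac !mul0r oppr0 mul0r atan0.
split.
- rewrite [LHS](cst_on_unit (f := fun s => nbin_sum b (re_pow a d) s * (expR (b * log_norm a d s) * cos (b * arg_frac a d s)) -
    nbin_sum b (im_pow a d) s * (expR (b * log_norm a d s) * sin (b * arg_frac a d s)))) //.
    rewrite L0 A0 !nbin_sum0 mulr0 expR0 sin0 cos0 /re_pow /im_pow expr0 /=.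
    by rewrite !mulr1 mul0r subr0.
  move=> t t1.
  (* Once the sums of exponent b are rewritten through those of exponent b + 1, the vanishing of the
     derivative is a rational identity with denominator |1 - t z|^2. *)
  apply: (is_derive_eq (is_deriveB (is_deriveM (dU t t1) (dC t t1)) (is_deriveM (dV t t1) (dS t t1)))).
  rewrite /GRing.scale /= -/(log_norm a d t) -/(arg_frac a d t) (nbin_sum_shift b e1 t1) (nbin_sum_shift b o1 t1) eS1// oS1//.
  by field; exact: DN0.
- rewrite [LHS](cst_on_unit (f := fun s => nbin_sum b (re_pow a d) s * (expR (b * log_norm a d s) * sin (b * arg_frac a d s)) +
    nbin_sum b (im_pow a d) s * (expR (b * log_norm a d s) * cos (b * arg_frac a d s)))) //.
    rewrite L0 A0 !nbin_sum0 mulr0 expR0 sin0 cos0 /re_pow /im_pow expr0 /=.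
    by rewrite !mulr0 mul0r addr0.
  move=> t t1.
  apply: (is_derive_eq (is_deriveD (is_deriveM (dU t t1) (dS t t1)) (is_deriveM (dV t t1) (dC t t1)))).
  rewrite /GRing.scale /= -/(log_norm a d t) -/(arg_frac a d t) (nbin_sum_shift b e1 t1) (nbin_sum_shift b o1 t1) eS1// oS1//.
  by field; exact: DN0.
Qed.

End binomial_series.

(** * Complex limits through real and imaginary parts *)

Section complex_limits.
Context {R : realType}.

Lemma cvg_complex (T : Type) (F : set_system T) {FF : Filter F} (w : T -> R[i]^o) (l : R[i]) :
  complex.Re (w x) @[x --> F] --> complex.Re l ->
  complex.Im (w x) @[x --> F] --> complex.Im l ->
  w x @[x --> F] --> (l : R[i]^o).
Proof.
move=> hr hi; apply/cvgrPdist_lt => e e0.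
(* A positive element of [R[i]] is real, so the tolerance may be replaced by its real part. *)
have e0' : 0 < complex.Re e by move: e0; rewrite ltcE => /andP[].
have eE : e = (complex.Re e)%:C%C.
  by move: e0; rewrite ltcE => /andP[/eqP /= h _]; case: e {e0'} h => x y /= ->.
have e2 : 0 < complex.Re e / 2 by rewrite divr_gt0.
move/cvgrPdist_lt/(_ _ e2): hr => hr.
move/cvgrPdist_lt/(_ _ e2): hi => hi.
near=> x.
rewrite (_ : `|_| = (Num.sqrt (complex.Re (l - w x) ^+ 2 + complex.Im (l - w x) ^+ 2))%:C%C); last exact: normc_def.
have h1 : `|complex.Re l - complex.Re (w x)| < complex.Re e / 2 by near: x.
have h2 : `|complex.Im l - complex.Im (w x)| < complex.Re e / 2 by near: x.
rewrite [ltRHS]eE ltcR.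
move: h1 h2; case: (l) (w x) => lr li [wr wi] /= h1 h2.
rewrite -(@ltr_pXn2r _ 2)// ?nnegrE ?sqrtr_ge0 ?ltW//.
rewrite sqr_sqrtr ?addr_ge0 ?sqr_ge0//.
rewrite -(real_normK (num_real (lr - wr))) -(real_normK (num_real (li - wi))).
have := normr_ge0 (lr - wr); have := normr_ge0 (li - wi).
move: h1 h2; move: `|lr - wr| `|li - wi| (complex.Re e) => p q r h1 h2 q0 p0.
nra.
Unshelve. all: end_near. Qed.

Lemma cvg_Re (T : Type) (F : set_system T) {FF : Filter F} (w : T -> R[i]^o) (l : R[i]) :
  w x @[x --> F] --> (l : R[i]^o) -> complex.Re (w x) @[x --> F] --> complex.Re l.
Proof.
move=> /cvgrPdist_lt h; apply/cvgrPdist_lt => e e0.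
have e0' : 0 < e%:C%C by rewrite ltcR.
move: (h _ e0'); apply: filterS => x hx.
have := le_lt_trans (normc_ge_Re (l - w x)) hx; rewrite ltcR.
by case: (l) (w x) => ? ? [].
Qed.
End complex_limits.

(** * The principal power in the right half-plane *)

Section cpow.
Context {R : realType}.

Lemma half_double (x : R) : 2^-1 * (x *+ 2) = x.
Proof. by rewrite -(mulr_natr x) mulrCA mulVf ?mulr1 ?pnatr_eq0. Qed.

Lemma mulc_real (k x y : R) : k%:C%C * (x +i* y)%C = (k * x +i* (k * y))%C.
Proof. by apply/eqP; rewrite eq_complex /= !mul0r subr0 addr0 !eqxx. Qed.

(** Turns the arccosine of the definition into the arctangent that [is_derive_argument]
    differentiates; the sign of y decides on which side of 0 the arccosine is inverted. *)
Lemma carg_gt0 (x y : R) : 0 < x -> carg (x +i* y)%C = atan (y / x).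
Proof.
move=> x0; rewrite /carg /=.
have xy0 : 0 < Num.sqrt (1 + (y / x) ^+ 2) by rewrite sqrtr_gt0 ltr_pwDl ?sqr_ge0.
have -> : x / Num.sqrt (x ^+ 2 + y ^+ 2) = cos (atan (y / x)).
  rewrite cos_atan (_ : x ^+ 2 + y ^+ 2 = x ^+ 2 * (1 + (y / x) ^+ 2)).
    rewrite sqrtrM ?sqr_ge0// sqrtr_sqr gtr0_norm//.
    by field; rewrite !gt_eqF.
  by field; rewrite gt_eqF.
have pi0 := pi_gt0 R.
case: ifPn => [y0|]; last rewrite -ltNge => y0.
  rewrite cosK// in_itv /= -{1}atan0 le_atan ?divr_ge0 ?(ltW x0)//=.
  by have := atan_ltpi2 (y / x); lra.
have a0 : atan (y / x) <= 0.
  by rewrite -[leRHS](@atan0 R) le_atan// ltW// pmulr_llt0 ?invr_gt0.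
by rewrite cosKN ?opprK// a0 andbT; have := atan_gtNpi2 (y / x); lra.
Qed.

Lemma cpow_gt0 (x y p : R) : 0 < x ->
  cpow (x +i* y)%C p =
  (expR (p * (2^-1 * ln (x ^+ 2 + y ^+ 2))) * cos (p * atan (y / x)) +i*
   (expR (p * (2^-1 * ln (x ^+ 2 + y ^+ 2))) * sin (p * atan (y / x))))%C.
Proof.
move=> x0; rewrite /cpow carg_gt0//=.
have D0 : 0 < x ^+ 2 + y ^+ 2 by rewrite ltr_pwDl ?sqr_ge0 ?exprn_gt0.
have -> : Num.sqrt (x ^+ 2 + y ^+ 2) `^ p = expR (p * (2^-1 * ln (x ^+ 2 + y ^+ 2))).
  by rewrite -powR12_sqrt ?ltW// -powRrM /powR gt_eqF// mulrA [p * _]mulrC.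
by rewrite mulc_real.
Qed.

Lemma cpow_real (x p : R) : 0 < x -> cpow x%:C%C p = (x `^ p)%:C%C.
Proof.
move=> x0; rewrite cpow_gt0// expr0n addr0 mul0r atan0 mulr0 sin0 cos0 mulr1 mulr0.
rewrite /powR gt_eqF//; congr ((expR (p * _)) +i* _)%C.
by rewrite lnXn// half_double.
Qed.

Lemma cpow0 (p : R) : p != 0 -> cpow 0 p = 0 :> R[i].
Proof.
move=> p0; rewrite /cpow /= expr0n addr0 sqrtr0 powR0//.
by rewrite mul0r.
Qed.

Lemma cpowZ (k : R) (z : R[i]) (p : R) : 0 < k -> 0 < complex.Re z ->
  cpow (k%:C%C * z) p = (k `^ p)%:C%C * cpow z p.
Proof.
case: z => x y /= k0 x0.
rewrite mulc_real.
have kx0 : 0 < k * x by rewrite mulr_gt0.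
rewrite !cpow_gt0//.
have D0 : 0 < x ^+ 2 + y ^+ 2 by rewrite ltr_pwDl ?sqr_ge0 ?exprn_gt0.
have -> : k * y / (k * x) = y / x by field; rewrite !gt_eqF.
have -> : (k * x) ^+ 2 + (k * y) ^+ 2 = k ^+ 2 * (x ^+ 2 + y ^+ 2) by ring.
rewrite lnM ?posrE ?exprn_gt0// lnXn// mulrDr mulrDr expRD.
rewrite half_double.
by rewrite /powR gt_eqF// mulc_real !mulrA.
Qed.
End cpow.

Lemma cvg_near_eq (R : realType) (T : Type) (F : set_system T) {FF : ProperFilter F}
    (f g : T -> R) (l m : R) : f x @[x --> F] --> l -> g x @[x --> F] --> m ->
  (\forall x \near F, f x = g x) -> l = m.
Proof.
move=> fl gm fg; have gl : g x @[x --> F] --> l.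
  by apply: cvg_trans fl; apply: near_eq_cvg; apply: filterS fg.
by rewrite -(cvg_lim (@Rhausdorff R) gm) -(cvg_lim (@Rhausdorff R) gl).
Qed.

(** * The complex binomial series *)

Section complex_binomial.
Context {R : realType}.

Lemma Re_sum (I : Type) (r : seq I) (P : pred I) (F : I -> R[i]) :
  complex.Re (\sum_(i <- r | P i) F i) = \sum_(i <- r | P i) complex.Re (F i).
Proof. by apply: (big_morph (@complex.Re R)) => // -[? ?] [? ?]. Qed.

Lemma Im_sum (I : Type) (r : seq I) (P : pred I) (F : I -> R[i]) :
  complex.Im (\sum_(i <- r | P i) F i) = \sum_(i <- r | P i) complex.Im (F i).
Proof. by apply: (big_morph (@complex.Im R)) => // -[? ?] [? ?]. Qed.

Lemma Re_genfun_term (c : nat -> R) (a d : R) n :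
  complex.Re (genfun_term c (a +i* d)%C n) = c n * re_pow a d n.
Proof. by rewrite /genfun_term /re_pow; case: (_ ^+ n) => x y /=; rewrite mul0r subr0. Qed.

Lemma Im_genfun_term (c : nat -> R) (a d : R) n :
  complex.Im (genfun_term c (a +i* d)%C n) = c n * im_pow a d n.
Proof. by rewrite /genfun_term /im_pow; case: (_ ^+ n) => x y /=; rewrite mul0r addr0. Qed.

Lemma cvg_genfun (c : nat -> R) (a d x y : R) :
  series (fun n => c n * re_pow a d n) @ \oo --> x ->
  series (fun n => c n * im_pow a d n) @ \oo --> y ->
  series (genfun_term c (a +i* d)%C) @ \oo --> ((x +i* y)%C : R[i]^o).
Proof.
move=> hx hy; apply: cvg_complex => /=.
  rewrite (_ : (fun N => _) = series (fun n => c n * re_pow a d n))//.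
  by apply/funext => N; rewrite /series/= Re_sum; apply: eq_bigr => i _; rewrite Re_genfun_term.
rewrite (_ : (fun N => _) = series (fun n => c n * im_pow a d n))//.
by apply/funext => N; rewrite /series/= Im_sum; apply: eq_bigr => i _; rewrite Im_genfun_term.
Qed.

Lemma powc_scale (s a d : R) n :
  ((s * a) +i* (s * d))%C ^+ n = (s ^+ n)%:C%C * (a +i* d)%C ^+ n.
Proof. by rewrite -mulc_real exprMn rmorphXn. Qed.

Lemma re_powZ (s a d : R) n : re_pow (s * a) (s * d) n = s ^+ n * re_pow a d n.
Proof. by rewrite /re_pow powc_scale; case: ((a +i* d)%C ^+ n) => x y; rewrite mulc_real. Qed.

Lemma im_powZ (s a d : R) n : im_pow (s * a) (s * d) n = s ^+ n * im_pow a d n.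
Proof. by rewrite /im_pow powc_scale; case: ((a +i* d)%C ^+ n) => x y; rewrite mulc_real. Qed.

Lemma onec_sub (x y : R) : 1 - (x +i* y)%C = ((1 - x) +i* (- y))%C.
Proof. by apply/eqP; rewrite eq_complex /= sub0r !eqxx. Qed.

Lemma cpow_onec_sub (b s a d : R) : 0 < 1 - s * a ->
  cpow (1 - ((s * a) +i* (s * d))%C) b =
  (expR (b * log_norm a d s) * cos (b * arg_frac a d s) +i*
   (expR (b * log_norm a d s) * sin (b * arg_frac a d s)))%C.
Proof. by move=> h; rewrite onec_sub cpow_gt0. Qed.

Lemma eq_invc (z w : R[i]) : z * w = 1 -> z = w^-1.
Proof.
move=> h; apply: (@mulIf _ w).
  by apply/eqP => w0; move: h; rewrite w0 mulr0 => /eqP; rewrite eq_sym oner_eq0.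
by rewrite h mulVf//; apply/eqP => w0; move: h; rewrite w0 mulr0 => /eqP; rewrite eq_sym oner_eq0.
Qed.

Lemma mulc_eq1 (u v c s : R) : u * c - v * s = 1 -> u * s + v * c = 0 ->
  (u +i* v)%C = (c +i* s)%C^-1.
Proof. by move=> h1 h2; apply: eq_invc; apply/eqP; rewrite eq_complex /= h1 h2 !eqxx. Qed.

Lemma cvg_nbin_cpow (b : R) (z : R[i]) : complex.Re z ^+ 2 + complex.Im z ^+ 2 < 1 ->
  series (genfun_term (nbin b) z) @ \oo --> ((cpow (1 - z) b)^-1 : R[i]^o).
Proof.
case: z => x y /= z1.
pose r := Num.sqrt (x ^+ 2 + y ^+ 2).
have r0 : 0 <= r by exact: sqrtr_ge0.
have r2 : r ^+ 2 = x ^+ 2 + y ^+ 2 by rewrite sqr_sqrtr// addr_ge0 ?sqr_ge0.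
have r1 : r < 1 by rewrite -(@ltr_pXn2r _ 2)// ?nnegrE// r2 expr1n.
(* The point z is written as s (a + i d), with s strictly between |z| and 1, so that a + i d stays
   in the closed disc and the ray argument of [binomial_ode] applies. The midpoint is nonzero even
   for z = 0. *)
pose s := (1 + r) / 2.
have s0 : 0 < s by rewrite /s; lra.
have s1 : `|s| < 1 by rewrite gtr0_norm// /s; lra.
pose a := x / s; pose d := y / s.
have xE : x = s * a by rewrite /a mulrC divfK// gt_eqF.
have yE : y = s * d by rewrite /d mulrC divfK// gt_eqF.
have ad1 : a ^+ 2 + d ^+ 2 <= 1.
  have -> : a ^+ 2 + d ^+ 2 = r ^+ 2 / s ^+ 2 by rewrite r2 /a /d; field; rewrite gt_eqF.
  rewrite ler_pdivrMr ?exprn_gt0// mul1r ler_pXn2r ?nnegrE ?(ltW s0)// /s; lra.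
have a1 : `|a| <= 1.
  by rewrite -(@ler_pXn2r _ 2)// ?nnegrE// expr1n real_normK ?num_real//; nra.
have [h1 h2] := binomial_ode b ad1 s1.
rewrite xE yE cpow_onec_sub; last exact: affine_gt0.
rewrite -(mulc_eq1 h1 h2); apply: cvg_genfun.
- under eq_fun do rewrite re_powZ mulrCA mulrC.
  by apply: nbin_sum_cvg => // n; exact: re_pow_norm.
- under eq_fun do rewrite im_powZ mulrCA mulrC.
  by apply: nbin_sum_cvg => // n; exact: im_pow_norm.
Qed.

Lemma cpowN (z : R[i]) (p : R) : 0 < complex.Re z -> cpow z (- p) = (cpow z p)^-1.
Proof.
case: z => x y /= x0; rewrite !cpow_gt0//; apply: mulc_eq1.
  rewrite !mulNr cosN sinN expRN.
  have := cos2Dsin2 (p * atan (y / x)); set c := cos _; set s := sin _ => cs.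
  set E := expR _; have E0 : E != 0 by rewrite gt_eqF ?expR_gt0.
  by rewrite -cs; field.
by rewrite !mulNr cosN sinN; ring.
Qed.
End complex_binomial.

(** * The Sibuya law and its compounds *)

Section sibuya.
Context {R : realType} (alpha : R) (alpha_gt0 : 0 < alpha) (alpha_le1 : alpha <= 1).

(* The coefficients of 1 - (1 - u)^alpha. *)
Definition sibuya (n : nat) : R := (n == 0%N)%:R - nbin (- alpha) n.

Lemma sibuya0 : sibuya 0 = 0.
Proof. by rewrite /sibuya nbin0 subrr. Qed.

(** The coefficient of index 1 is -alpha, and each later recurrence factor has the sign of n + 1 -
    alpha, nonnegative since alpha <= 1. This is the source of all positivity of the Sibuya law. *)
Lemma nbinN_le0 n : nbin (- alpha) n.+1 <= 0.
Proof.
elim: n => [|n IH]; first by rewrite nbinSE nbin0 mulr1 addr0 divr1 oppr_le0 ltW.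
rewrite nbinSE mulr_ge0_le0// divr_ge0//.
by rewrite addrC subr_ge0 (le_trans alpha_le1)// ler1n.
Qed.

Lemma sibuya_ge0 n : 0 <= sibuya n.
Proof.
case: n => [|n]; first by rewrite sibuya0.
by rewrite /sibuya /= sub0r oppr_ge0 nbinN_le0.
Qed.

(** By [series_nbin] the mass left beyond N is a coefficient of (1 - u)^(alpha - 1), which is
    nonnegative. *)
Lemma series_sibuyaS N : series sibuya N.+1 = 1 - nbin (1 - alpha) N.
Proof.
rewrite addrC [1 + _]addrC; have := series_nbin (- alpha) N; rewrite [- alpha + 1]addrC => <-; rewrite addrC /series /= /sibuya sumrB; congr (_ - _).
by rewrite big_nat_recl//= big1 ?addr0.
Qed.

Lemma series_sibuya_le1 N : series sibuya N <= 1.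
Proof.
case: N => [|N]; first by rewrite /series /= big_nil.
by rewrite series_sibuyaS gerBl nbin_ge0// subr_ge0.
Qed.

Lemma is_cvg_series_sibuya : cvgn (series sibuya).
Proof. exact: is_cvg_series_bounded sibuya_ge0 series_sibuya_le1. Qed.

(** The absolute values of the coefficients of (1 - u)^alpha. Their summability makes that series
    converge absolutely on the whole closed disc. *)
Definition sibuya_maj n : R := (n == 0%N)%:R + sibuya n.

Lemma is_cvg_series_sibuya_maj : cvgn (series sibuya_maj).
Proof.
apply: (@is_cvg_series_bounded _ _ 2) => [n|N].
  by rewrite addr_ge0 ?sibuya_ge0.
rewrite /series /= /sibuya_maj big_split /= -[2]/(1 + 1) lerD// ?series_sibuya_le1//.
case: N => [|N]; first by rewrite big_nil.
by rewrite big_nat_recl//= big1 ?addr0.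
Qed.

Lemma nbinN_maj n : `|nbin (- alpha) n| <= sibuya_maj n.
Proof.
have -> : nbin (- alpha) n = (n == 0%N)%:R - sibuya n by rewrite /sibuya opprB addrC subrK.
by rewrite (le_trans (ler_normB _ _))// lerD ?ger0_norm ?sibuya_ge0.
Qed.

(** Abel's radial limit; here it is plain dominated convergence, the coefficients being absolutely
    summable. *)
Lemma nbin_sum_left1 (c : nat -> R) : (forall n, `|c n| <= 1) ->
  nbin_sum (- alpha) c (1 - x) @[x --> 0^'+] --> limn (series (fun n => nbin (- alpha) n * c n)).
Proof.
move=> c1; have maj n x : 0 <= x <= 1 -> `|nbin (- alpha) n * c n * (1 - x) ^+ n| <= sibuya_maj n.
  move=> /andP[x0 x1]; rewrite !normrM -[leRHS]mulr1 -[sibuya_maj n]mulr1 !ler_pM ?mulr_ge0// ?nbinN_maj//.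
  by rewrite normrX exprn_ile1// ger0_norm; lra.
apply: (tannery is_cvg_series_sibuya_maj).
- by move=> n; have := maj n 0; rewrite subr0 expr1n mulr1; apply; rewrite lexx ler01.
- near=> x => n; apply: maj; apply/andP; split; near: x; first exact: nbhs_right_ge.
  exact: nbhs_right_le.
- move=> n; rewrite -[X in _ --> X]mulr1; apply: cvgMl_tmp.
  rewrite -[X in _ --> X](expr1n _ n) -[X in X ^+ n]subr0.
  apply: (@cvg_continuous_comp _ _ _ _ (fun x => 1 - x) (fun x => x ^+ n) (1 - 0)).
    exact: exprn_continuous.
  apply: cvgB; first exact: cvg_cst.
  exact: cvg_at_right_filter.
Unshelve. all: end_near. Qed.

(** The identity is known at the radii 1 - x of [binomial_ode]; letting x -> 0+ on both sides brings
    it to the boundary. *)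
Lemma series_nbinN_cpow (z : R[i]) : complex.Re z ^+ 2 + complex.Im z ^+ 2 <= 1 ->
  series (genfun_term (nbin (- alpha)) z) @ \oo --> (cpow (1 - z) alpha : R[i]^o).
Proof.
case: z => a d /= ad1.
have re1 n := @re_pow_norm _ a d n ad1. have im1 n := @im_pow_norm _ a d n ad1.
have conv c : (forall n, `|c n| <= 1) -> cvgn (series (fun n => nbin (- alpha) n * c n)).
  move=> c1; apply: (is_cvg_series_dominated is_cvg_series_sibuya_maj) => n.
  by rewrite normrM -[leRHS]mulr1 ler_pM// nbinN_maj.
have hU := nbin_sum_left1 re1. have hV := nbin_sum_left1 im1.
suff -> : cpow (1 - (a +i* d)%C) alpha = (limn (series (fun n => nbin (- alpha) n * re_pow a d n)) +i*
    limn (series (fun n => nbin (- alpha) n * im_pow a d n)))%C.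
  by apply: cvg_genfun; exact: conv.
have sx (x : R) : 0 < x < 2 -> `|1 - x| < 1 by move=> /andP[? ?]; rewrite ltr_norml; lra.
(* If a < 1, then 1 - z has positive real part and the power is continuous along the ray up to s =
   1. *)
have [a1|a1] := ltrP a 1.
- rewrite -[alpha in LHS]opprK cpowN; last by rewrite onec_sub /= subr_gt0.
  apply/esym; have -> : (a +i* d)%C = (1 * a +i* (1 * d))%C by rewrite !mul1r.
  have p1 : 0 < 1 - 1 * a by rewrite mul1r subr_gt0.
  rewrite cpow_onec_sub//.
  have x1 : 1 - x @[x --> (0 : R)^'+] --> (1 : R).
    rewrite -[X in _ --> X]subr0; apply: cvgB; first exact: cvg_cst.
    exact: cvg_at_right_filter.
  have hC : (expR (- alpha * log_norm a d (1 - x)) * cos (- alpha * arg_frac a d (1 - x))) @[x --> (0 : R)^'+]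
      --> expR (- alpha * log_norm a d 1) * cos (- alpha * arg_frac a d 1).
    apply: (@cvg_continuous_comp _ _ _ _ (fun x => 1 - x) (fun t => expR (- alpha * log_norm a d t) * cos (- alpha * arg_frac a d t)) 1 _ x1).
    have [+ _] := is_derive_expcos (- alpha) (is_derive_modulus d p1) (is_derive_argument d p1).
    by move=> /derivable1_diffP/differentiable_continuous.
  have hS : (expR (- alpha * log_norm a d (1 - x)) * sin (- alpha * arg_frac a d (1 - x))) @[x --> (0 : R)^'+]
      --> expR (- alpha * log_norm a d 1) * sin (- alpha * arg_frac a d 1).
    apply: (@cvg_continuous_comp _ _ _ _ (fun x => 1 - x) (fun t => expR (- alpha * log_norm a d t) * sin (- alpha * arg_frac a d t)) 1 _ x1).
    have [+ _] := is_derive_expsin (- alpha) (is_derive_modulus d p1) (is_derive_argument d p1).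
    by move=> /derivable1_diffP/differentiable_continuous.
  apply: mulc_eq1.
    apply: (cvg_near_eq (cvgB (cvgM hU hC) (cvgM hV hS)) (cvg_cst (1 : R))); near=> x; apply: (binomial_ode _ ad1 _).1; apply: sx.
    by apply/andP; split; near: x; [exact: nbhs_right_gt|exact: nbhs_right_lt].
  apply: (cvg_near_eq (cvgD (cvgM hU hS) (cvgM hV hC)) (cvg_cst (0 : R))); near=> x; apply: (binomial_ode _ ad1 _).2; apply: sx.
  by apply/andP; split; near: x; [exact: nbhs_right_gt|exact: nbhs_right_lt].
(* In the disc a >= 1 leaves only z = 1, where the power is 0. There the real sum at radius 1 - x
   equals x^alpha, which tends to 0, and every imaginary part vanishes. *)
- have [a1' d0] : a = 1 /\ d = 0 by split; nra.
  subst a d.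
  have -> : 1 - (1 +i* 0)%C = 0 :> R[i] by rewrite subrr.
  rewrite cpow0 ?gt_eqF//; apply/eqP; rewrite eq_sym eq_complex /=; apply/andP; split; apply/eqP.
    apply: (cvg_near_eq hU (powR_cvg0 alpha_gt0)); near=> x.
    have x0 : 0 < x by [].
    have /sx x1 : 0 < x < 2 by apply/andP; split; near: x; [exact: nbhs_right_gt|exact: nbhs_right_lt].
    have [+ _] := binomial_ode (- alpha) ad1 x1.
    rewrite /log_norm /arg_frac !mulr0 oppr0 mul0r atan0 mulr0 sin0 cos0 !mulr0 subr0 expr0n addr0 !mulr1.
    rewrite subKr lnXn// half_double mulNr expRN /powR gt_eqF// => h.
    by rewrite -[LHS](mulfVK (lt0r_neq0 (expR_gt0 (alpha * ln x)))) h mul1r.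
  rewrite (_ : (fun n => _) = (fun=> 0)); last first.
    by apply/funext => n; rewrite /im_pow expr1n /= mulr0.
  by apply: (@cvg_lim _ (@Rhausdorff R)); rewrite /series /=; under eq_fun do rewrite big1//; exact: cvg_cst.
Unshelve. all: end_near. Qed.

End sibuya.

(** * Cauchy products on the closed unit disc *)

Section cauchy_product.
Context {R : realType}.

Lemma normc_ge_Im (z : R[i]) : `|complex.Im z|%:C%C <= `|z|.
Proof.
by rewrite normc_def lecR -sqrtr_sqr ler_sqrt ?addr_ge0 ?sqr_ge0// lerDr sqr_ge0.
Qed.

Lemma cvg_Im (T : Type) (F : set_system T) {FF : Filter F} (w : T -> R[i]^o) (l : R[i]) :
  w x @[x --> F] --> (l : R[i]^o) -> complex.Im (w x) @[x --> F] --> complex.Im l.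
Proof.
move=> /cvgrPdist_lt h; apply/cvgrPdist_lt => e e0.
have e0' : 0 < e%:C%C by rewrite ltcR.
move: (h _ e0'); apply: filterS => x hx.
have := le_lt_trans (normc_ge_Im (l - w x)) hx; rewrite ltcR.
by case: (l) (w x) => ? ? [].
Qed.

Lemma cvg_series_conv (p q : nat -> R) : (forall n, 0 <= p n) -> (forall n, 0 <= q n) ->
  cvgn (series p) -> cvgn (series q) ->
  series (conv p q) @ \oo --> limn (series p) * limn (series q).
Proof.
move=> p0 q0 cp cq; have pq0 := conv_ge0 p0 q0.
have sp0 N : 0 <= series p N by apply: sumr_ge0.
have sq0 N : 0 <= series q N by apply: sumr_ge0.
have bnd N : series (conv p q) N <= limn (series p) * limn (series q).
  apply: le_trans (series_conv_le N p0 q0) _.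
  by apply: ler_pM => //; exact: series_le_lim.
have c := is_cvg_series_bounded pq0 bnd.
suff -> : limn (series p) * limn (series q) = limn (series (conv p q)) by [].
have lim_pq : (fun N => series p N * series q N) @ \oo --> limn (series p) * limn (series q).
  exact: cvgM.
apply/eqP; rewrite eq_le; apply/andP; split; last first.
  by apply: (ler_cvg_to c (cvg_cst _)); near=> N.
apply: (ler_cvg_to lim_pq (cvg_cst _)); near=> N.
apply: le_trans (series_conv_ge N p0 q0) _; exact: series_le_lim.
Unshelve. all: end_near. Qed.

Lemma squeeze_complex (w : nat -> R[i]^o) (e : nat -> R) :
  (forall n, `|w n| <= (e n)%:C%C) -> e @ \oo --> 0 -> w @ \oo --> (0 : R[i]^o).
Proof.
move=> we /cvgrPdist_lt e0; apply/cvgrPdist_lt => d d0.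
have d0' : 0 < complex.Re d by move: d0; rewrite ltcE => /andP[].
have dE : d = (complex.Re d)%:C%C.
  by move: d0; rewrite ltcE => /andP[/eqP /= h _]; case: d {d0'} h => x y /= ->.
move: (e0 _ d0'); apply: filterS => n; rewrite !sub0r !normrN => en.
rewrite dE; apply: le_lt_trans (we n) _; rewrite ltcR.
exact: le_lt_trans (ler_norm _) en.
Qed.

Lemma normc_le1 (u : R[i]) : (`|u| <= 1) = (complex.Re u ^+ 2 + complex.Im u ^+ 2 <= 1).
Proof.
rewrite normc_def -[1]/(1%:C%C) lecR -[X in _ <= X]sqrtr1 ler_sqrt//.
Qed.

Lemma norm_genfun_term (p : nat -> R) (u : R[i]) n : 0 <= p n -> `|u| <= 1 ->
  `|genfun_term p u n| <= (p n)%:C%C.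
Proof.
move=> pn u1; rewrite /genfun_term normrM normrX ger0_norm ?ler0c//.
by rewrite ler_piMr ?ler0c// exprn_ile1.
Qed.

Lemma norm_series_genfun (p : nat -> R) (u : R[i]) N : (forall n, 0 <= p n) -> `|u| <= 1 ->
  `|series (genfun_term p u) N| <= (series p N)%:C%C.
Proof.
move=> p0 u1; rewrite /series /= rmorph_sum (le_trans (ler_norm_sum _ _ _))//.
by apply: ler_sum => n _; exact: norm_genfun_term.
Qed.

Lemma genfun_term_conv (p q : nat -> R) (u : R[i]) :
  genfun_term (conv p q) u = conv (genfun_term p u : nat -> R[i]) (genfun_term q u : nat -> R[i]).
Proof.
apply/funext => n; rewrite /genfun_term /conv rmorph_sum mulr_suml.
apply: eq_bigr => i _; rewrite rmorphM /= mulrACA -exprD subnKC//.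
by have := ltn_ord i; rewrite ltnS.
Qed.

(** The product of the partial sums differs from the partial sum of the product by the terms of the
    corner i + j >= N. Since |u| <= 1, this corner is bounded by its value at u = 1, which tends to
    0 by the real case [cvg_series_conv]. *)
Lemma cvg_genfun_conv (p q : nat -> R) (u A B : R[i]) :
  (forall n, 0 <= p n) -> (forall n, 0 <= q n) ->
  cvgn (series p) -> cvgn (series q) -> `|u| <= 1 ->
  series (genfun_term p u) @ \oo --> (A : R[i]^o) ->
  series (genfun_term q u) @ \oo --> (B : R[i]^o) ->
  series (genfun_term (conv p q) u) @ \oo --> (A * B : R[i]^o).
Proof.
move=> p0 q0 cp cq u1 hA hB.
pose a : nat -> R[i] := genfun_term p u. pose b : nat -> R[i] := genfun_term q u.
pose d N : R[i]^o := series (genfun_term p u) N * series (genfun_term q u) N - series (genfun_term (conv p q) u) N.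
have e0 : (fun N => series p N * series q N - series (conv p q) N) @ \oo --> 0.
  rewrite -(subrr (limn (series p) * limn (series q))); apply: cvgB.
    exact: cvgM.
  exact: cvg_series_conv.
have d0 : d @ \oo --> (0 : R[i]^o).
  apply: squeeze_complex e0 => N.
  have split_sum (S : comNzRingType) (x y : nat -> S) : (\sum_(0 <= n < N) x n) * (\sum_(0 <= n < N) y n) -
      \sum_(0 <= n < N) conv x y n = \sum_(i < N) \sum_(j < N | ~~ (i + j < N)%N) x i * y j.
    rewrite sum_conv !big_mkord mulr_suml -sumrB; apply: eq_bigr => i _.
    by rewrite mulr_sumr (bigID (fun j : 'I_N => (i + j < N)%N)) /= addrAC subrr add0r.
  rewrite /d /series /= genfun_term_conv !split_sum.
  rewrite rmorph_sum (le_trans (ler_norm_sum _ _ _))// ler_sum// => i _.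
  rewrite rmorph_sum (le_trans (ler_norm_sum _ _ _))// ler_sum// => j _.
  by rewrite rmorphM /= normrM ler_pM// norm_genfun_term.
pose proof (cvgB (cvgM hA hB) d0) as h; rewrite subr0 in h.
apply: cvg_trans h; apply: near_eq_cvg; near=> N.
by rewrite /d /= opprB addrC subrK.
Unshelve. all: end_near. Qed.
End cauchy_product.

(** * Compounding the Sibuya law *)

Section compound.
Context {R : realType} (alpha : R) (alpha_gt0 : 0 < alpha) (alpha_le1 : alpha <= 1).

Fixpoint sibuya_conv (n : nat) : nat -> R :=
  if n is m.+1 then conv (sibuya alpha) (sibuya_conv m) else fun k => (k == 0%N)%:R.

Lemma sibuya_conv_ge0 n k : 0 <= sibuya_conv n k.
Proof.
elim: n k => [|n IH] k //=; apply: conv_ge0 => // m; exact: sibuya_ge0.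
Qed.

(** A Sibuya variable is at least 1, so a sum of n of them is at least n. This is why the sum over n
    in [compound] can stop at k. *)
Lemma sibuya_conv_small n k : (k < n)%N -> sibuya_conv n k = 0.
Proof.
elim: n k => [|n IH] k //= kn; rewrite /conv big1// => -[[|i] ik] _ /=.
  by rewrite sibuya0 mul0r.
by rewrite IH ?mulr0//; move: ik kn; lia.
Qed.

Lemma series_sibuya_conv_le1 n N : series (sibuya_conv n) N <= 1.
Proof.
elim: n N => [|n IH] N.
  rewrite /series /=; case: N => [|N]; first by rewrite big_nil.
  by rewrite big_nat_recl//= big1 ?addr0.
rewrite /= (le_trans (series_conv_le _ _ _))//.
- by move=> k; exact: sibuya_ge0.
- by move=> k; exact: sibuya_conv_ge0.
rewrite mulr_ile1 ?series_sibuya_le1//.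
  by apply: sumr_ge0 => k _; exact: sibuya_ge0.
by apply: sumr_ge0 => k _; exact: sibuya_conv_ge0.
Qed.

Lemma is_cvg_series_sibuya_conv n : cvgn (series (sibuya_conv n)).
Proof. exact: is_cvg_series_bounded (sibuya_conv_ge0 n) (series_sibuya_conv_le1 n). Qed.

Lemma cvg_genfun_sibuya (u : R[i]) : `|u| <= 1 ->
  series (genfun_term (sibuya alpha) u) @ \oo --> (1 - cpow (1 - u) alpha : R[i]^o).
Proof.
rewrite normc_le1 => u1.
have h : (fun N => 1 - series (genfun_term (nbin (- alpha)) u) N : R[i]^o) @ \oo -->
    (1 - cpow (1 - u) alpha : R[i]^o).
  by apply: cvgB; [exact: cvg_cst|exact: series_nbinN_cpow].
apply: cvg_trans h; apply: near_eq_cvg; near=> N.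
have N0 : (0 < N)%N by near: N; exact: nbhs_infty_gt.
rewrite /series /= -(prednK N0) /= /genfun_term /sibuya.
under [RHS]eq_bigr do rewrite rmorphB mulrBl.
rewrite sumrB [X in _ = X - _]big_nat_recl//= expr0 mulr1 [X in _ = _ + X - _]big1 ?addr0//.
by move=> i _; rewrite mul0r.
Unshelve. all: end_near. Qed.

Lemma cvg_genfun_sibuya_conv (u : R[i]) n : `|u| <= 1 ->
  series (genfun_term (sibuya_conv n) u) @ \oo --> ((1 - cpow (1 - u) alpha) ^+ n : R[i]^o).
Proof.
move=> u1; elim: n => [|n IH].
  rewrite expr0; apply: cvg_near_cst; near=> N.
  have N0 : (0 < N)%N by near: N; exact: nbhs_infty_gt.
  rewrite /series /= -(prednK N0) big_nat_recl//= /genfun_term expr0 mulr1 big1 ?addr0//.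
  by move=> i _; rewrite mul0r.
rewrite exprS; apply: cvg_genfun_conv IH => //.
- exact: sibuya_ge0.
- exact: sibuya_conv_ge0.
- exact: is_cvg_series_sibuya.
- exact: is_cvg_series_sibuya_conv.
- exact: cvg_genfun_sibuya.
Unshelve. all: end_near. Qed.

Context (nu : R) (nu_gt0 : 0 < nu).

(** The coefficients of (1 - S(u) / (1 + xi))^(-nu), where S is the Sibuya generating function. The
    normalising constant is added in [gdist]. *)
Definition compound (xi : R) (k : nat) : R :=
  \sum_(n < k.+1) nbin nu n * (1 + xi)^-1 ^+ n * sibuya_conv n k.

Lemma compound_ge0 xi k : 0 < xi -> 0 <= compound xi k.
Proof.
move=> xi0; apply: sumr_ge0 => n _; rewrite !mulr_ge0 ?sibuya_conv_ge0//.
  by rewrite nbin_ge0// ltW.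
by rewrite exprn_ge0// invr_ge0; lra.
Qed.

(** Exchanging the sums costs no remainder, because the terms with n > k are zero. The test sequence
    [c] will be the real or imaginary part of u^k. *)
Lemma series_compound (xi : R) (c : nat -> R) K :
  \sum_(0 <= k < K) compound xi k * c k =
  series (fun n => nbin nu n * (1 + xi)^-1 ^+ n * \sum_(0 <= k < K) sibuya_conv n k * c k) K.
Proof.
rewrite /series /=; under [RHS]eq_bigr do rewrite mulr_sumr.
rewrite exchange_big_nat /=; apply: eq_big_nat => k /andP[_ kK].
rewrite (@big_cat_nat _ _ _ k.+1)//= [X in _ + X]big_nat [X in _ + X]big1 ?addr0; last first.
  by move=> n /andP[kn _]; rewrite sibuya_conv_small// mul0r mulr0.
by rewrite /compound mulr_suml big_mkord; apply: eq_bigr => n _; rewrite mulrA.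
Qed.

Lemma unit_disc_lim (w : nat -> R[i]^o) (l : R[i]) : w @ \oo --> (l : R[i]^o) ->
  (forall n, `|w n| <= 1) -> complex.Re l ^+ 2 + complex.Im l ^+ 2 <= 1.
Proof.
move=> wl w1.
have h : (fun n => complex.Re (w n) ^+ 2 + complex.Im (w n) ^+ 2) @ \oo -->
    complex.Re l ^+ 2 + complex.Im l ^+ 2.
  by apply: cvgD; rewrite expr2; apply: cvgM; by [exact: cvg_Re|exact: cvg_Im].
apply: (ler_cvg_to h (cvg_cst _)); near=> n.
by rewrite -normc_le1.
Unshelve. all: end_near. Qed.

(** Substitution of S into the binomial series: S(u) stays in the closed disc and r = 1 / (1 + xi) <
    1, so r S(u) lies strictly inside. The limit in K is taken under the sum over n, dominated by
    [w]. *)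
Lemma cvg_genfun_compound (xi : R) (u : R[i]) : 0 < xi -> `|u| <= 1 ->
  series (genfun_term (compound xi) u) @ \oo -->
  ((cpow (1 - ((1 + xi)^-1)%:C%C * (1 - cpow (1 - u) alpha)) nu)^-1 : R[i]^o).
Proof.
move=> xi0 u1; set P := 1 - cpow (1 - u) alpha; set r := (1 + xi)^-1.
have x1 : 0 < 1 + xi by lra.
have r01 : 0 <= r < 1 by apply/andP; split; [rewrite invr_ge0 ltW|rewrite invf_lt1// ltrDl].
have /andP[r0 r1] := r01.
have hP n : series (genfun_term (sibuya_conv n) u) @ \oo --> (P ^+ n : R[i]^o).
  exact: cvg_genfun_sibuya_conv.
have P1 : complex.Re P ^+ 2 + complex.Im P ^+ 2 <= 1.
  have := hP 1%N; rewrite expr1 => /unit_disc_lim; apply => N.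
  rewrite (le_trans (norm_series_genfun _ (sibuya_conv_ge0 1) u1))//.
  by rewrite -[leRHS]/(1%:C%C) lecR series_sibuya_conv_le1.
pose w n := nbin nu n * r ^+ n.
have w0 n : 0 <= w n by rewrite mulr_ge0 ?nbin_ge0 ?exprn_ge0// ltW.
have cw : cvgn (series w).
  have <- : (fun n => `|nbin nu n| * r ^+ n) = w.
    by apply/funext => n; rewrite ger0_norm ?nbin_ge0 ?(ltW nu_gt0).
  exact: is_cvg_series_nbin_norm.
have hz : complex.Re (r%:C%C * P) ^+ 2 + complex.Im (r%:C%C * P) ^+ 2 < 1.
  case: P P1 {hP} => x y /=; rewrite !mul0r subr0 addr0 => xy1.
  by rewrite !exprMn -mulrDr (le_lt_trans (ler_piMr _ xy1)) ?exprn_ge0 ?exprn_ilt1.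
have hl := @cvg_nbin_cpow _ nu _ hz.
move: P hP P1 hz hl => P hP P1 hz hl.
case: u u1 hP => a d; rewrite normc_le1 /= => u1 hP.
have bnd (c : nat -> R) n K : (forall k, `|c k| <= 1) ->
    `|w n * \sum_(0 <= k < K) sibuya_conv n k * c k| <= w n.
  move=> c1; rewrite normrM ger0_norm// ler_piMr// (le_trans _ (series_sibuya_conv_le1 n K))//.
  rewrite /series /= (le_trans (ler_norm_sum _ _ _))// ler_sum// => k _.
  by rewrite normrM (ger0_norm (sibuya_conv_ge0 _ _)) ler_piMr ?sibuya_conv_ge0.
have main (c : nat -> R) (A : nat -> R) : (forall k, `|c k| <= 1) -> (forall k, `|A k| <= 1) ->
   (forall n, (fun K => \sum_(0 <= k < K) sibuya_conv n k * c k) @ \oo --> A n) ->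
   (fun K => \sum_(0 <= k < K) compound xi k * c k) @ \oo --> limn (series (fun n => w n * A n)).
  move=> c1 A1 cA; under eq_fun do rewrite series_compound.
  have := @tannery _ _ \oo _ (fun K n => w n * \sum_(0 <= k < K) sibuya_conv n k * c k) (fun n => w n * A n) w cw.
  (* For a given K only n < K contribute, so the infinite sum over n required by [tannery] is the
     partial sum at hand. *)
  have -> : (fun K => limn (series (fun n => w n * \sum_(0 <= k < K) sibuya_conv n k * c k))) =
    (fun K => series (fun n => w n * \sum_(0 <= k < K) sibuya_conv n k * c k) K).
    apply/funext => K; apply: lim_series_finite => n Kn.
    rewrite big_nat big1 ?mulr0// => k /andP[_ kK].
    by rewrite sibuya_conv_small ?mul0r//; exact: leq_trans kK Kn.
  apply.
  - by move=> n; rewrite normrM ger0_norm// ler_piMr.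
  - by near=> K => n; exact: bnd.
  - by move=> n; apply: cvgMl_tmp; exact: cA.
apply: cvg_complex.
- have {}hl : complex.Re (cpow (1 - r%:C%C * P) nu)^-1 = limn (series (fun n => w n * complex.Re (P ^+ n))).
    apply/esym/(@cvg_lim _ (@Rhausdorff R)); move/cvg_Re: hl.
    apply: cvg_trans; apply: near_eq_cvg; near=> N; rewrite Re_sum; apply: eq_bigr => n _.
    rewrite /genfun_term exprMn -rmorphXn mulrA -rmorphM /=.
    by rewrite -/(w n); case: (P ^+ n) => x y; rewrite mulc_real.
  rewrite hl.
  rewrite (_ : (fun K => _) = (fun K => \sum_(0 <= k < K) compound xi k * re_pow a d k)); last first.
    by apply/funext => K; rewrite Re_sum; apply: eq_bigr => k _; rewrite Re_genfun_term.
  apply: main.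
  + by move=> k; exact: re_pow_norm.
  + by move=> k; case: (P) P1 => x y /= P1; exact: re_pow_norm.
  + move=> n; move/cvg_Re: (hP n).
    apply: cvg_trans; apply: near_eq_cvg; near=> N; rewrite Re_sum.
    by apply: eq_bigr => k _; rewrite Re_genfun_term.
- have {}hl : complex.Im (cpow (1 - r%:C%C * P) nu)^-1 = limn (series (fun n => w n * complex.Im (P ^+ n))).
    apply/esym/(@cvg_lim _ (@Rhausdorff R)); move/cvg_Im: hl.
    apply: cvg_trans; apply: near_eq_cvg; near=> N; rewrite Im_sum; apply: eq_bigr => n _.
    rewrite /genfun_term exprMn -rmorphXn mulrA -rmorphM /=.
    by rewrite -/(w n); case: (P ^+ n) => x y; rewrite mulc_real.
  rewrite hl.
  rewrite (_ : (fun K => _) = (fun K => \sum_(0 <= k < K) compound xi k * im_pow a d k)); last first.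
    by apply/funext => K; rewrite Im_sum; apply: eq_bigr => k _; rewrite Im_genfun_term.
  apply: main.
  + by move=> k; exact: im_pow_norm.
  + by move=> k; case: (P) P1 => x y /= P1; exact: im_pow_norm.
  + move=> n; move/cvg_Im: (hP n).
    apply: cvg_trans; apply: near_eq_cvg; near=> N; rewrite Im_sum.
    by apply: eq_bigr => k _; rewrite Im_genfun_term.
Unshelve. all: end_near. Qed.

End compound.

(** * The law theta and its generating function *)

Section theta.
Context {R : realType} (alpha : R) (alpha_gt0 : 0 < alpha) (alpha_le1 : alpha <= 1).
Context (nu : R) (nu_gt0 : 0 < nu).

(* The coefficients of xi^nu / (xi + (1 - u)^alpha)^nu, from
   xi + (1 - u)^alpha = (1 + xi) (1 - (1 - (1 - u)^alpha) / (1 + xi)). *)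
Definition gdist (xi : R) (k : nat) : R := (xi / (1 + xi)) `^ nu * compound alpha nu xi k.

Lemma gdist_ge0 xi k : 0 < xi -> 0 <= gdist xi k.
Proof. by move=> xi0; rewrite mulr_ge0 ?powR_ge0// compound_ge0. Qed.

Lemma genfun_sibuya_le1 (u : R[i]) : `|u| <= 1 ->
  complex.Re (1 - cpow (1 - u) alpha) ^+ 2 + complex.Im (1 - cpow (1 - u) alpha) ^+ 2 <= 1.
Proof.
move=> u1; apply: (unit_disc_lim (cvg_genfun_sibuya alpha_gt0 alpha_le1 u1)) => N.
rewrite (le_trans (norm_series_genfun _ (sibuya_ge0 alpha_gt0 alpha_le1) u1))//.
by rewrite -[leRHS]/(1%:C%C) lecR series_sibuya_le1.
Qed.

Lemma cvg_genfun_gdist (xi : R) (u : R[i]) : 0 < xi -> `|u| <= 1 ->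
  series (genfun_term (gdist xi) u) @ \oo -->
  ((xi `^ nu)%:C%C / cpow (xi%:C%C + cpow (1 - u) alpha) nu : R[i]^o).
Proof.
move=> xi0 u1; have x1 : 0 < 1 + xi by lra.
pose r := (1 + xi)^-1.
have h := cvg_genfun_compound alpha_gt0 alpha_le1 nu_gt0 xi0 u1.
pose proof (@cvgM R[i] nat \oo _ (fun=> (((xi / (1 + xi)) `^ nu)%:C%C)) (series (genfun_term (compound alpha nu xi) u)) _ _ (cvg_cst _) h) as hM.
have -> : (xi `^ nu)%:C%C / cpow (xi%:C%C + cpow (1 - u) alpha) nu =
  ((xi / (1 + xi)) `^ nu)%:C%C * (cpow (1 - r%:C%C * (1 - cpow (1 - u) alpha)) nu)^-1.
  have P1 := genfun_sibuya_le1 u1.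
  have -> : xi%:C%C + cpow (1 - u) alpha = (1 + xi)%:C%C * (1 - r%:C%C * (1 - cpow (1 - u) alpha)).
    rewrite mulrBr mulr1 mulrA -rmorphM /= mulfV ?gt_eqF// mul1r rmorphD /=.
    have E (S : zmodType) (x c z : S) : x + c = z + x - (z - c).
      by rewrite opprB [z + x]addrC addrACA subrr addr0.
    exact: E.
  (* The base 1 - r S(u) has positive real part, as Re S(u) <= 1 and r < 1; a positive factor then
     leaves its argument unchanged. *)
  rewrite cpowZ//; last first.
    move: (1 - cpow _ _) P1 => -[x y] /= P1; rewrite mul0r subr0 subr_gt0.
    have x1' : x <= 1 by nra.
    rewrite (le_lt_trans (ler_wpM2l _ x1'))// ?invr_ge0 ?(ltW x1)// mulr1 invf_lt1//; lra.
  rewrite invfM mulrA; congr (_ * _).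
  rewrite -fmorphV -rmorphM /=; congr (_%:C%C).
  by rewrite powRM ?invr_ge0 ?(ltW xi0) ?(ltW x1)// -(powR_inv1 (ltW x1)) -powRrM mulN1r powRN.
apply: cvg_trans hM; apply: near_eq_cvg; near=> N.
rewrite /= /series /= mulr_sumr; apply: eq_bigr => k _.
by rewrite /genfun_term /gdist rmorphM mulrA.
Unshelve. all: end_near. Qed.

(** The total mass is the value at u = 1, where (1 - u)^alpha vanishes. This is a boundary point,
    hence the care taken to reach the closed disc. *)
Lemma series_gdist xi : 0 < xi -> series (gdist xi) @ \oo --> (1 : R).
Proof.
move=> xi0; have u1 : `|1 : R[i]| <= 1 by rewrite normr1.
pose proof (cvg_Re (cvg_genfun_gdist xi0 u1)) as h.
move: h; rewrite subrr cpow0 ?gt_eqF// addr0 cpow_real// divff ?(inj_eq complexI)//=; last first.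
  by rewrite eq_complex /= eqxx andbT gt_eqF ?powR_gt0.
move=> h; apply: cvg_trans h; apply: near_eq_cvg; near=> N.
rewrite Re_sum; apply: eq_bigr => k _.
by rewrite /genfun_term expr1n mulr1.
Unshelve. all: end_near. Qed.

Lemma is_cvg_series_gdist xi : 0 < xi -> cvgn (series (gdist xi)).
Proof. by move=> xi0; apply/cvg_ex; exists 1; exact: series_gdist. Qed.

Lemma cvg_genfun_term (p : nat -> R) (u : R[i]) : (forall n, 0 <= p n) ->
  cvgn (series p) -> `|u| <= 1 ->
  series (genfun_term p u) @ \oo --> (genfun p u : R[i]^o).
Proof.
move=> p0 cp; case: u => a d u1; have := u1; rewrite normc_le1 /= => ad1.
have h1 : cvgn (series (fun n => p n * re_pow a d n)).
  apply: (is_cvg_series_dominated cp) => n.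
  by rewrite normrM ger0_norm// ler_piMr// re_pow_norm.
have h2 : cvgn (series (fun n => p n * im_pow a d n)).
  apply: (is_cvg_series_dominated cp) => n.
  by rewrite normrM ger0_norm// ler_piMr// im_pow_norm.
have h := cvg_genfun h1 h2.
by rewrite /genfun (cvg_lim (@norm_hausdorff _ _) h).
Qed.

Context (f : nat -> R) (f_distr : is_distribution f) (f0 : f 0%N = 0).

Definition theta (xi : R) : nat -> R := conv f (gdist xi).

Lemma theta_distr xi : 0 < xi ->
  [/\ is_distribution (theta xi), theta xi 0%N = 0
        & is_genfun (theta xi) (theta_bar alpha nu f xi)].
Proof.
move=> xi0; have [fge0 fs] := f_distr.
have cf : cvgn (series f) by apply/cvg_ex; exists 1.
have g0 k := @gdist_ge0 xi k xi0. have cg := is_cvg_series_gdist xi0.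
split.
- split; first exact: conv_ge0.
  have := cvg_series_conv fge0 g0 cf cg.
  by rewrite (cvg_lim (@Rhausdorff R) fs) (cvg_lim (@Rhausdorff R) (series_gdist xi0)) mulr1.
- by rewrite /theta /conv big_ord1 f0 mul0r.
- move=> u u1; apply: cvg_genfun_conv => //; first exact: cvg_genfun_term.
  exact: cvg_genfun_gdist.
Qed.

End theta.

(** * Expansion in powers of xi *)

Section explicit_series.
Context {R : realType} (alpha : R) (alpha_gt0 : 0 < alpha) (alpha_le1 : alpha <= 1).

Lemma sibuya_conv_widen (c : nat -> R) k K : (k < K)%N ->
  \sum_(0 <= n < K) c n * sibuya_conv alpha n k = \sum_(0 <= n < k.+1) c n * sibuya_conv alpha n k.
Proof.
move=> kK; rewrite (@big_cat_nat _ _ _ k.+1)//= [X in _ + X]big_nat [X in _ + X]big1 ?addr0//.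
by move=> n /andP[kn _]; rewrite sibuya_conv_small ?mulr0.
Qed.

Lemma nbin_zero n : nbin (0 : R) n = (n == 0%N)%:R.
Proof.
elim: n => [|n IH]; first by rewrite nbin0.
by rewrite nbinSE IH; case: n {IH} => [|n] /=; rewrite ?mulr0// addr0 !mul0r.
Qed.

(** On generating functions, (1 - u)^(alpha i) = (1 - S(u))^i. Passing from i to i + 1 multiplies by
    1 - S: Pascal's rule on one side, [conv_nbin] on the other. *)
Lemma nbin_sibuya_nat (i : nat) k :
  nbin (- (alpha * i%:R)) k = \sum_(0 <= n < k.+1) nbin (- i%:R) n * sibuya_conv alpha n k.
Proof.
elim: i k => [|i IH] k.
  rewrite mulr0 oppr0 nbin_zero big_nat_recl// nbin0 mul1r big1 ?addr0// => n _.
  by rewrite nbin_zero mul0r.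
have pas n : nbin (- i.+1%:R) n.+1 = nbin (- i%:R) n.+1 - nbin (- i%:R) n :> R.
  have -> : - i%:R = - i.+1%:R + 1 :> R by rewrite -natr1 opprD addrNK.
  by rewrite nbin_pascal addrK.
rewrite big_nat_recl// nbin0.
under eq_bigr do rewrite pas mulrBl.
rewrite sumrB addrA.
have <- : \sum_(0 <= n < k.+1) nbin (- i%:R) n * sibuya_conv alpha n k =
    1 * sibuya_conv alpha 0 k + \sum_(0 <= n < k) nbin (- i%:R) n.+1 * sibuya_conv alpha n.+1 k.
  by rewrite big_nat_recl// nbin0.
rewrite -IH.
have -> : \sum_(0 <= n < k) nbin (- i%:R) n * sibuya_conv alpha n.+1 k =
    conv (sibuya alpha) (nbin (- (alpha * i%:R))) k.
  rewrite /= /conv; under eq_bigr do rewrite mulr_sumr.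
  rewrite exchange_big /=; apply: eq_bigr => -[[|j] jk] _ /=.
    by rewrite sibuya0 mul0r big1// => n _; rewrite mul0r mulr0.
  rewrite IH -(@sibuya_conv_widen _ _ k); last by lia.
  by rewrite mulr_sumr; apply: eq_bigr => n _; rewrite mulrCA.
have -> : conv (sibuya alpha) (nbin (- (alpha * i%:R))) k =
    nbin (- (alpha * i%:R)) k - conv (nbin (- alpha)) (nbin (- (alpha * i%:R))) k.
  rewrite /conv /sibuya; under eq_bigr do rewrite mulrBl.
  rewrite sumrB big_ord_recl /= mul1r subn0 big1 ?addr0// => j _.
  by rewrite mul0r.
by rewrite opprB addrC subrK conv_nbin -natr1 mulrDr mulr1 opprD addrC.
Qed.

Definition nbin_poly (n : nat) : {poly R} :=
  (n`!%:R^-1)%:P * \prod_(i < n) ('X + i%:R%:P).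

Lemma nbin_polyE n y : (nbin_poly n).[y] = nbin y n.
Proof.
rewrite /nbin_poly hornerM hornerC horner_prod nbinE /rising mulrC; congr (_ / _).
by apply: eq_bigr => i _; rewrite hornerD hornerX hornerC.
Qed.

Lemma poly_nat_roots (p : {poly R}) : (forall i : nat, p.[- i%:R] = 0) -> p = 0.
Proof.
move=> pr; apply: (@roots_geq_poly_eq0 _ p [seq - (i%:R : R) | i <- iota 0 (size p)]).
- by apply/allP => _ /mapP[i _ ->]; rewrite rootE pr.
- rewrite map_inj_uniq ?iota_uniq// => i j /oppr_inj/eqP.
  by rewrite eqr_nat => /eqP.
- by rewrite size_map size_iota.
Qed.

(* Both sides are polynomials in y, which agree at the integers y = - i. *)
Lemma nbin_sibuya (y : R) k :
  nbin (alpha * y) k = \sum_(0 <= n < k.+1) nbin y n * sibuya_conv alpha n k.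
Proof.
pose D := nbin_poly k \Po (alpha *: 'X) - \sum_(0 <= n < k.+1) (sibuya_conv alpha n k)%:P * nbin_poly n.
have DE z : D.[z] = nbin (alpha * z) k - \sum_(0 <= n < k.+1) nbin z n * sibuya_conv alpha n k.
  rewrite /D hornerD hornerN horner_comp hornerZ hornerX nbin_polyE; congr (_ - _).
  by rewrite horner_sum; apply: eq_bigr => n _; rewrite hornerM hornerC nbin_polyE mulrC.
have D0 : D = 0 by apply: poly_nat_roots => i; rewrite DE mulrN nbin_sibuya_nat subrr.
by apply/eqP; rewrite -subr_eq0 -DE D0 horner0.
Qed.

(** Both sides are the rising factorial of y of length m + n, divided by m! n!. *)
Lemma nbin_mul_shift (y : R) m n : nbin y m * nbin (y + m%:R) n = nbin y n * nbin (y + n%:R) m.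
Proof.
have risD (k l : nat) : rising y k * rising (y + k%:R) l = rising y (k + l).
  rewrite /rising big_split_ord /=; congr (_ * _); apply: eq_bigr => i _.
  by rewrite natrD addrA.
rewrite !nbinE mulrACA risD [X in _ = X]mulrACA risD addnC.
by congr (_ * _); rewrite mulrC.
Qed.

Lemma binomial_series (b x : R) : `|x| < 1 ->
  series (fun n => nbin b n * x ^+ n) @ \oo --> (1 - x) `^ (- b).
Proof.
move=> x1; have h : complex.Re (x%:C%C) ^+ 2 + complex.Im (x%:C%C) ^+ 2 < 1.
  by rewrite /= expr0n addr0 -real_normK ?num_real// expr_lt1.
pose proof (cvg_Re (@cvg_nbin_cpow _ b _ h)) as hl.
have xx : 0 < 1 - x by rewrite subr_gt0 (le_lt_trans (ler_norm _)).
rewrite -[1]/(1%:C%C) -rmorphB cpow_real// -fmorphV /= -powRN in hl.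
apply: cvg_trans hl; apply: near_eq_cvg; near=> N.
by rewrite Re_sum; apply: eq_bigr => n _; rewrite /genfun_term -rmorphXn mulc_real.
Unshelve. all: end_near. Qed.

Context (nu : R) (nu_gt0 : 0 < nu).

(** Each (1 + xi)^(-(nu + n)) in the finite compound sum is expanded in powers of -xi, whence xi <
    1. After the exchange, [nbin_mul_shift] turns the inner sum over n into [nbin_sibuya] at y = nu
    + m. *)
Lemma gdist_series (xi : R) k : 0 < xi < 1 ->
  series (fun m => nbin nu m * (- xi) ^+ m * nbin (alpha * (nu + m%:R)) k) @ \oo -->
  xi `^ (- nu) * gdist alpha nu xi k.
Proof.
move=> /andP[xi0 xi1]; have x1 : 0 < 1 + xi by lra.
have nx1 : `|- xi| < 1 by rewrite normrN gtr0_norm.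
have h : (fun N => \sum_(0 <= n < k.+1) nbin nu n * sibuya_conv alpha n k *
    series (fun m => nbin (nu + n%:R) m * (- xi) ^+ m) N) @ \oo -->
    \sum_(0 <= n < k.+1) nbin nu n * sibuya_conv alpha n k * (1 - - xi) `^ (- (nu + n%:R)).
  elim: k.+1 => [|K IH].
    under eq_fun do rewrite big_nil; rewrite big_nil; exact: cvg_cst.
  under eq_fun do rewrite big_nat_recr//=.
  rewrite big_nat_recr//=; apply: cvgD => //.
  by apply: cvgMl_tmp; exact: binomial_series.
have -> : xi `^ (- nu) * gdist alpha nu xi k =
   \sum_(0 <= n < k.+1) nbin nu n * sibuya_conv alpha n k * (1 - - xi) `^ (- (nu + n%:R)).
  rewrite /gdist powRM ?invr_ge0 ?(ltW xi0) ?(ltW x1)// !mulrA -powRD; last first.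
    by rewrite (gt_eqF xi0) implybT.
  rewrite addNr powRr0 mul1r /compound big_mkord mulr_sumr; apply: eq_bigr => n _.
  rewrite opprK opprD powRD; last by rewrite (gt_eqF x1) implybT.
  rewrite -(powR_inv1 (ltW x1)) -powRrM mulN1r -powR_mulrn ?powR_ge0// -powRrM mulN1r.
  by ring.
apply: cvg_trans h; apply: near_eq_cvg; near=> N.
rewrite /series /=; under eq_bigr do rewrite mulr_sumr.
rewrite exchange_big /=; apply: eq_bigr => m _.
rewrite nbin_sibuya mulr_sumr; apply: eq_bigr => n _.
rewrite mulrACA -nbin_mul_shift; ring.
Unshelve. all: end_near. Qed.

End explicit_series.

(** * A bound on the coefficients, explicit in the exponent *)

Section coefficient_bound.
Context {R : realType}.

Lemma nbinS_ge (b : R) j : 1 <= b -> nbin b j <= nbin b j.+1.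
Proof.
move=> b1; rewrite nbinSE ler_peMl ?nbin_ge0 ?(le_trans _ b1)//.
by rewrite ler_pdivlMr// mul1r -nat1r lerD2r.
Qed.

Lemma nbin_homo (b : R) i j : 1 <= b -> (i <= j)%N -> nbin b i <= nbin b j.
Proof.
move=> b1; elim: j => [|j IH]; first by rewrite leqn0 => /eqP ->.
rewrite leq_eqVlt => /orP[/eqP ->//|]; rewrite ltnS => /IH h.
by apply: le_trans h _; exact: nbinS_ge.
Qed.

(* As nbin b is nondecreasing, each of the k + 1 terms of index between k and 2k in
   the series of (1 - r)^(-b) is at least nbin b k * r ^+ k.*2. *)
Lemma nbin_window (b r : R) k : 1 <= b -> 0 <= r < 1 ->
  k.+1%:R * nbin b k * r ^+ k.*2 <= (1 - r) `^ (- b).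
Proof.
move=> b1 /andP[r0 r1]; have b0 : 0 <= b by apply: le_trans b1.
have r1' : `|r| < 1 by rewrite ger0_norm.
have hl := @binomial_series R b r r1'.
have t0 n : 0 <= nbin b n * r ^+ n by rewrite mulr_ge0 ?nbin_ge0 ?exprn_ge0.
have -> : (1 - r) `^ (- b) = limn (series (fun n => nbin b n * r ^+ n)).
  by rewrite (cvg_lim (@Rhausdorff R) hl).
have cv : cvgn (series (fun n => nbin b n * r ^+ n)) by apply/cvg_ex; eexists; exact: hl.
apply: le_trans (series_le_lim t0 cv k.*2.+1).
rewrite /series /= (@big_cat_nat _ _ _ k)//=; last by lia.
rewrite -[leLHS]add0r lerD ?sumr_ge0//.
rewrite (_ : k.+1%:R = \sum_(k <= i < k.*2.+1) (1 : R)); last first.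
  by rewrite sumr_const_nat -addnn subSn ?leq_addr// addnK.
rewrite -mulrA mulr_suml; apply: ler_sum_nat => i /andP[ki ik].
rewrite mul1r ler_pM ?nbin_ge0 ?exprn_ge0//; first exact: nbin_homo.
by apply: ler_wiXn2l => //; exact: ltW.
Qed.

(* nbin_window at b + 1 with r = (k + 1) / (k + 1 + c). *)
Lemma nbin_bound (b c : R) k : 0 <= b -> 0 < c ->
  nbin b k <= (b + 1) * expR (c *+ 2) * (k.+1%:R ^- 2) * (1 + k.+1%:R / c) `^ (b + 1).
Proof.
move=> b0 c0; set n : R := k.+1%:R.
have n0 : 0 < n by rewrite ltr0n.
have nc0 : 0 < n + c by lra.
pose r := n / (n + c).
have r01 : 0 <= r < 1 by rewrite divr_ge0 ?(ltW n0) ?(ltW nc0)//= ltr_pdivrMr// mul1r; lra.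
have b1 : 1 <= b + 1 by lra.
have hw := @nbin_window (b + 1) r k b1 r01.
have r0 : 0 < r by rewrite divr_gt0.
have rE : (1 - r) `^ (- (b + 1)) = (1 + n / c) `^ (b + 1).
  have -> : 1 - r = (1 + n / c)^-1 by rewrite /r; field; rewrite !gt_eqF//; lra.
  have nc1 : 0 <= 1 + n / c by rewrite addr_ge0// divr_ge0// ltW.
  by rewrite -(powR_inv1 nc1) -powRrM mulN1r opprK.
rewrite rE in hw.
(* Here 1 / r = 1 + c / n <= exp (c / n), and 2 k (c / n) <= 2 c. *)
have er : r ^- k.*2 <= expR (c *+ 2).
  have r1n : r^-1 <= expR (c / n).
    by rewrite invf_div mulrDl divff ?gt_eqF// addrC [_ + 1]addrC expR_ge1Dx.
  rewrite -exprVn (le_trans (_ : _ <= expR (c / n) ^+ k.*2))//.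
    by rewrite lerXn2r ?nnegrE ?invr_ge0 ?(ltW r0) ?expR_ge0.
  rewrite -expRM_natl ler_expR -muln2 natrM.
  have -> : k%:R * 2%:R * (c / n) = c *+ 2 * (k%:R / n) by rewrite -(mulr_natr c); ring.
  by rewrite ler_piMr ?mulrn_wge0 ?(ltW c0)// ler_pdivrMr// mul1r ler_nat.
have nb : (b + k%:R) * nbin b k = b * nbin (b + 1) k by rewrite -nbinS nbin_shift.
(* The window bound needs an exponent at least 1, hence b + 1. Coming back to b gains a factor b /
   (b + k) <= (b + 1) / n, which supplies the second power of 1 / n. The quotient is meaningless for
   b = k = 0, treated apart. *)
have h1 : nbin b k <= (b + 1) / n * nbin (b + 1) k.
  have [bk|bk] := eqVneq (b + k%:R) 0.
    have k0 : k = 0%N by apply/eqP; rewrite -(@pnatr_eq0 R); move: bk; have := ler0n R k; lra.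
    by rewrite /n k0 !nbin0 mulr1 divr1; lra.
  have bk0 : 0 < b + k%:R by rewrite lt_def bk addr_ge0.
  rewrite -(ler_pM2l bk0) nb mulrA ler_wpM2r ?nbin_ge0//; first lra.
  rewrite mulrA ler_pdivlMr// /n -natr1; have := ler0n R k; nra.
apply: le_trans h1 _.
have h2 : nbin (b + 1) k <= n^-1 * ((1 + n / c) `^ (b + 1) * r ^- k.*2).
  rewrite ler_pdivlMl// ler_pdivlMr ?exprn_gt0//.
have P0 : 0 <= (1 + n / c) `^ (b + 1) by exact: powR_ge0.
have bn0 : 0 <= (b + 1) / n by rewrite divr_ge0 ?(ltW n0)//; lra.
apply: le_trans (ler_wpM2l bn0 h2) _.
rewrite [leRHS](_ : _ = (b + 1) / n * (n^-1 * ((1 + n / c) `^ (b + 1) * expR (c *+ 2)))); last first.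
  by rewrite invfM; ring.
by rewrite ler_wpM2l// ler_wpM2l ?invr_ge0 ?(ltW n0)// ler_wpM2l.
Qed.

End coefficient_bound.

(** * The Gamma function *)

Section gamma.
Context {R : realType}.
Notation mu := (@lebesgue_measure R).
Implicit Types (x y a b s t : R).

Definition gamma_fun x t : R := t `^ (x - 1) * expR (- t).

(** Kept in the extended reals: the comparison lemma and the functional equation hold there before
    finiteness is known, and finiteness is deduced from them. *)
Definition egamma x : \bar R := (\int[mu]_(t in `]0%R, +oo[) (gamma_fun x t)%:E)%E.

Lemma gamma_fun_ge0 x t : 0 <= gamma_fun x t.
Proof. by rewrite mulr_ge0 ?powR_ge0 ?expR_ge0. Qed.

Lemma measurable_gamma_fun x (D : set R) : measurable D -> measurable_fun D (gamma_fun x).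
Proof.
move=> mD; apply: measurable_funTS; apply: measurable_funM.
  exact: measurable_powR.
by apply: measurableT_comp => //; exact: measurable_expR.
Qed.

Lemma measurable_egamma_fun x (D : set R) : measurable D -> measurable_fun D (EFin \o gamma_fun x).
Proof. by move=> mD; apply/measurable_EFinP; exact: measurable_gamma_fun. Qed.

Lemma egamma_ge0 x : (0 <= egamma x)%E.
Proof. by apply: integral_ge0 => t _; rewrite lee_fin gamma_fun_ge0. Qed.

Lemma GammaE x : Gamma x = fine (egamma x).
Proof. by []. Qed.

(** A pointwise comparison of integrands, used both for finiteness and for logarithmic convexity. *)
Lemma egamma_comb z x y a b : 0 <= a -> 0 <= b ->
  (forall t, 0 < t -> gamma_fun z t <= a * gamma_fun x t + b * gamma_fun y t) ->
  (egamma z <= a%:E * egamma x + b%:E * egamma y)%E.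
Proof.
move=> a0 b0 h; rewrite /egamma.
have m := measurable_egamma_fun.
rewrite -ge0_integralZl_EFin//; last 2 first.
- by move=> t _; rewrite lee_fin gamma_fun_ge0.
- exact: m.
rewrite -ge0_integralZl_EFin//; last 2 first.
- by move=> t _; rewrite lee_fin gamma_fun_ge0.
- exact: m.
rewrite -ge0_integralD//; last 4 first.
- by move=> t _; rewrite mule_ge0// lee_fin// gamma_fun_ge0.
- by apply: measurable_funeM; exact: m.
- by move=> t _; rewrite mule_ge0// lee_fin// gamma_fun_ge0.
- by apply: measurable_funeM; exact: m.
apply: ge0_le_integral => //.
- by move=> t _; rewrite lee_fin gamma_fun_ge0.
- exact: m.
- by apply: emeasurable_funD; apply: measurable_funeM; exact: m.
- move=> t /=; rewrite in_itv /= andbT => t0.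
  by rewrite -!EFinM -EFinD lee_fin h.
Qed.

Let gamma_bdry x t : R := t `^ x * expR (- t).

Lemma is_derive_gamma_bdry x t : 0 < t -> is_derive t 1 (gamma_bdry x) (x * gamma_fun x t - gamma_fun (x + 1) t).
Proof.
move=> t0; have h1 := is_derive1_powR x t0.
have h2 : is_derive t 1 (fun t => expR (- t)) (- expR (- t)).
  by apply: is_derive_eq; rewrite /GRing.scale /= mulrN1.
apply: (is_derive_eq (is_deriveM h1 h2)).
by rewrite /gamma_fun addrK /GRing.scale /=; ring.
Qed.

Lemma continuous_gamma_fun x t : 0 < t -> {for t, continuous (gamma_fun x)}.
Proof.
move=> t0; have h1 := is_derive1_powR (x - 1) t0.
have h2 : is_derive t 1 (fun t => expR (- t)) (- expR (- t)).
  by apply: is_derive_eq; rewrite /GRing.scale /= mulrN1.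
have [+ _] := is_deriveM h1 h2.
by move=> /derivable1_diffP/differentiable_continuous.
Qed.

Lemma within_continuous_gamma_fun x a b : 0 < a -> {within `[a, b], continuous (gamma_fun x)}.
Proof.
move=> a0; apply: continuous_in_subspaceT => t; rewrite inE /= in_itv /= => /andP[ta _].
by apply: continuous_gamma_fun; exact: lt_le_trans ta.
Qed.

Lemma integrable_gamma_fun x a b : 0 < a -> mu.-integrable `[a, b] (fun t => (gamma_fun x t)%:E).
Proof.
move=> a0; apply: continuous_compact_integrable; first exact: segment_compact.
exact: within_continuous_gamma_fun.
Qed.

(** Integration by parts written with sums only, so that both sides have limits in the extended
    reals. *)
Lemma gamma_parts x a b : 0 < a -> a < b ->
  ((\int[mu]_(t in `[a, b]) (gamma_fun (x + 1) t)%:E) + (gamma_bdry x b)%:E =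
   x%:E * (\int[mu]_(t in `[a, b]) (gamma_fun x t)%:E) + (gamma_bdry x a)%:E)%E.
Proof.
move=> a0 ab.
have cH t : 0 < t -> {for t, continuous (gamma_bdry x)}.
  by move=> t0; have [+ _] := is_derive_gamma_bdry x t0; move=> /derivable1_diffP/differentiable_continuous.
have := @continuous_FTC2 R (fun t => x * gamma_fun x t - gamma_fun (x + 1) t) (gamma_bdry x) a b ab.
move=> /(_ _ _ _)/wrap[].
- apply: continuous_in_subspaceT => t; rewrite inE /= in_itv /= => /andP[ta _].
  have t0 : 0 < t by exact: lt_le_trans ta.
  apply: cvgB; last exact: continuous_gamma_fun.
  by apply: cvgMl_tmp; exact: continuous_gamma_fun.
- split.
  + move=> t; rewrite in_itv /= => /andP[ta _].
    by have [] := is_derive_gamma_bdry x (lt_trans a0 ta).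
  + by apply: cvg_at_right_filter; exact: cH.
  + by apply: cvg_at_left_filter; apply: cH; exact: lt_trans ab.
- move=> t; rewrite in_itv /= => /andP[ta _].
  by have [_ <-] := is_derive_gamma_bdry x (lt_trans a0 ta); rewrite derive1E.
have i1 := @integrable_gamma_fun x a b a0.
have i2 := @integrable_gamma_fun (x + 1) a b a0.
rewrite -EFinB.
under eq_integral do rewrite EFinB EFinM.
rewrite integralB//; last exact: integrableZl.
rewrite integralZl//.
have h1 : (\int[mu]_(t in `[a, b]) (gamma_fun x t)%:E)%E \is a fin_num by exact: integrable_fin_num.
have h2 : (\int[mu]_(t in `[a, b]) (gamma_fun (x + 1) t)%:E)%E \is a fin_num by exact: integrable_fin_num.
rewrite -(fineK h1) -(fineK h2).
by rewrite -!EFinM -EFinB => -[h]; rewrite -!EFinD; congr (_%:E); lra.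
Qed.

Lemma gamma_bdry_cvg0 x : 0 < x -> (gamma_bdry x (n.+1%:R^-1)) @[n --> \oo] --> 0.
Proof.
move=> x0.
have h : (n.+1%:R^-1 : R) `^ x @[n --> \oo] --> 0.
  apply: ((cvg_at_rightP _ _ _).1 (powR_cvg0 x0) (fun n => n.+1%:R^-1)); split => [n|].
    by rewrite invr_gt0.
  exact: cvg_harmonic.
apply: (@squeeze_cvgr _ _ _ _ (fun=> 0) (fun n => (n.+1%:R^-1 : R) `^ x)) => //; last exact: cvg_cst.
near=> n; rewrite /gamma_bdry mulr_ge0 ?powR_ge0 ?expR_ge0//= ler_piMr ?powR_ge0//.
Unshelve. all: end_near. Qed.

Lemma gamma_bdry_cvgy x : 0 < x -> (gamma_bdry x (n.+1%:R)) @[n --> \oo] --> 0.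
Proof.
(* With an integer m >= x, the exponential beats the power through its Taylor term of degree m + 1,
   leaving a factor 1 / (n + 1). *)
move=> x0; pose m := (Num.truncn x).+1.
have xm : x <= m%:R by rewrite ltW// truncnS_gt.
apply: (@squeeze_cvgr _ _ _ _ (fun=> 0) (fun n => m.+1`!%:R * n.+1%:R^-1)) => //; last 2 first.
- exact: cvg_cst.
- rewrite -[X in _ --> X](mulr0 m.+1`!%:R); apply: cvgMl_tmp.
  exact: cvg_harmonic.
near=> n; rewrite /gamma_bdry mulr_ge0 ?powR_ge0 ?expR_ge0//= expRN.
rewrite ler_pdivrMr ?expR_gt0//.
have h1 : n.+1%:R `^ x <= n.+1%:R ^+ m :> R.
  by rewrite -powR_mulrn// ler_powR// ler1n.
have h2 : n.+1%:R ^+ m.+1 / m.+1`!%:R <= expR n.+1%:R :> R.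
  by apply: le_trans (expR_ge1Dxn m (ler0n _ _)); rewrite lerDr.
apply: le_trans h1 _; rewrite -mulrA.
rewrite -ler_pdivrMl ?ltr0n ?fact_gt0// -ler_pdivrMl ?invr_gt0// invrK.
by rewrite mulrCA -exprS mulrC.
Unshelve. all: end_near. Qed.

(** A compact exhaustion of the open half-line. With n + 2 the endpoints are strictly ordered
    already at n = 0, as [gamma_parts] requires. *)
Let K n : set R := `[n.+2%:R^-1, n.+2%:R]%classic.

Lemma egamma_cvg x :
  (\int[mu]_(t in K n) (gamma_fun x t)%:E)%E @[n --> \oo] --> egamma x.
Proof.
have -> : egamma x = (\int[mu]_(t in \bigcup_n K n) (gamma_fun x t)%:E)%E.
  rewrite /egamma; congr (integral _ _ _); apply/seteqP; split => t /=.
    rewrite in_itv /= andbT => t0.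
    exists (Num.truncn (t + t^-1)) => //=; rewrite /K /= in_itv /=.
    have h : t + t^-1 < (Num.truncn (t + t^-1)).+1%:R by rewrite truncnS_gt.
    have ti0 : 0 < t^-1 by rewrite invr_gt0.
    rewrite -[X in _ <= X <= _]invrK lef_pV2 ?posrE// -natr1; apply/andP; split; lra.
  move=> [n _] /=; rewrite !in_itv /= andbT => /andP[h _].
  rewrite bnd_simp in h; apply: lt_le_trans h; by rewrite invr_gt0 ltr0n.
apply: ge0_nondecreasing_set_cvg_integral.
- apply/nondecreasing_seqP => n; rewrite subsetEset /K => t /=; rewrite !in_itv /= => /andP[h1 h2].
  apply/andP; split; last by apply: le_trans h2 _; rewrite ler_nat.
  by apply: le_trans h1; rewrite lef_pV2 ?posrE// ler_nat.
- by move=> n; exact: measurable_itv.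
- by move=> n; apply: measurable_egamma_fun; exact: measurable_itv.
- by move=> n t _; rewrite lee_fin gamma_fun_ge0.
Qed.

Lemma egammaS x : 0 < x -> egamma (x + 1) = (x%:E * egamma x)%E.
Proof.
move=> x0.
have h1 := @egamma_cvg (x + 1). have h2 := @egamma_cvg x.
have l1 : (gamma_bdry x n.+2%:R)%:E @[n --> \oo] --> 0%:E.
  apply: cvg_EFin; first by near=> n.
  by have := gamma_bdry_cvgy x0; rewrite -(cvg_shiftS (fun n => gamma_bdry x n.+1%:R)).
have l2 : (gamma_bdry x (n.+2%:R^-1))%:E @[n --> \oo] --> 0%:E.
  apply: cvg_EFin; first by near=> n.
  by have := gamma_bdry_cvg0 x0; rewrite -(cvg_shiftS (fun n => gamma_bdry x (n.+1%:R^-1))).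
have e1 : ((\int[mu]_(t in K n) (gamma_fun (x + 1) t)%:E) + (gamma_bdry x n.+2%:R)%:E)%E
    @[n --> \oo] --> (egamma (x + 1) + 0%:E)%E.
  by apply: cvgeD => //; rewrite fin_num_adde_defl.
have e2 : (x%:E * (\int[mu]_(t in K n) (gamma_fun x t)%:E) + (gamma_bdry x (n.+2%:R^-1))%:E)%E
    @[n --> \oo] --> (x%:E * egamma x + 0%:E)%E.
  apply: cvgeD => //; first by rewrite fin_num_adde_defl.
  exact: cvgeZl.
rewrite !adde0 in e1 e2.
rewrite -(cvg_lim (@ereal_hausdorff R) e1) -(cvg_lim (@ereal_hausdorff R) e2).
congr (lim (_ @ \oo)); apply/funext => n; apply: gamma_parts.
  by rewrite invr_gt0.
by rewrite (@lt_trans _ _ 1)// ?invf_lt1 ?ltr1n.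
Unshelve. all: end_near. Qed.

Lemma egamma1 : egamma 1 = 1%:E.
Proof.
rewrite /egamma.
rewrite integral_itv_obnd_cbnd; last by apply: measurable_egamma_fun; exact: measurable_itv.
have -> : (fun t => (gamma_fun 1 t)%:E) = (fun t => (expR (- t))%:E).
  by apply/funext => t; rewrite /gamma_fun subrr powRr0 mul1r.
have dE t : is_derive t 1 (fun t : R => - expR (- t)) (expR (- t)).
  by apply: is_derive_eq; rewrite /GRing.scale /= mulrN1 opprK.
have cE : continuous (fun t : R => expR (- t)).
  move=> t; have h : is_derive t 1 (fun t => expR (- t)) (- expR (- t)).
    by apply: is_derive_eq; rewrite /GRing.scale /= mulrN1.
  by have [+ _] := h; move=> /derivable1_diffP/differentiable_continuous.
rewrite (@ge0_continuous_FTC2y R (fun t => expR (- t)) (fun t => - expR (- t)) 0 0).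
- by rewrite oppr0 expR0 EFinN oppeK add0e.
- by move=> t _; rewrite expR_ge0.
- by apply: continuous_subspaceT.
- by rewrite -oppr0; apply: cvgN; exact: cvgr_expR.
- by move=> t _; have [] := dE t.
- by apply: cvg_at_right_filter; apply: cvgN; exact: cE.
- by move=> t _; have [_ <-] := dE t; rewrite derive1E.
Qed.

Lemma egamma_nat n : egamma n.+1%:R = (n`!%:R)%:E.
Proof.
elim: n => [|n IH]; first exact: egamma1.
by rewrite -natr1 egammaS ?ltr0n// IH -EFinM factS natrM.
Qed.

Lemma egamma_fin x : 0 < x -> egamma x \is a fin_num.
Proof.
(* For y >= 1 the integrand is at most the sum of those at 1 and at an integer above y, whose
   integrals are factorials. Smaller arguments are raised by the functional equation. *)
have ge1 y : 1 <= y -> egamma y \is a fin_num.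
  move=> y1; pose n := Num.truncn y.
  have yn : y <= n.+1%:R by rewrite ltW// truncnS_gt.
  rewrite ge0_fin_numE ?egamma_ge0//.
  have h : (egamma y <= 1%:E * egamma 1 + 1%:E * egamma n.+1%:R)%E.
    apply: egamma_comb => // t t0; rewrite !mul1r /gamma_fun -mulrDl ler_wpM2r ?expR_ge0//.
    have [t1|t1] := lerP t 1.
      rewrite -[leLHS]addr0 lerD ?powR_ge0// subrr powRr0.
      have y10 : 0 <= y - 1 by lra.
      have t01 : 0 < t <= 1 by rewrite t0.
      by have := ger_powR t01 y10; rewrite powRr0.
    by rewrite -[leLHS]add0r lerD ?powR_ge0// ler_powR ?(ltW t1)//; lra.
  apply: le_lt_trans h _; rewrite egamma1 egamma_nat.
  by rewrite -!EFinM -EFinD ltry.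
move=> x0; have := ge1 (x + 1); rewrite egammaS// => /(_ _) h.
have {}h : (x%:E * egamma x)%E \is a fin_num by apply: h; lra.
have : egamma x = (x^-1%:E * (x%:E * egamma x))%E.
  by rewrite muleA -EFinM mulVf ?gt_eqF// mul1e.
by move=> ->; rewrite fin_numM.
Qed.

Lemma egammaE x : 0 < x -> egamma x = (Gamma x)%:E.
Proof. by move=> x0; rewrite GammaE fineK// egamma_fin. Qed.

Lemma Gamma_ge0 x : 0 <= Gamma x.
Proof. by rewrite GammaE fine_ge0// egamma_ge0. Qed.

Lemma GammaS x : 0 < x -> Gamma (x + 1) = x * Gamma x.
Proof.
move=> x0; have := egammaS x0; rewrite !egammaE//; last lra.
by rewrite -EFinM => -[].
Qed.

Lemma Gamma_nat n : Gamma (n.+1%:R : R) = n`!%:R.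
Proof. by have := egamma_nat n; rewrite egammaE// => -[]. Qed.

Lemma Gamma_comb z x y a b : 0 < z -> 0 < x -> 0 < y -> 0 <= a -> 0 <= b ->
  (forall t, 0 < t -> gamma_fun z t <= a * gamma_fun x t + b * gamma_fun y t) ->
  Gamma z <= a * Gamma x + b * Gamma y.
Proof.
move=> z0 x0 y0 a0 b0 h; have := egamma_comb a0 b0 h.
by rewrite !egammaE// -!EFinM -EFinD lee_fin.
Qed.

(** The tangent to exp at s ln a lies below exp; its values at ln a and at 0 are averaged with the
    weights s and 1 - s, and the terms in ln a cancel. *)
Lemma powR_weighted_AMGM a s : 0 < a -> 0 <= s <= 1 -> a `^ s <= 1 - s + s * a.
Proof.
move=> a0 /andP[s0 s1]; set M := a `^ s.
have ME : M = expR (s * ln a) by rewrite /M /powR gt_eqF.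
have M0 : 0 <= M by exact: powR_ge0.
have tangent y : M * (1 + (y - s * ln a)) <= expR y.
  have -> : expR y = M * expR (y - s * ln a) by rewrite ME -expRD addrC subrK.
  by rewrite ler_wpM2l// expR_ge1Dx.
have h1 := tangent (ln a); rewrite lnK ?posrE// in h1.
have h2 := tangent 0; rewrite expR0 in h2.
have := lerD (ler_wpM2l s0 h1) (ler_wpM2l (_ : 0 <= 1 - s) h2); lra.
Qed.

(** In place of Hoelder's inequality, the pointwise bound t^s <= x^s (1 - s + s t / x) is
    integrated. Comparing t with x makes the two integrals add up to x^s Gamma x, since Gamma (x +
    1) = x Gamma x. *)
Lemma Gamma_log_convex x s : 0 < x -> 0 <= s <= 1 -> Gamma (x + s) <= x `^ s * Gamma x.
Proof.
move=> x0 /andP[s0 s1].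
have xs0 : 0 <= x `^ s by exact: powR_ge0.
have -> : x `^ s * Gamma x = x `^ s * (1 - s) * Gamma x + x `^ s * (s / x) * Gamma (x + 1).
  by rewrite GammaS//; field; rewrite gt_eqF.
apply: Gamma_comb => //; [lra|lra|by rewrite mulr_ge0//; lra|by rewrite mulr_ge0// divr_ge0// ltW|].
move=> t t0; rewrite /gamma_fun.
have -> : x + s - 1 = x - 1 + s by ring.
have -> : x + 1 - 1 = x - 1 + 1 by ring.
have tN0 (r r' : R) : (r + r' == 0) ==> (t != 0) by rewrite (gt_eqF t0) implybT.
rewrite (powRD (tN0 (x - 1) s)) (powRD (tN0 (x - 1) 1)) powRr1 ?(ltW t0)//.
have T0 : 0 <= t `^ (x - 1) * expR (- t) by rewrite mulr_ge0 ?powR_ge0 ?expR_ge0.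
have : t `^ s <= x `^ s * (1 - s + s * (t / x)).
  have -> : t `^ s = x `^ s * (t / x) `^ s.
    by rewrite -powRM ?divr_ge0 ?(ltW x0) ?(ltW t0)// mulrC divfK ?gt_eqF.
  by rewrite ler_wpM2l// powR_weighted_AMGM ?divr_gt0// s0.
move=> /(ler_wpM2l T0) h.
rewrite [leLHS](_ : _ = t `^ (x - 1) * expR (- t) * t `^ s); last by ring.
apply: le_trans h _; rewrite le_eqVlt; apply/orP; left; apply/eqP; ring.
Qed.

(** Logarithmic convexity from x + 1 up to the integer n + 2 bounds a factorial by a multiple of
    Gamma (x + 1), which therefore cannot vanish. *)
Lemma Gamma_gt0 x : 0 < x -> 0 < Gamma x.
Proof.
move=> x0.
have up n : 0 < Gamma (x + n%:R) -> 0 < Gamma x.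
  elim: n => [|n IH]; first by rewrite addr0.
  rewrite -natr1 addrA GammaS ?ltr_pwDl// => h; apply: IH.
  by move: h; rewrite pmulr_rgt0// ltr_pwDl.
pose n := Num.truncn x; have /andP[nx xn] : n%:R <= x < n.+1%:R by rewrite truncn_itv ?ltW.
apply: (up 1%N).
pose s := n.+1%:R - x.
have h := @Gamma_log_convex (x + 1) s; rewrite /s (_ : x + 1 + (n.+1%:R - x) = n.+2%:R) in h; last first.
  by rewrite -(natr1 n.+1); ring.
rewrite Gamma_nat in h.
have x1 : 0 < x + 1 by lra.
have {}h : n.+1`!%:R <= (x + 1) `^ (n.+1%:R - x) * Gamma (x + 1).
  apply: h => //; rewrite -natr1 in xn *; apply/andP; split; lra.
rewrite lt_def Gamma_ge0 andbT; apply/eqP => G0; move: h; rewrite G0 mulr0.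
by rewrite leNgt ltr0n fact_gt0.
Qed.

End gamma.

Lemma cvg_seriesMl (R : realType) (k l : R) (c : nat -> R) :
  series c @ \oo --> l -> series (fun n => k * c n) @ \oo --> k * l.
Proof.
move=> cl; have -> : series (fun n => k * c n) = (fun N => k * series c N).
  by apply/funext => N; rewrite /series /= mulr_sumr.
exact: cvgMl_tmp.
Qed.

(** * Local limit *)

Section gauss_limit.
Context {R : realType}.
Implicit Types (b s : R).

Lemma nbin_Gamma b n : 0 < b -> Gamma (b + n%:R) = nbin b n * (Gamma b * n`!%:R).
Proof.
move=> b0; elim: n => [|n IH]; first by rewrite addr0 nbin0 mul1r fact0 mulr1.
rewrite -natr1 addrA GammaS ?ltr_wpDr// IH mulrA -nbinS factS natrM -natr1.
by ring.
Qed.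

(** Wendel's inequalities: convexity from x to x + s gives the upper bound, convexity from x + s to
    x + 1 the lower one, where (x / (x + s))^(1 - s) >= x / (x + s) >= 1 - s / x. *)
Lemma Gamma_wendel (x s : R) : 0 < x -> 0 <= s <= 1 ->
  (1 - s / x) * Gamma (x + 1) <= Gamma (x + s) * x `^ (1 - s) <= Gamma (x + 1).
Proof.
move=> x0 s01; have /andP[s0 s1] := s01.
have s01' : 0 <= 1 - s <= 1 by apply/andP; split; lra.
have P0 : 0 <= x `^ (1 - s) by exact: powR_ge0.
apply/andP; split; last first.
  apply: le_trans (ler_wpM2r P0 (Gamma_log_convex x0 s01)) _.
  rewrite mulrAC -powRD; last by rewrite (gt_eqF x0) implybT.
  by rewrite addrC subrK powRr1 ?(ltW x0)// GammaS.
have xs0 : 0 < x + s by lra.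
have h := Gamma_log_convex xs0 s01'.
rewrite (_ : x + s + (1 - s) = x + 1) in h; last by ring.
have q1 : 0 < x / (x + s) <= 1 by rewrite divr_gt0// ler_pdivrMr// mul1r; lra.
have s1' : 1 - s <= 1 by lra.
have hq : x / (x + s) <= (x / (x + s)) `^ (1 - s) by exact: ger1_powR.
have hl : 1 - s / x <= x / (x + s).
  rewrite ler_pdivlMr// mulrBl mul1r.
  have -> : s / x * (x + s) = s + s ^+ 2 / x by field; rewrite gt_eqF.
  by rewrite opprD addrA addrK lerBlDr lerDl divr_ge0 ?sqr_ge0// ltW.
apply: le_trans (ler_wpM2r (Gamma_ge0 _) (le_trans hl hq)) _.
apply: le_trans (ler_wpM2l (powR_ge0 _ _) h) _.
rewrite mulrA -powRM ?(ltW xs0)//; last by rewrite ltW//; case/andP: q1.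
by rewrite divfK ?gt_eqF// mulrC.
Qed.

Lemma nbin_asymp_base s : 0 < s -> s <= 1 ->
  nbin s n.+1 * n.+1%:R `^ (1 - s) @[n --> \oo] --> (Gamma s)^-1.
Proof.
move=> s0 s1; have G0 := Gamma_gt0 s0.
have lo : (1 - s * n.+1%:R^-1) / Gamma s @[n --> \oo] --> (Gamma s)^-1.
  rewrite -[X in _ --> X]mul1r; apply: cvgMr_tmp.
  rewrite -[X in _ --> X]subr0 -(mulr0 s); apply: cvgB; first exact: cvg_cst.
  by apply: cvgMl_tmp; exact: cvg_harmonic.
apply: (squeeze_cvgr _ lo (cvg_cst (Gamma s)^-1)); near=> n.
have N0 : 0 < n.+1%:R :> R by rewrite ltr0n.
have s01 : 0 <= s <= 1 by rewrite (ltW s0).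
have := Gamma_wendel N0 s01; rewrite natr1 Gamma_nat [_ + s]addrC nbin_Gamma//.
have F0 : 0 < n.+1`!%:R :> R by rewrite ltr0n fact_gt0.
set x := _ `^ _; set y := nbin _ _; set u := 1 - _ => /andP[h1 h2].
move: (Gamma s) G0 (n.+1`!%:R : R) F0 h1 h2 => G G0 F F0 h1 h2.
apply/andP; split.
  rewrite ler_pdivrMr// -(ler_pM2r F0); apply: le_trans h1 _.
  by rewrite le_eqVlt; apply/orP; left; apply/eqP; ring.
rewrite -[leRHS]mul1r ler_pdivlMr// -(ler_pM2r F0) mul1r; apply: le_trans h2.
by rewrite le_eqVlt; apply/orP; left; apply/eqP; ring.
Unshelve. all: end_near. Qed.

(** Wendel's inequalities cover exponents in ]0, 1]. Larger ones are reached by unit steps: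
    [nbin_shift] multiplies the coefficient by (b' + n) / b', and Gamma grows by the factor b'. *)
Lemma nbin_asymp b : 0 < b -> nbin b n * n%:R `^ (1 - b) @[n --> \oo] --> (Gamma b)^-1.
Proof.
suff h (m : nat) (c : R) : 0 < c -> c <= m.+1%:R -> nbin c n * n%:R `^ (1 - c) @[n --> \oo] --> (Gamma c)^-1.
  move=> b0; apply: (h (Num.truncn b)) => //; rewrite ltW//; exact: truncnS_gt.
elim: m c => [|m IH] c c0 cm.
  by rewrite -(cvg_shiftS (fun n => nbin c n * n%:R `^ (1 - c))); exact: nbin_asymp_base.
have [c1|c1] := lerP c 1.
  by rewrite -(cvg_shiftS (fun n => nbin c n * n%:R `^ (1 - c))); exact: nbin_asymp_base.
pose b' := c - 1; have b0 : 0 < b' by rewrite /b'; lra.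
have cE : c = b' + 1 by rewrite /b' subrK.
have hb : nbin b' n * n%:R `^ (1 - b') @[n --> \oo] --> (Gamma b')^-1.
  by apply: IH => //; rewrite /b' lerBlDr natr1.
rewrite cE GammaS// invfM.
rewrite -(cvg_shiftS (fun n => nbin (b' + 1) n * n%:R `^ (1 - (b' + 1)))).
have r1 : (b' * n.+1%:R^-1 + 1) / b' @[n --> \oo] --> b'^-1.
  rewrite -[X in _ --> X]mul1r; apply: cvgMr_tmp; rewrite -[X in _ --> X]add0r -(mulr0 b').
  by apply: cvgD; [apply: cvgMl_tmp; exact: cvg_harmonic|exact: cvg_cst].
move: hb; rewrite -(cvg_shiftS (fun n => nbin b' n * n%:R `^ (1 - b'))) => hb.
pose proof (cvgM r1 hb) as hM; apply: cvg_trans hM; apply: near_eq_cvg; near=> n => /=.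
set N : R := n.+1%:R; have N0 : 0 < N by rewrite ltr0n.
have e1 : nbin (b' + 1) n.+1 = (b' + N) * nbin b' n.+1 / b'.
  by rewrite -nbinS nbin_shift mulrC mulKf// gt_eqF.
rewrite e1 (_ : 1 - (b' + 1) = (1 - b') - 1); last by ring.
rewrite [N `^ (_ - 1)]powRB ?(gt_eqF N0) ?implybT// powRr1 ?(ltW N0)//.
by field; rewrite !gt_eqF.
Unshelve. all: end_near. Qed.

End gauss_limit.

(** * Term-by-term limit of the expansion *)

Section local_limit.
Context {R : realType} (alpha : R) (alpha_gt0 : 0 < alpha) (alpha_le1 : alpha <= 1).
Context (nu : R) (nu_gt0 : 0 < nu) (xi0 : R) (xi0_gt0 : 0 < xi0).

Let bexp (m : nat) : R := alpha * (nu + m%:R).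

Lemma bexp_gt0 m : 0 < bexp m.
Proof. by rewrite mulr_gt0// ltr_wpDr. Qed.

(* The term of degree m in the expansion of gdist (xi0 h^alpha) k / h. *)
Definition gterm (h : R) (k m : nat) : R :=
  xi0 `^ nu * (- xi0) ^+ m * nbin nu m * (h `^ (bexp m - 1) * nbin (bexp m) k).

(** Summability in m must hold up to any time T, although xi0 T^alpha may be large. In [nbin_bound]
    a large c shrinks the effective time to y = h (1 + (k + 1) / c), small enough for xi0 y^alpha <=
    1/4, and the price expR (2 c) is the same for all m. *)
Lemma gterm_bound (T : R) : 0 < T -> exists c C h0 : R, [/\ 1 <= c, 0 <= C, 0 < h0 &
  forall (h : R) (k m : nat), 0 < h -> h <= h0 -> h * k.+1%:R <= T ->
  xi0 * h `^ alpha < 1 /\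
  `|gterm h k m| <= C * (h * (1 + k.+1%:R / c)) `^ (alpha * nu - 1) * (nbin nu m * 2^-1 ^+ m)].
Proof.
(* z solves xi0 z^alpha = 1/4. Of the resulting factor 4^-m, a part 2^m pays for the growth of b +
   1, and 2^-m remains. *)
move=> T0; pose z := (4 * xi0)^-1 `^ alpha^-1.
have x4 : 0 < (4 * xi0)^-1 by rewrite invr_gt0 mulr_gt0.
have z0 : 0 < z by rewrite powR_gt0.
have za : z `^ alpha = (4 * xi0)^-1 by rewrite -powRrM mulVf ?gt_eqF// powRr1 ?ltW.
pose c := Num.max 1 (2 * T / z).
have c1 : 1 <= c by rewrite le_max lexx.
have c0 : 0 < c by apply: lt_le_trans c1.
have cz : 2 * T / c <= z.
  by rewrite ler_pdivrMr// [z * c]mulrC -ler_pdivrMr// /c le_max lexx orbT.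
have nu2 : 0 <= nu + 2 by rewrite addr_ge0// ltW.
(* h <= T / c and h n <= T give y <= 2 T / c <= z, by the choice of c. *)
exists c, (xi0 `^ nu * (4 * expR (c *+ 2)) * (nu + 2)), (T / c); split => //.
- by rewrite !mulr_ge0 ?powR_ge0 ?expR_ge0.
- by rewrite divr_gt0.
move=> h k m h0 hc hT; set n : R := k.+1%:R in hT *.
have n0 : 0 < n by rewrite ltr0n.
have n1 : 1 <= n by rewrite ler1n.
pose y := h * (1 + n / c).
have nc0 : 0 < 1 + n / c by rewrite ltr_pwDl// divr_ge0// ltW.
have y0 : 0 < y by rewrite mulr_gt0.
have yz : y <= z.
  apply: le_trans cz; rewrite /y mulrDr mulr1 mulrA.
  have : h * n / c <= T / c by rewrite ler_pM2r// invr_gt0.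
  have -> : 2 * T / c = T / c + T / c by ring.
  lra.
have hy : h <= y by rewrite /y ler_peMr ?(ltW h0)// lerDl divr_ge0 ?ltW.
have xiy : xi0 * y `^ alpha <= 4^-1.
  have : y `^ alpha <= z `^ alpha by rewrite ge0_ler_powR ?nnegrE ?(ltW y0) ?(ltW z0) ?(ltW alpha_gt0).
  by rewrite za invfM => /(ler_wpM2l (ltW xi0_gt0)); rewrite mulrCA divff ?mulr1// gt_eqF.
split.
  have : h `^ alpha <= y `^ alpha by rewrite ge0_ler_powR ?nnegrE ?(ltW y0) ?(ltW h0) ?(ltW alpha_gt0).
  move=> /(ler_wpM2l (ltW xi0_gt0)); lra.
set b := bexp m; have b0 : 0 < b by exact: bexp_gt0.
have hn0 : 0 <= h `^ (b - 1) * nbin b k by rewrite mulr_ge0 ?powR_ge0// nbin_ge0// ltW.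
have -> : `|gterm h k m| = xi0 `^ nu * xi0 ^+ m * nbin nu m * (h `^ (b - 1) * nbin b k).
  rewrite /gterm !normrM (ger0_norm (powR_ge0 _ _)) normrX normrN (gtr0_norm xi0_gt0).
  rewrite (ger0_norm (nbin_ge0 _ (ltW nu_gt0))) (ger0_norm (powR_ge0 _ _)).
  by rewrite (ger0_norm (nbin_ge0 _ (ltW (bexp_gt0 m)))).
have neP (u r r' : R) : 0 < u -> (r + r' == 0) ==> (u != 0) by move=> u0; rewrite (gt_eqF u0) implybT.
have k1 : h `^ (b - 1) * nbin b k <= (b + 1) * (4 * expR (c *+ 2)) * y `^ (b - 1).
  have := nbin_bound k (ltW b0) c0; rewrite -/n => /(ler_wpM2l (powR_ge0 h (b - 1))) hb.
  apply: le_trans hb _.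
  have -> : (1 + n / c) `^ (b + 1) = (1 + n / c) `^ (b - 1) * (1 + n / c) ^+ 2.
    by rewrite -powR_mulrn ?(ltW nc0)// -powRD ?neP//; congr (_ `^ _); ring.
  have -> : y `^ (b - 1) = h `^ (b - 1) * (1 + n / c) `^ (b - 1) by rewrite powRM// ltW.
  have hh : (1 + n / c) ^+ 2 <= 4 * n ^+ 2.
    have -> : 4 * n ^+ 2 = (2 * n) ^+ 2 by ring.
    rewrite ler_pXn2r ?nnegrE ?(ltW nc0)//; last by rewrite mulr_ge0// ltW.
    have : n / c <= n by rewrite ler_pdivrMr// ler_peMr// ltW.
    lra.
  have {}hh : n ^- 2 * (1 + n / c) ^+ 2 <= 4.
    by rewrite mulrC ler_pdivrMr// exprn_gt0.
  rewrite [leLHS](_ : _ = (b + 1) * expR (c *+ 2) * (h `^ (b - 1) * (1 + n / c) `^ (b - 1)) *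
    (n ^- 2 * (1 + n / c) ^+ 2)); last by ring.
  rewrite [leRHS](_ : _ = (b + 1) * expR (c *+ 2) * (h `^ (b - 1) * (1 + n / c) `^ (b - 1)) * 4); last by ring.
  by rewrite ler_wpM2l// !mulr_ge0 ?powR_ge0 ?expR_ge0//; lra.
have yb : y `^ (b - 1) = y `^ (alpha * nu - 1) * (y `^ alpha) ^+ m.
  rewrite -powR_mulrn ?powR_ge0// -powRrM -powRD ?neP//.
  by congr (_ `^ _); rewrite /b /bexp; ring.
have bm : b + 1 <= (nu + 2) * 2 ^+ m.
  have m2 : m.+1%:R <= 2 ^+ m :> R by rewrite -natrX ler_nat ltn_expl.
  have : b <= nu + m%:R by rewrite /b /bexp ler_piMl// addr_ge0// ltW.
  have m0 : 0 <= m%:R :> R by [].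
  rewrite -natr1 in m2; move: (m%:R : R) (2 ^+ m : R) m0 m2 => q w q0 qw bq.
  have : nu <= nu * w by rewrite ler_peMr ?(ltW nu_gt0)//; lra.
  by rewrite mulrDl; lra.
have X0 : 0 <= xi0 `^ nu * xi0 ^+ m * nbin nu m.
  by rewrite !mulr_ge0 ?powR_ge0 ?exprn_ge0 ?nbin_ge0 ?(ltW xi0_gt0) ?(ltW nu_gt0).
apply: le_trans (ler_wpM2l X0 k1) _; rewrite yb.
have q : (xi0 * y `^ alpha) ^+ m * 2 ^+ m <= 2^-1 ^+ m.
  rewrite -exprMn lerXn2r ?nnegrE ?mulr_ge0 ?powR_ge0 ?(ltW xi0_gt0)//; lra.
rewrite [leLHS](_ : _ = xi0 `^ nu * (4 * expR (c *+ 2)) * y `^ (alpha * nu - 1) * nbin nu m * ((xi0 * y `^ alpha) ^+ m * (b + 1))); last by rewrite exprMn; ring.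
rewrite [leRHS](_ : _ = xi0 `^ nu * (4 * expR (c *+ 2)) * y `^ (alpha * nu - 1) * nbin nu m * ((nu + 2) * 2^-1 ^+ m)); last by ring.
have Y0 : 0 <= xi0 `^ nu * (4 * expR (c *+ 2)) * y `^ (alpha * nu - 1) * nbin nu m.
  by rewrite !mulr_ge0 ?powR_ge0 ?expR_ge0 ?nbin_ge0 ?(ltW nu_gt0).
rewrite ler_wpM2l//.
have xy0 : 0 <= (xi0 * y `^ alpha) ^+ m by rewrite exprn_ge0 ?mulr_ge0 ?powR_ge0 ?(ltW xi0_gt0).
apply: le_trans (ler_wpM2l xy0 bm) _.
by rewrite mulrCA ler_wpM2l//; lra.
Qed.

Lemma cvg_series_gterm (h : R) k : 0 < h -> xi0 * h `^ alpha < 1 ->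
  series (gterm h k) @ \oo --> gdist alpha nu (xi0 * h `^ alpha) k / h.
Proof.
move=> h0 x1; set xi := xi0 * h `^ alpha.
have ha : 0 < h `^ alpha by rewrite powR_gt0.
have xi_gt0 : 0 < xi by rewrite mulr_gt0.
have x01 : 0 < xi < 1 by rewrite xi_gt0.
have hs : series (fun m => nbin nu m * (- xi) ^+ m * nbin (alpha * (nu + m%:R)) k) @ \oo -->
    xi `^ (- nu) * gdist alpha nu xi k by exact: gdist_series.
have := cvg_seriesMl (k := xi `^ nu / h) hs.
rewrite (_ : _ * (_ * gdist _ _ _ _) = gdist alpha nu xi k / h); last first.
  rewrite [_ * (_ * _)](_ : _ = xi `^ nu * xi `^ (- nu) * gdist alpha nu xi k / h); last by ring.
  by rewrite -powRD ?subrr ?powRr0 ?mul1r// (gt_eqF xi_gt0) implybT.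
move=> hl; apply: cvg_trans hl; apply: near_eq_cvg; near=> N => /=.
rewrite /series /=; apply: eq_bigr => m _.
have neP (r r' : R) : (r + r' == 0) ==> (h != 0) by rewrite (gt_eqF h0) implybT.
rewrite /gterm; have -> : h `^ (bexp m - 1) = (h `^ alpha) `^ nu * (h `^ alpha) ^+ m / h.
  rewrite -powR_mulrn ?powR_ge0// -!powRrM -(powR_inv1 (ltW h0)) -!powRD//.
  by congr (_ `^ _); rewrite /bexp; ring.
have -> : xi `^ nu = xi0 `^ nu * (h `^ alpha) `^ nu by rewrite powRM// ltW.
have -> : (- xi) ^+ m = (- xi0) ^+ m * (h `^ alpha) ^+ m by rewrite /xi -mulNr exprMn.
ring.
Unshelve. all: end_near. Qed.

Lemma is_cvg_nbin_half : cvgn (series (fun m => nbin nu m * 2^-1 ^+ m)).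
Proof.
have h : 0 <= (2^-1 : R) < 1 by apply/andP; split; lra.
have <- : (fun n => `|nbin nu n| * 2^-1 ^+ n) = (fun m => nbin nu m * 2^-1 ^+ m).
  by apply/funext => n; rewrite ger0_norm ?nbin_ge0 ?(ltW nu_gt0).
exact: (@is_cvg_series_nbin_norm _ nu _ h).
Qed.

(** [gterm_bound] summed over m. The bound retains the power singularity of the density at the
    origin, which is integrable, so that it can serve as a dominating function. *)
Lemma gdist_le (T : R) : 0 < T -> exists c C h0 : R, [/\ 1 <= c, 0 <= C, 0 < h0 &
  forall (h : R) (k : nat), 0 < h -> h <= h0 -> h * k.+1%:R <= T ->
  gdist alpha nu (xi0 * h `^ alpha) k / h <= C * (h * (1 + k.+1%:R / c)) `^ (alpha * nu - 1)].
Proof.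
move=> T0; have [c [C [h0 [c1 C0 h00 H]]]] := gterm_bound T0.
pose S := limn (series (fun m => nbin nu m * 2^-1 ^+ m)).
have S0 : 0 <= S.
  apply: limr_ge; first exact: is_cvg_nbin_half.
  near=> N; apply: sumr_ge0 => m _.
  by rewrite mulr_ge0 ?nbin_ge0 ?(ltW nu_gt0)// exprn_ge0.
exists c, (C * S), h0; split => //; first exact: mulr_ge0.
move=> h k hp hh hT; have [x1 _] := H h k 0%N hp hh hT.
have hs := @cvg_series_gterm h k hp x1.
set Y := _ `^ (alpha * nu - 1).
have hS : (fun N => C * Y * series (fun m => nbin nu m * 2^-1 ^+ m) N) @ \oo --> C * Y * S.
  by apply: cvgMl_tmp; exact: is_cvg_nbin_half.
rewrite [leRHS]mulrAC; apply: (ler_cvg_to hs hS); near=> N.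
rewrite /series /= mulr_sumr; apply: ler_sum => m _.
by apply: le_trans (ler_norm _) _; have [] := H h k m hp hh hT.
Unshelve. all: end_near. Qed.

Definition limit_term (t : R) (m : nat) : R :=
  xi0 `^ nu * (- xi0) ^+ m * nbin nu m * (t `^ (bexp m - 1) / Gamma (bexp m)).

Lemma limit_termE t m : 0 < t -> limit_term t m = xi0 `^ nu * t `^ (alpha * nu - 1) *
  (rising nu m / m`!%:R * ((- xi0 * t `^ alpha) ^+ m / Gamma (alpha * m%:R + alpha * nu))).
Proof.
move=> t0; rewrite /limit_term -nbinE.
have neP (r r' : R) : (r + r' == 0) ==> (t != 0) by rewrite (gt_eqF t0) implybT.
have -> : t `^ (bexp m - 1) = t `^ (alpha * nu - 1) * (t `^ alpha) ^+ m.
  rewrite -powR_mulrn ?powR_ge0// -!powRrM -!powRD//.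
  by congr (_ `^ _); rewrite /bexp; ring.
have -> : alpha * m%:R + alpha * nu = bexp m by rewrite /bexp; ring.
by rewrite exprMn; ring.
Qed.

Section filters.
Context (T : Type) (F : set_system T) {FF : ProperFilter F} (h : T -> R) (k : T -> nat) (t : R).
Hypotheses (t_gt0 : 0 < t) (h0 : h x @[x --> F] --> (0 : R)^'+)
  (hk : h x * (k x)%:R @[x --> F] --> t).

Lemma near_h_gt0 : \forall x \near F, 0 < h x.
Proof. by move: (nbhs_right_gt (0 : R)) => /h0. Qed.

Lemma near_h_le (e : R) : 0 < e -> \forall x \near F, h x <= e.
Proof. by move=> /nbhs_right_le /h0. Qed.

Lemma cvg_h0 : h x @[x --> F] --> (0 : R).
Proof. exact: cvg_trans h0 (cvg_within _). Qed.

Lemma k_oo : k x @[x --> F] --> \oo.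
Proof.
apply/cvgnyPge => N.
have t2 : 0 < t / 2 by rewrite divr_gt0.
have hN := near_h_le (divr_gt0 t2 (ltr0Sn _ N)).
have ht : \forall x \near F, t / 2 < h x * (k x)%:R.
  by apply: (cvgr_gt t hk); rewrite ltr_pdivrMr// mulr_natr mulr2n ltrDl.
near=> x.
have hx0 : 0 < h x by near: x; exact: near_h_gt0.
have h1 : h x <= t / 2 / N.+1%:R by near: x.
have h2 : t / 2 < h x * (k x)%:R by near: x.
rewrite -(ler_nat R) -(ler_pM2l hx0) ltW// (le_lt_trans _ h2)//.
rewrite (le_trans (ler_wpM2r (ler0n _ N) h1))//.
by rewrite -[leLHS]mulrA ler_piMr ?(ltW t2)// mulrC ler_pdivrMr// mul1r ler_nat.
Unshelve. all: end_near. Qed.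

Lemma cvg_powR_hk (r : R) : (h x * (k x)%:R) `^ r @[x --> F] --> t `^ r.
Proof.
apply: (@cvg_continuous_comp _ _ _ _ (fun x => h x * (k x)%:R) (fun y => y `^ r) t _ hk).
have [+ _] := is_derive1_powR r t_gt0.
by move=> /derivable1_diffP/differentiable_continuous.
Qed.

(** Regrouping h^(b - 1) c_b(k) as (h k)^(b - 1) times c_b(k) k^(1 - b) isolates the asymptotics of
    [nbin_asymp]. *)
Lemma cvg_gterm m : gterm (h x) (k x) m @[x --> F] --> limit_term t m.
Proof.
apply: cvgMl_tmp.
have hN := cvg_comp _ _ k_oo (nbin_asymp (bexp_gt0 m)).
pose proof (cvgM (@cvg_powR_hk (bexp m - 1)) hN) as hM.
apply: cvg_trans hM; apply: near_eq_cvg; near=> x => /=.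
have hx0 : 0 < h x by near: x; exact: near_h_gt0.
have k0 : (0 < k x)%N.
  by near: x; move/cvgnyPgt: k_oo; exact.
have kr0 : 0 < (k x)%:R :> R by rewrite ltr0n.
rewrite powRM ?(ltW hx0)// -[1 - bexp m]opprB powRN.
field; rewrite gt_eqF// powR_gt0//.
Unshelve. all: end_near. Qed.

(** An arbitrary filter serves both the sequences of steps used for integrals and the steps dividing
    a fixed time. *)
Lemma cvg_gdist : gdist alpha nu (xi0 * h x `^ alpha) (k x) / h x @[x --> F] -->
  prabhakar_ML_density alpha nu xi0 t.
Proof.
(* Eventually h k < t + 1 and h <= 1, hence h (k + 1) <= t + 2. *)
have T0 : 0 < t + 2 by rewrite addr_gt0.
have [c [C [e [c1 C0 e0 H]]]] := gterm_bound T0.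
have c0 : 0 < c by apply: lt_le_trans c1.
pose y x := h x * (1 + (k x).+1%:R / c).
have hy : y x @[x --> F] --> t / c.
  have h1 : h x * (1 + c^-1) + h x * (k x)%:R / c @[x --> F] --> 0 * (1 + c^-1) + t / c.
    by apply: cvgD; apply: cvgMr_tmp => //; exact: cvg_h0.
  rewrite mul0r add0r in h1; apply: cvg_trans h1; apply: near_eq_cvg; near=> x.
  by rewrite /y -natr1; field; rewrite gt_eqF.
have tc : 0 < t / c by rewrite divr_gt0.
have hyp : y x `^ (alpha * nu - 1) @[x --> F] --> (t / c) `^ (alpha * nu - 1).
  apply: (@cvg_continuous_comp _ _ _ _ y (fun y => y `^ (alpha * nu - 1)) (t / c) _ hy).
  have [+ _] := is_derive1_powR (alpha * nu - 1) tc.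
  by move=> /derivable1_diffP/differentiable_continuous.
pose D := C * ((t / c) `^ (alpha * nu - 1) + 1).
pose M m := D * (nbin nu m * 2^-1 ^+ m).
have cM : cvgn (series M) by apply/cvg_ex; eexists; apply: cvg_seriesMl; exact: is_cvg_nbin_half.
have nu0 := ltW nu_gt0.
have aM : \forall x \near F, forall n, `|gterm (h x) (k x) n| <= M n.
  near=> x => n.
  have hx0 : 0 < h x by near: x; exact: near_h_gt0.
  have he : h x <= e by near: x; exact: near_h_le.
  have hT : h x * (k x).+1%:R <= t + 2.
    have h1 : h x <= 1 by near: x; exact: near_h_le.
    have h2 : h x * (k x)%:R < t + 1 by near: x; apply: (cvgr_lt t hk); rewrite ltrDl.
    by rewrite -natr1 mulrDr mulr1 (le_trans (lerD (ltW h2) h1))// -addrA.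
  have [_ hb] := H (h x) (k x) n hx0 he hT.
  apply: le_trans hb _; rewrite /M ler_wpM2r ?mulr_ge0 ?nbin_ge0 ?exprn_ge0//.
  rewrite ler_wpM2l// ltW//; near: x.
  by apply: (cvgr_lt _ hyp); rewrite ltrDl.
have AM n : `|limit_term t n| <= M n.
  pose proof (cvg_norm (@cvg_gterm n)) as h1.
  by apply: (cvgr_to_le h1); apply: filterS aM => x; exact.
pose proof (tannery cM AM aM (fun n => @cvg_gterm n)) as h0t.
(* The constant factor can be taken out of the limit only if the Prabhakar series converges; this
   follows from the domination of the limit terms, after division by P. *)
have pE : limn (series (limit_term t)) = prabhakar_ML_density alpha nu xi0 t.
  rewrite /prabhakar_ML_density /prabhakar; set P := xi0 `^ nu * _; set u := fun m => _ / _ * _.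
  have P0 : P != 0 by rewrite gt_eqF// mulr_gt0// powR_gt0.
  have uE m : limit_term t m = P * u m by exact: limit_termE.
  move: (u) uE => {}u uE.
  have cu : cvgn (series u).
    have h1 : cvgn (series (limit_term t)) by exact: is_cvg_series_dominated AM.
    have -> : u = (fun m => P^-1 * limit_term t m).
      by apply/funext => m; rewrite uE mulrA mulVf// mul1r.
    by apply/cvg_ex; eexists; apply: cvg_seriesMl; exact: h1.
  have -> : limit_term t = (fun m => P * u m) by apply/funext.
  by apply: (@cvg_lim _ (@Rhausdorff R)); apply: cvg_seriesMl.
rewrite pE in h0t; apply: cvg_trans h0t; apply: near_eq_cvg; near=> x.
have hx0 : 0 < h x by near: x; exact: near_h_gt0.
have he : h x <= e by near: x; exact: near_h_le.
have hT : h x * (k x).+1%:R <= t + 2.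
  have h1 : h x <= 1 by near: x; exact: near_h_le.
  have h2 : h x * (k x)%:R < t + 1 by near: x; apply: (cvgr_lt t hk); rewrite ltrDl.
  by rewrite -natr1 mulrDr mulr1 (le_trans (lerD (ltW h2) h1))// -addrA.
have [x1 _] := H (h x) (k x) 0%N hx0 he hT.
by apply: (@cvg_lim _ (@Rhausdorff R)); exact: cvg_series_gterm.
Unshelve. all: end_near. Qed.

End filters.

End local_limit.

(** * Step densities *)

Section step_functions.
Context {R : realType}.
Notation mu := (@lebesgue_measure R).
Implicit Types (h t : R).

Definition step_index h t : nat := Num.truncn (t / h).

Lemma step_index_itv h t : 0 < h -> 0 <= t ->
  (step_index h t)%:R * h <= t < (step_index h t).+1%:R * h.
Proof.
move=> h0 t0; have := truncn_itv (divr_ge0 t0 (ltW h0)).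
by rewrite ler_pdivlMr// ltr_pdivrMr.
Qed.

Lemma step_index_eq h t n : 0 < h -> n%:R * h <= t < n.+1%:R * h -> step_index h t = n.
Proof.
by move=> h0 tn; apply: truncn_def; rewrite ler_pdivlMr// ltr_pdivrMr.
Qed.

Lemma pos_halfline_cover h : 0 < h ->
  `[0, +oo[%classic = \bigcup_n `[n%:R * h, n.+1%:R * h[%classic.
Proof.
move=> h0; apply/seteqP; split => t /=.
  rewrite in_itv /= andbT => t0; exists (step_index h t) => //=.
  by rewrite in_itv /=; exact: step_index_itv.
move=> [n _] /=; rewrite !in_itv /= andbT => /andP[+ _].
by apply: le_trans; rewrite mulr_ge0// ltW.
Qed.

Lemma trivIset_steps h : 0 < h -> trivIset setT (fun n => `[n%:R * h, n.+1%:R * h[%classic).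
Proof.
move=> h0; apply/trivIsetP => i j _ _ ij; apply/seteqP; split => // t /= [].
rewrite !in_itv /= => hi hj; move: ij.
by rewrite -(step_index_eq h0 hi) -(step_index_eq h0 hj) eqxx.
Qed.

Lemma measurable_step d (T : measurableType d) h (a : nat -> T) (D : set R) :
  0 < h -> measurable D -> D `<=` `[0, +oo[ ->
  measurable_fun D (fun t => a (step_index h t)).
Proof.
move=> h0 mD D0 _ B mB.
have -> : D `&` (fun t => a (step_index h t)) @^-1` B =
    \bigcup_(n in [set n | B (a n)]) (D `&` `[n%:R * h, n.+1%:R * h[%classic).
  apply/seteqP; split => t /=.
    move=> [Dt Bt]; exists (step_index h t) => //=; split => //.
    rewrite in_itv /=; apply: step_index_itv => //.
    by have := D0 _ Dt; rewrite /= in_itv /= andbT.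
  move=> [n Bn] [Dt] /=; rewrite in_itv /= => tn; split => //.
  by rewrite (step_index_eq h0 tn).
apply: bigcup_measurable => n _; apply: measurableI => //; exact: measurable_itv.
Qed.

Lemma measurable_step_pos d (T : measurableType d) h (a : nat -> T) :
  0 < h -> measurable_fun (`]0, +oo[%classic : set R) (fun t => a (step_index h t)).
Proof.
move=> h0; apply: measurable_step => //.
by move=> t /=; rewrite !in_itv /= !andbT => /ltW.
Qed.

Lemma integral_step h (a : nat -> R) : 0 < h -> (forall n, 0 <= a n) ->
  (\int[mu]_(t in `]0%R, +oo[) (a (step_index h t))%:E =
   \sum_(n <oo) (h * a n)%:E)%E.
Proof.
move=> h0 a0; rewrite integral_itv_obnd_cbnd; last first.
  by apply: (@measurable_step_pos _ _ h (EFin \o a)).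
rewrite (pos_halfline_cover h0) ge0_integral_bigcup//.
- apply: eq_eseriesr => n _.
  rewrite (eq_integral (cst (a n)%:E)); last first.
    by move=> t; rewrite inE /= in_itv /= => tn; rewrite (step_index_eq h0 tn).
  rewrite integral_cst; last exact: measurable_itv.
  have E : mu `[n%:R * h, n.+1%:R * h[%classic = h%:E.
    rewrite lebesgue_measure_itv /= lte_fin ltr_pM2r// ltr_nat ltnSn.
    by rewrite -EFinB -mulrBl -natr1 [_ + 1]addrC addrK mul1r.
  by rewrite [h * a n]mulrC EFinM; congr (_ * _)%E; exact: E.
- rewrite -(pos_halfline_cover h0); apply: (@measurable_step _ _ h (EFin \o a)) => //.
- by move=> t _; rewrite lee_fin.
- exact: trivIset_steps.
Qed.

Lemma nneseries_EFin (u : nat -> R) (l : R) : series u @ \oo --> l ->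
  (\sum_(n <oo) (u n)%:E = l%:E)%E.
Proof.
move=> ul; apply: (cvg_lim (@ereal_hausdorff R)).
have : (fun N => (series u N)%:E) @ \oo --> l%:E by apply: cvg_EFin => //; near=> N.
by under eq_fun do rewrite /series /= -sumEFin.
Unshelve. all: end_near. Qed.

Lemma integral_step_cvg h (a : nat -> R) (l : R) : 0 < h -> (forall n, 0 <= a n) ->
  series a @ \oo --> l ->
  (\int[mu]_(t in `]0%R, +oo[) (a (step_index h t))%:E = (h * l)%:E)%E.
Proof.
by move=> h0 a0 al; rewrite integral_step//; apply: nneseries_EFin; exact: cvg_seriesMl.
Qed.

Lemma scaled_densityE h (g : nat -> R) n : 0 < h -> scaled_density h g (n%:R * h) = g n / h.
Proof.
move=> h0; rewrite /scaled_density (@lim_series_finite _ _ n.+1); last first.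
  move=> k nk; rewrite /delta -mulrBl mulf_eq0 (gt_eqF h0) orbF subr_eq0 eqr_nat.
  by rewrite ltn_eqF// mulr0.
rewrite seriesSr /delta subrr eqxx /series /= big_nat big1 ?add0r// => k /andP[_ kn].
rewrite -mulrBl mulf_eq0 (gt_eqF h0) orbF subr_eq0 eqr_nat.
by rewrite gtn_eqF// mulr0.
Qed.

Lemma floor_step_index h t : 0 < h -> 0 <= t -> (Num.floor (t / h))%:~R = (step_index h t)%:R :> R.
Proof.
move=> h0 t0; rewrite /step_index truncn_floor divr_ge0 ?(ltW h0)//.
by rewrite -[in LHS](gez0_abs (_ : 0 <= Num.floor (t / h)))// floor_ge0 divr_ge0// ltW.
Qed.

(** A fixed delay j displaces the time by j h -> 0. The first conclusion makes the truncated
    subtraction a true one. *)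
Lemma cvg_step_index (T : Type) (F : set_system T) {FF : ProperFilter F} (h : T -> R) t j :
  0 < t -> h x @[x --> F] --> (0 : R)^'+ ->
  (\forall x \near F, (j <= step_index (h x) t)%N) /\
  h x * (step_index (h x) t - j)%N%:R @[x --> F] --> t.
Proof.
move=> t0 h0.
have jle : \forall x \near F, (j <= step_index (h x) t)%N.
  near=> x; have hx0 : 0 < h x by near: x; exact: near_h_gt0 h0.
  rewrite /step_index truncn_ge_nat ?divr_ge0 ?(ltW t0) ?(ltW hx0)//.
  have ht : h x <= t / j.+1%:R by near: x; apply: (near_h_le h0); rewrite divr_gt0.
  rewrite ler_pdivlMr// (le_trans (ler_wpM2l (ler0n _ _) ht))// mulrC -mulrA.
  by rewrite ler_piMr ?(ltW t0)// mulrC ler_pdivrMr// mul1r ler_nat.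
split => //.
have lo : t - h x * j.+1%:R @[x --> F] --> t.
  rewrite -[X in _ --> X]subr0 -(mul0r j.+1%:R); apply: cvgB; first exact: cvg_cst.
  by apply: cvgMr_tmp; exact: cvg_h0.
apply: (squeeze_cvgr _ lo (cvg_cst t)); near=> x.
have hx0 : 0 < h x by near: x; exact: near_h_gt0 h0.
have jx : (j <= step_index (h x) t)%N by near: x.
have := step_index_itv hx0 (ltW t0); rewrite natrB// -!natr1.
have : 0 <= h x * j%:R by rewrite mulr_ge0// ltW.
set i := (step_index _ _)%:R; rewrite mulrBr mulrDr mulrDl mulr1 mul1r mulrC.
by move=> ? /andP[? ?]; apply/andP; split; lra.
Unshelve. all: end_near. Qed.

End step_functions.

Lemma cvg_right0 (R : realType) (T : Type) (F : set_system T) {FF : Filter F} (u : T -> R) :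
  (\forall x \near F, 0 < u x) -> u x @[x --> F] --> (0 : R) -> u x @[x --> F] --> (0 : R)^'+.
Proof.
move=> u0 ul A nA; have := ul _ nA; rewrite !nbhs_simpl /= => hA.
by apply: filterS2 u0 hA => x ux; apply.
Qed.

(** * Delayed lattice densities and the Laplace transform *)

Section density.
Context {R : realType} (alpha : R) (alpha_gt0 : 0 < alpha) (alpha_le1 : alpha <= 1).
Context (nu : R) (nu_gt0 : 0 < nu) (xi0 : R) (xi0_gt0 : 0 < xi0).
Notation mu := (@lebesgue_measure R).
Let g (h : R) := gdist alpha nu (xi0 * h `^ alpha).
Let p := prabhakar_ML_density alpha nu xi0.
Let D : set R := `]0, +oo[%classic.

Lemma scaled_xi_gt0 (h : R) : 0 < h -> 0 < xi0 * h `^ alpha.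
Proof. by move=> h0; rewrite mulr_gt0// powR_gt0. Qed.

(* The lattice density theta / h in the case where f is the point mass at j. *)
Definition delayed_gdist (h : R) (j n : nat) : R := if (j <= n)%N then g h (n - j) / h else 0.

Lemma delayed_ge0 h j n : 0 < h -> 0 <= delayed_gdist h j n.
Proof.
move=> h0; rewrite /delayed_gdist; case: ifP => // _.
by rewrite divr_ge0 ?(ltW h0)// gdist_ge0// scaled_xi_gt0.
Qed.

Lemma series_delayed h j : 0 < h -> series (delayed_gdist h j) @ \oo --> h^-1.
Proof.
move=> h0; rewrite -(cvg_shiftn j).
have := cvg_seriesMl (k := h^-1) (series_gdist alpha_gt0 alpha_le1 nu_gt0 (scaled_xi_gt0 h0)).
rewrite mulr1; apply: cvg_trans; apply: near_eq_cvg; near=> N => /=.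
rewrite /series /= [RHS](@big_cat_nat _ _ _ j)//=; last exact: leq_addl.
rewrite [X in _ = X + _]big_nat [X in _ = X + _]big1 ?add0r; last first.
  by move=> i /andP[_ ij]; rewrite /delayed_gdist leqNgt ij.
have := big_addn 0 (N + j) j xpredT (delayed_gdist h j); rewrite add0n addnK => ->; apply: eq_bigr => i _.
by rewrite /delayed_gdist leq_addl addnK mulrC.
Unshelve. all: end_near. Qed.

Lemma integral_delayed h j : 0 < h ->
  (\int[mu]_(t in D) (delayed_gdist h j (step_index h t))%:E = 1)%E.
Proof.
move=> h0; rewrite (integral_step_cvg h0 _ (series_delayed j h0)).
  by rewrite mulfV ?gt_eqF.
by move=> n; exact: delayed_ge0.
Qed.

Lemma cvg_delayed (T : Type) (F : set_system T) {FF : ProperFilter F} (h : T -> R) t j :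
  0 < t -> h x @[x --> F] --> (0 : R)^'+ ->
  delayed_gdist (h x) j (step_index (h x) t) @[x --> F] --> p t.
Proof.
move=> t0 h0; have [jle hk] := cvg_step_index j t0 h0.
pose proof (cvg_gdist alpha_gt0 alpha_le1 nu_gt0 xi0_gt0 t0 h0 hk) as hl.
apply: cvg_trans hl; apply: near_eq_cvg; near=> x.
by rewrite /delayed_gdist ifT//; near: x.
Unshelve. all: end_near. Qed.

Let hn (n : nat) : R := n.+1%:R^-1.

Lemma mesh_gt0 n : 0 < hn n.
Proof. by rewrite invr_gt0 ltr0n. Qed.

Lemma cvg_mesh_right : hn n @[n --> \oo] --> (0 : R)^'+.
Proof.
apply: cvg_right0; first by near=> n; exact: mesh_gt0.
exact: cvg_harmonic.
Unshelve. all: end_near. Qed.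

(** The sign cannot be read from the alternating series; like measurability below, it is inherited
    from the lattice densities converging to p. *)
Lemma density_ge0 t : 0 < t -> 0 <= p t.
Proof.
move=> t0; pose proof (@cvg_delayed _ \oo _ hn t 0%N t0 cvg_mesh_right) as h.
apply: (cvgr_to_ge h); near=> n; exact: delayed_ge0 (mesh_gt0 n).
Unshelve. all: end_near. Qed.

Lemma measurable_delayed h j : 0 < h -> measurable_fun D (fun t => delayed_gdist h j (step_index h t)).
Proof. by move=> h0; exact: measurable_step_pos. Qed.

Lemma measurable_density : measurable_fun D p.
Proof.
apply: (@measurable_fun_cvg _ _ _ D (fun n t => delayed_gdist (hn n) 0 (step_index (hn n) t))).
  by move=> n; apply: measurable_delayed; exact: mesh_gt0.
move=> t; rewrite /D /= in_itv /= andbT => t0.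
exact: (@cvg_delayed _ \oo _ hn t 0 t0 cvg_mesh_right).
Qed.

(** At u = 1 - h s the factor h^alpha cancels, so the generating function equals the Laplace
    transform of the limit for every h, not only as h -> 0. *)
Lemma gdist_laplace h s : 0 < h -> 0 < s -> h * s < 1 ->
  series (fun k => g h k * (1 - h * s) ^+ k) @ \oo --> (xi0 / (xi0 + s `^ alpha)) `^ nu.
Proof.
move=> h0 s0 hs1; have hs0 : 0 < h * s by rewrite mulr_gt0.
set u := 1 - h * s; have u1 : `|u%:C%C| <= 1.
  by rewrite normc_le1 /= expr0n addr0 -real_normK ?num_real// exprn_ile1// ger0_norm; rewrite /u; lra.
have x0 := scaled_xi_gt0 h0.
pose proof (cvg_Re (cvg_genfun_gdist alpha_gt0 alpha_le1 nu_gt0 x0 u1)) as hl.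
have E : (xi0 * h `^ alpha) `^ nu / (xi0 * h `^ alpha + (h * s) `^ alpha) `^ nu =
    (xi0 / (xi0 + s `^ alpha)) `^ nu.
  have ha : 0 < h `^ alpha by rewrite powR_gt0.
  have xs : 0 < xi0 + s `^ alpha by rewrite addr_gt0// powR_gt0.
  rewrite [(h * s) `^ _]powRM ?(ltW h0) ?(ltW s0)//.
  rewrite (_ : xi0 * h `^ alpha + h `^ alpha * s `^ alpha = (xi0 + s `^ alpha) * h `^ alpha); last by ring.
  rewrite !powRM ?invr_ge0 ?powR_ge0 ?(ltW xi0_gt0) ?(ltW xs)//.
  have -> : (xi0 + s `^ alpha)^-1 `^ nu = ((xi0 + s `^ alpha) `^ nu)^-1.
    by rewrite -[X in X `^ nu](powR_inv1 (ltW xs)) -powRrM mulN1r powRN.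
  by field; rewrite !gt_eqF ?powR_gt0.
have Eu : 1 - u%:C%C = (h * s)%:C%C by rewrite -(rmorphB _ 1) /u opprB addrC subrK.
rewrite -E; rewrite Eu in hl.
rewrite cpow_real// -rmorphD cpow_real ?addr_gt0 ?powR_gt0// -fmorphV -rmorphM /= in hl.
apply: cvg_trans hl; apply: near_eq_cvg; near=> N.
by rewrite Re_sum; apply: eq_bigr => k _; rewrite /genfun_term -rmorphXn -rmorphM.
Unshelve. all: end_near. Qed.

Lemma series_gdist_le1 h N : 0 < h -> series (g h) N <= 1.
Proof.
move=> h0; have g0 k : 0 <= g h k := gdist_ge0 alpha_gt0 alpha_le1 nu_gt0 k (scaled_xi_gt0 h0).
have gl := series_gdist alpha_gt0 alpha_le1 nu_gt0 (scaled_xi_gt0 h0).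
have c : cvgn (series (g h)) by apply/cvg_ex; exists 1.
by have := series_le_lim g0 c N; rewrite (cvg_lim (@Rhausdorff R) gl).
Qed.

(** In the Laplace sum the first N weights are at most 1, and the rest contributes at most (1 - h
    s)^N times a mass at most 1. *)
Lemma upper_tail h s N : 0 < h -> 0 < s -> h * s < 1 ->
  (xi0 / (xi0 + s `^ alpha)) `^ nu - (1 - h * s) ^+ N <= series (g h) N.
Proof.
move=> h0 s0 hs1; have hs0 : 0 < h * s by rewrite mulr_gt0.
have g0 k : 0 <= g h k := gdist_ge0 alpha_gt0 alpha_le1 nu_gt0 k (scaled_xi_gt0 h0).
rewrite lerBlDr; apply: (cvgr_to_le (gdist_laplace h0 s0 hs1)).
set u := 1 - h * s; have u0 : 0 <= u by rewrite /u; lra.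
have u1 : u <= 1 by rewrite /u; lra.
near=> M; have NM : (N <= M)%N by near: M; exact: nbhs_infty_ge.
rewrite /series /= (@big_cat_nat _ _ _ N)//= lerD//.
  by apply: ler_sum => k _; rewrite ler_piMr// exprn_ile1.
apply: (@le_trans _ _ (\sum_(N <= k < M) g h k * u ^+ N)).
  by apply: ler_sum_nat => k /andP[Nk _]; rewrite ler_wpM2l// ler_wiXn2l.
rewrite -mulr_suml ler_piMl ?exprn_ge0//.
apply: le_trans (series_gdist_le1 M h0).
by rewrite /series /= [leRHS](@big_cat_nat _ _ _ N)//= lerDr sumr_ge0.
Unshelve. all: end_near. Qed.

(** In the Laplace sum the first N weights are at least (1 - h s)^N. *)
Lemma lower_tail h s N : 0 < h -> 0 < s -> h * s < 1 ->
  (1 - h * s) ^+ N * series (g h) N <= (xi0 / (xi0 + s `^ alpha)) `^ nu.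
Proof.
move=> h0 s0 hs1; have hs0 : 0 < h * s by rewrite mulr_gt0.
have g0 k : 0 <= g h k := gdist_ge0 alpha_gt0 alpha_le1 nu_gt0 k (scaled_xi_gt0 h0).
have hl := gdist_laplace h0 s0 hs1.
set u := 1 - h * s in hl *; have u0 : 0 <= u by rewrite /u; lra.
have u1 : u <= 1 by rewrite /u; lra.
have c : cvgn (series (fun k => g h k * u ^+ k)) by apply/cvg_ex; eexists; exact: hl.
have t0 k : 0 <= g h k * u ^+ k by rewrite mulr_ge0 ?exprn_ge0.
have := series_le_lim t0 c N; rewrite (cvg_lim (@Rhausdorff R) hl).
apply: le_trans; rewrite /series /= mulr_sumr; apply: ler_sum_nat => k /andP[_ kN].
by rewrite mulrC ler_wpM2l// ler_wiXn2l// ltnW.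
Qed.

Lemma laplace_near0 (e : R) : 0 < e -> exists2 s : R, 0 < s < 1 & 1 - e <= (xi0 / (xi0 + s `^ alpha)) `^ nu.
Proof.
move=> e0.
have h : (xi0 / (xi0 + s `^ alpha)) `^ nu @[s --> (0 : R)^'+] --> (1 : R).
  have h1 : xi0 / (xi0 + s `^ alpha) @[s --> (0 : R)^'+] --> (1 : R).
    rewrite -[X in _ --> X](mulfV (lt0r_neq0 xi0_gt0)); apply: cvgMl_tmp.
    apply: cvgV; first by rewrite gt_eqF.
    rewrite -[X in _ --> X]addr0; apply: cvgD; first exact: cvg_cst.
    exact: powR_cvg0.
  have -> : (1 : R) = 1 `^ nu by rewrite powR1.
  apply: (@cvg_continuous_comp _ _ _ _ (fun s => xi0 / (xi0 + s `^ alpha)) (fun y => y `^ nu) 1 _ h1).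
  have [+ _] := is_derive1_powR nu ltr01.
  by move=> /derivable1_diffP/differentiable_continuous.
have h2 : \forall s \near (0 : R)^'+, 1 - e <= (xi0 / (xi0 + s `^ alpha)) `^ nu.
  by apply: (cvgr_ge _ h); rewrite ltrBlDr ltrDl.
have h3 : \forall s \near (0 : R)^'+, 0 < s < 1.
  by near=> s; apply/andP; split; near: s; [exact: nbhs_right_gt|exact: nbhs_right_lt].
near (0 : R)^'+ => s; exists s; near: s; [exact: h3|exact: h2].
Unshelve. all: end_near. Qed.

End density.

(** * Total mass of the limit *)

Section total_mass.
Context {R : realType} (alpha : R) (alpha_gt0 : 0 < alpha) (alpha_le1 : alpha <= 1).
Context (nu : R) (nu_gt0 : 0 < nu) (xi0 : R) (xi0_gt0 : 0 < xi0).
Notation mu := (@lebesgue_measure R).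
Notation delayed := (delayed_gdist alpha nu xi0).
Let g (h : R) := gdist alpha nu (xi0 * h `^ alpha).
Let p := prabhakar_ML_density alpha nu xi0.
Let D : set R := `]0, +oo[%classic.
Let mD : measurable D. Proof. exact: measurable_itv. Qed.
Let Dpos t : D t -> 0 < t. Proof. by rewrite /D /= in_itv /= andbT. Qed.

Let mp : measurable_fun D (EFin \o p).
Proof. by apply/measurable_EFinP; exact: measurable_density. Qed.

Let p0 t : 0 < t -> 0 <= p t.
Proof. exact: density_ge0. Qed.

Lemma integral_density_le1 : (\int[mu]_(t in D) (p t)%:E <= 1)%E.
Proof.
pose hn n : R := n.+1%:R^-1.
pose G n t : \bar R := (delayed (hn n) 0 (step_index (hn n) t))%:E.
have mG n : measurable_fun D (G n).
  by apply/measurable_EFinP; apply: measurable_delayed; exact: mesh_gt0.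
have G0 n t : D t -> (0 <= G n t)%E.
  by move=> _; rewrite lee_fin; apply: delayed_ge0 => //; exact: mesh_gt0.
have := fatou mu mD mG G0.
rewrite (@eq_integral _ _ _ mu D (EFin \o p)); last first.
  move=> t /set_mem /Dpos t0.
  have Gt : G n t @[n --> \oo] --> (p t)%:E.
    apply: cvg_EFin; first by near=> n.
    exact: (@cvg_delayed _ _ alpha_gt0 alpha_le1 _ nu_gt0 _ xi0_gt0 _ \oo _ hn t 0%N t0 (@cvg_mesh_right R)).
  have cG : cvgn (G^~ t) by apply/cvg_ex; exists (p t)%:E; exact: Gt.
  by rewrite (is_cvg_limn_einfE cG); apply: cvg_lim.
move=> /le_trans; apply.
have -> : (fun n => \int[mu]_(t in D) G n t)%E = cst 1%E.
  by apply/funext => n; apply: integral_delayed => //; exact: mesh_gt0.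
have c1 : (cst 1%E : nat -> \bar R) @ \oo --> 1%E by exact: cvg_cst.
have c2 : cvgn (cst 1%E : nat -> \bar R) by apply/cvg_ex; exists 1%E.
by rewrite (is_cvg_limn_einfE c2) (cvg_lim (@ereal_hausdorff R) c1).
Unshelve. all: end_near. Qed.

Lemma integrable_gamma_fun_pos (x : R) : 0 < x -> mu.-integrable D (EFin \o gamma_fun x).
Proof.
move=> x0; apply/integrableP; split; first exact: measurable_egamma_fun.
rewrite (@eq_integral _ _ _ mu D (EFin \o gamma_fun x)).
  by have := egammaE x0; rewrite /egamma => ->; rewrite ltry.
by move=> t _ /=; rewrite ger0_norm ?gamma_fun_ge0.
Qed.

(** A power is monotone, in a direction depending on the sign of a; the sum of the end values covers
    both signs of alpha nu - 1 at once. *)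
Lemma powR_mono_or (a x y z : R) : 0 < x -> x <= y -> y <= z -> y `^ a <= x `^ a + z `^ a.
Proof.
move=> x0 xy yz; have y0 : 0 < y by exact: lt_le_trans xy.
have [a0|a0] := lerP 0 a.
  apply: (@le_trans _ _ (z `^ a)); last by rewrite lerDr powR_ge0.
  by rewrite ge0_ler_powR ?nnegrE ?(ltW y0)// ltW// (lt_le_trans y0).
apply: (@le_trans _ _ (x `^ a)); last by rewrite lerDl powR_ge0.
rewrite -[a]opprK ![_ `^ (- - a)]powRN lef_pV2 ?posrE ?powR_gt0//.
by rewrite ge0_ler_powR ?nnegrE ?(ltW x0) ?(ltW y0)// oppr_ge0 ltW.
Qed.

(* With step T / N the mass of the first N steps is at least the value on the left,
   by the Laplace transform at s; dominated convergence on ]0, T] passes to the limit. *)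
Lemma gdist_mass_le s T : 0 < s -> 0 < T ->
  (((xi0 / (xi0 + s `^ alpha)) `^ nu - expR (- (T * s)))%:E <= \int[mu]_(t in D) (p t)%:E)%E.
Proof.
move=> s0 T0.
have [c [C [h0 [c1 C0 h00 H]]]] := gdist_le alpha_gt0 alpha_le1 nu_gt0 xi0_gt0 T0.
have c0 : 0 < c by exact: lt_le_trans c1.
(* The index is shifted by m so that every step T / (n + m + 1) is at most [h0]. *)
pose m := Num.truncn (T / h0).
pose hn n : R := T * (n + m).+1%:R^-1.
have hn0 n : 0 < hn n by rewrite mulr_gt0// invr_gt0.
have hnle n : hn n <= h0.
  rewrite /hn ler_pdivrMr// mulrC -ler_pdivrMr// (le_trans (ltW (truncnS_gt _)))//.
  by rewrite ler_nat ltnS leq_addl.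
have hnT n : hn n * (n + m).+1%:R = T by rewrite /hn mulfVK.
have hnr : hn n @[n --> \oo] --> (0 : R)^'+.
  apply: cvg_right0; first by near=> n.
  rewrite -(mulr0 T); apply: cvgMl_tmp.
  have := @cvg_harmonic R; rewrite -(cvg_shiftn m); exact.
pose G n t : \bar R :=
  (if (step_index (hn n) t < (n + m).+1)%N then g (hn n) (step_index (hn n) t) / hn n else 0)%:E.
pose q t : \bar R := (if t < T then p t else 0)%:E.
have ltT n t : 0 < t -> (step_index (hn n) t < (n + m).+1)%N = (t < T).
  move=> t0; have /andP[h1 h2] := step_index_itv (hn0 n) (ltW t0).
  rewrite -[in RHS](hnT n) [hn n * _]mulrC; apply/idP/idP => h.
    by apply: lt_le_trans h2 _; rewrite ler_pM2r// ler_nat.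
  by have := le_lt_trans h1 h; rewrite ltr_pM2r// ltr_nat.
have mG n : measurable_fun D (G n).
  apply/measurable_EFinP.
  exact: (@measurable_step_pos _ _ _ (hn n) (fun k => if (k < (n + m).+1)%N then g (hn n) k / hn n else 0)).
have g0 n k : 0 <= g (hn n) k by apply: gdist_ge0 => //; exact: scaled_xi_gt0.
have G0 n t : (0 <= G n t)%E by rewrite lee_fin; case: ifP => // _; rewrite divr_ge0// ltW.
have Gq t : D t -> G n t @[n --> \oo] --> q t.
  move=> /Dpos t0; rewrite /q; case: ifPn => [tT|tT].
    apply: cvg_EFin; first by near=> n.
    pose proof (@cvg_delayed _ _ alpha_gt0 alpha_le1 _ nu_gt0 _ xi0_gt0 _ \oo _ hn t 0%N t0 hnr) as h1.
    apply: cvg_trans h1; apply: near_eq_cvg; near=> n.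
    by rewrite /= ltT// tT /delayed_gdist leq0n subn0.
  apply: cvg_near_cst; near=> n.
  by rewrite /G ltT// (negbTE tT).
(* The dominating function is built from Gamma integrands, already known to be integrable; expR T
   compensates their factor exp (- t) for t < T. *)
pose K1 := C * expR T * c^-1 `^ (alpha * nu - 1).
pose K2 := C * expR T * (2 * T) `^ (alpha * nu - 1).
pose B t : \bar R := (K1%:E * (gamma_fun (alpha * nu) t)%:E + K2%:E * (gamma_fun 1 t)%:E)%E.
have iB : mu.-integrable D B.
  by apply: integrableD => //; apply: integrableZl => //; apply: integrable_gamma_fun_pos => //; rewrite mulr_gt0.
have GB t n : D t -> (`|G n t| <= B t)%E.
  move=> /Dpos t0; rewrite gee0_abs// /G /B -!EFinM -EFinD lee_fin.
  have gf x : 0 <= gamma_fun x t by exact: gamma_fun_ge0.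
  have K10 : 0 <= K1 by rewrite !mulr_ge0 ?powR_ge0 ?expR_ge0.
  have K20 : 0 <= K2 by rewrite !mulr_ge0 ?powR_ge0 ?expR_ge0.
  case: ifPn => [ktT|_]; last by rewrite addr_ge0// mulr_ge0.
  have tT : t < T by rewrite -(ltT n).
  have /andP[_ h2] := step_index_itv (hn0 n) (ltW t0).
  set k := step_index _ _ in ktT h2 *.
  have kT : hn n * k.+1%:R <= T by rewrite -[leRHS](hnT n) ler_pM2l// ler_nat.
  apply: le_trans (H _ _ (hn0 n) (hnle n) kT) _.
  have y1 : t / c <= hn n * (1 + k.+1%:R / c).
    rewrite mulrDr mulr1 mulrA ler_wpDl ?(ltW (hn0 n))// ler_pM2r ?invr_gt0// mulrC.
    exact: ltW.
  have y2 : hn n * (1 + k.+1%:R / c) <= 2 * T.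
    rewrite mulrDr mulr1 mulrA mulr2n mulrDl mul1r lerD//.
      by rewrite -[leRHS](hnT n) ler_peMr ?(ltW (hn0 n))// ler1n.
    by rewrite ler_pdivrMr// (le_trans kT)// ler_peMr// ltW.
  have y3 := powR_mono_or (alpha * nu - 1) (divr_gt0 t0 c0) y1 y2.
  apply: le_trans (ler_wpM2l C0 y3) _.
  have eT : 1 <= expR T * expR (- t) by rewrite -expRD -expR0 ler_expR subr_ge0 ltW.
  rewrite powRM ?(ltW t0) ?invr_ge0 ?(ltW c0)//.
  rewrite /gamma_fun subrr powRr0 mul1r /K1 /K2 mulrDr.
  set a := t `^ _; set b := c^-1 `^ _; set d := (2 * T) `^ _.
  have a0 : 0 <= a by exact: powR_ge0.
  have b0 : 0 <= b by exact: powR_ge0.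
  have d0 : 0 <= d by exact: powR_ge0.
  apply: lerD.
    rewrite [leRHS](_ : _ = C * (a * b) * (expR T * expR (- t))); last by ring.
    by rewrite ler_peMr// !mulr_ge0.
  rewrite [leRHS](_ : _ = C * d * (expR T * expR (- t))); last by ring.
  by rewrite ler_peMr// !mulr_ge0.
have mq : measurable_fun D q by exact: (emeasurable_fun_cvg G q mG Gq).
have Bfin t : D t -> B t \is a fin_num by [].
pose proof (@dominated_cvg _ _ _ mu D mD G q B mG Gq Bfin iB (fun n t => @GB t n)) as cv.
apply: (@le_trans _ _ (\int[mu]_(t in D) q t)%E); last first.
  apply: ge0_le_integral => //.
  - by move=> t /Dpos t0; rewrite /q lee_fin; case: ifP => // _; exact: p0.
  - by move=> t /Dpos t0; rewrite /q lee_fin; case: ifP => // _; exact: p0.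
have IG n : (\int[mu]_(t in D) G n t = (series (g (hn n)) (n + m).+1)%:E)%E.
  pose a k := if (k < (n + m).+1)%N then g (hn n) k / hn n else 0.
  have a0 k : 0 <= a k by rewrite /a; case: ifP => // _; rewrite divr_ge0// ltW.
  have ac : series a @ \oo --> series a (n + m).+1.
    apply: cvg_near_cst; near=> N; rewrite /series /= (@big_cat_nat _ _ _ (n + m).+1)//=.
      rewrite [X in _ + X]big_nat [X in _ + X]big1 ?addr0// => k /andP[mk _].
      by rewrite /a ltnNge mk.
    by near: N; exact: nbhs_infty_ge.
  rewrite (integral_step_cvg (hn0 n) a0 ac) /series /= mulr_sumr; congr EFin.
  by apply: eq_big_nat => k /andP[_ km]; rewrite /a km mulrC divfK// gt_eqF.
have lo : \forall n \near \oo, (((xi0 / (xi0 + s `^ alpha)) `^ nu - expR (- (T * s)))%:E <= \int[mu]_(t in D) G n t)%E.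
  have hs : \forall n \near \oo, hn n <= (2 * s)^-1.
    by apply: (@near_h_le _ _ \oo _ hnr); rewrite invr_gt0 mulr_gt0.
  near=> n; rewrite IG lee_fin.
  have hns : hn n <= (2 * s)^-1 by near: n.
  have hs1 : hn n * s < 1.
    apply: (@le_lt_trans _ _ ((2 * s)^-1 * s)); first by rewrite ler_pM2r.
    by rewrite invfM divfK ?gt_eqF// invf_lt1// ltr1n.
  (* With N steps of length h making up T, (1 - h s)^N <= exp (- h s N) = exp (- T s). *)
  apply: le_trans (upper_tail alpha_gt0 alpha_le1 nu_gt0 xi0_gt0 _ (hn0 n) s0 hs1).
  rewrite lerD2l lerN2 (_ : - (T * s) = - (hn n * s) * (n + m).+1%:R); last first.
    by rewrite -[in LHS](hnT n); ring.
  rewrite expRM_natr.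
  rewrite lerXn2r ?nnegrE ?expR_ge0//; first by lra.
  exact: expR_ge1Dx.
by apply: (cvge_to_ge cv lo).
Unshelve. all: end_near. Qed.

Lemma integral_density : (\int[mu]_(t in D) (p t)%:E = 1)%E.
Proof.
apply/eqP; rewrite eq_le integral_density_le1 /=.
apply/lee_addgt0Pr => e e0; rewrite -leeBlDr//.
have e2 : 0 < e / 2 by rewrite divr_gt0.
have [s /andP[s0 _] hs] := laplace_near0 alpha_gt0 nu xi0_gt0 e2.
(* Then T s = 2 / e, and exp (- x) <= 1 / x gives exp (- T s) <= e / 2. *)
pose T := (e / 2 * s)^-1.
have T0 : 0 < T by rewrite invr_gt0 mulr_gt0.
apply: le_trans (gdist_mass_le s0 T0); rewrite -EFinB lee_fin.
have : expR (- (T * s)) <= e / 2.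
  rewrite /T invfM divfK ?gt_eqF// expRN invf_ple ?posrE ?expR_gt0//.
  by apply: le_trans (expR_ge1Dx _); rewrite lerDr.
by lra.
Qed.

Lemma integrable_density : mu.-integrable D (EFin \o p).
Proof.
apply/integrableP; split => //.
rewrite (@eq_integral _ _ _ mu D (EFin \o p)).
  by have := integral_density => /= ->; rewrite ltry.
by move=> t /set_mem /Dpos t0 /=; rewrite ger0_norm ?p0.
Qed.

End total_mass.

(** * Convergence in mean *)

Section scheffe.
Context d (T : measurableType d) (R : realType) (mu : {measure set T -> \bar R}).
Context (D : set T) (mD : measurable D) (p : T -> R) (p0 : forall t, D t -> 0 <= p t).
Context (mp : measurable_fun D p) (ip : (\int[mu]_(t in D) (p t)%:E = 1)%E).

(** The bound 2 does not depend on the step or on the delay: it dominates the average over the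
    delays in [cvg_mean_dist]. *)
Lemma integral_dist_le (f : T -> R) : measurable_fun D f -> (forall t, D t -> 0 <= f t) ->
  (\int[mu]_(t in D) (f t)%:E = 1)%E -> (\int[mu]_(t in D) (`|f t - p t|%:E) <= 2%:E)%E.
Proof.
move=> mf f0 fi.
have -> : (2%:E = \int[mu]_(t in D) ((f t)%:E + (p t)%:E))%E.
  rewrite ge0_integralD//; [by rewrite fi ip -EFinD|..].
  - exact/measurable_EFinP.
  - exact/measurable_EFinP.
apply: ge0_le_integral => //.
- by apply/measurable_EFinP; apply: measurableT_comp => //; exact: measurable_funB.
- by apply/measurable_EFinP; exact: measurable_funD.
- move=> t Dt; rewrite -EFinD lee_fin ler_norml.
  by have := p0 Dt; have := f0 _ Dt; move=> ? ?; apply/andP; split; lra.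
Qed.

Lemma integrable_unit_mass : mu.-integrable D (EFin \o p).
Proof.
apply/integrableP; split; first exact/measurable_EFinP.
rewrite (@eq_integral _ _ _ mu D (EFin \o p)); first by rewrite [ltLHS]ip ltry.
by move=> t /set_mem Dt /=; rewrite ger0_norm ?p0.
Qed.

Lemma scheffe (f : nat -> T -> R) : (forall n, measurable_fun D (f n)) ->
  (forall n t, D t -> 0 <= f n t) -> (forall n, \int[mu]_(t in D) (f n t)%:E = 1)%E ->
  (forall t, D t -> f n t @[n --> \oo] --> p t) ->
  (\int[mu]_(t in D) (`|f n t - p t|%:E))%E @[n --> \oo] --> 0%E.
Proof.
move=> mf f0 fi fp; pose q n t := Num.max (p t - f n t) 0.
have mq n : measurable_fun D (q n) by apply: measurable_maxr => //; exact: measurable_funB.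
have q0 n t : 0 <= q n t by rewrite le_max lexx orbT.
(* |f - p| + p = f + 2 (p - f)^+, and (p - f)^+ is dominated by p. *)
have E n : (\int[mu]_(t in D) (`|f n t - p t|%:E) = 2%:E * \int[mu]_(t in D) (q n t)%:E)%E.
  have I : (\int[mu]_(t in D) (`|f n t - p t|%:E + (p t)%:E) =
      \int[mu]_(t in D) ((f n t)%:E + 2%:E * (q n t)%:E))%E.
    apply: eq_integral => t _; rewrite -EFinM -!EFinD /q; congr EFin.
    by case: (ler0P (f n t - p t)) => h; case: (ltrP (p t - f n t) 0) => h'; lra.
  have m1 : measurable_fun D (fun t => (`|f n t - p t|%:E)).
    by apply/measurable_EFinP; apply: measurableT_comp => //; exact: measurable_funB.
  have m2 : measurable_fun D (fun t => (2%:E * (q n t)%:E)%E).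
    by apply/measurable_EFinP; exact: measurable_funM.
  have m3 : measurable_fun D (EFin \o f n) by exact/measurable_EFinP.
  have m4 : measurable_fun D (EFin \o p) by exact/measurable_EFinP.
  have m5 : measurable_fun D (EFin \o q n) by exact/measurable_EFinP.
  have z1 t : D t -> (0 <= (f n t)%:E)%E by move=> Dt; rewrite lee_fin f0.
  have z2 t : D t -> (0 <= 2%:E * (q n t)%:E)%E by move=> _; rewrite mule_ge0// lee_fin.
  have z3 t : D t -> (0 <= (p t)%:E)%E by move=> Dt; rewrite lee_fin p0.
  have z4 t : D t -> (0 <= `|f n t - p t|%:E)%E by move=> Dt; rewrite lee_fin.
  have z5 t : D t -> (0 <= (q n t)%:E)%E by move=> Dt; rewrite lee_fin.
  move: I; rewrite (ge0_integralD mu mD z4 m1 z3 m4) (ge0_integralD mu mD z1 m3 z2 m2) fi ip.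
  rewrite (ge0_integralZl_EFin mu mD z5 m5)// [RHS]addeC.
  by move/(congr1 (fun x => x - 1)%E); rewrite !addeK.
under eq_fun do rewrite E.
rewrite -(mule0 2%:E); apply: cvgeZl => //.
have -> : (0 = \int[mu]_(t in D) (0 : R)%:E)%E by rewrite integral0.
apply: (@dominated_cvg _ _ _ mu D mD (fun n t => (q n t)%:E) (fun=> 0%:E) (EFin \o p)) => //.
- by move=> n; exact/measurable_EFinP.
- move=> t Dt; apply: cvg_EFin; first by near=> n.
  have -> : (0 : R) = Num.max (p t - p t) 0 by rewrite subrr maxxx.
  apply: (@cvg_continuous_comp _ _ _ _ (fun n => p t - f n t) (fun y => Num.max y 0) (p t - p t)).
    by apply: continuous_max; [exact: cvg_id|exact: cvg_cst].
  by apply: cvgB; [exact: cvg_cst|exact: fp].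
- exact: integrable_unit_mass.
- move=> n t Dt /=; rewrite ger0_norm// lee_fin /q ge_max p0// andbT.
  by rewrite gerBl f0.
Unshelve. all: end_near. Qed.

End scheffe.

Section mean_convergence.
Context {R : realType} (alpha : R) (alpha_gt0 : 0 < alpha) (alpha_le1 : alpha <= 1).
Context (nu : R) (nu_gt0 : 0 < nu) (xi0 : R) (xi0_gt0 : 0 < xi0).
Context (f : nat -> R) (f_distr : is_distribution f) (f0 : f 0%N = 0).
Notation mu := (@lebesgue_measure R).
Notation delayed := (delayed_gdist alpha nu xi0).
Let p := prabhakar_ML_density alpha nu xi0.
Let D : set R := `]0, +oo[%classic.
Let mD : measurable D. Proof. exact: measurable_itv. Qed.
Let Dpos t : D t -> 0 < t. Proof. by rewrite /D /= in_itv /= andbT. Qed.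
Let mp : measurable_fun D p. Proof. exact: measurable_density. Qed.
Let p0 t : D t -> 0 <= p t. Proof. by move=> /Dpos; exact: density_ge0. Qed.
Let ip : (\int[mu]_(t in D) (p t)%:E = 1)%E. Proof. exact: integral_density. Qed.

Definition scaled_theta (h : R) (n : nat) : R := theta alpha nu f (xi0 * h `^ alpha) n / h.

Lemma scaled_theta_delayed h n :
  scaled_theta h n = \sum_(0 <= j < n.+1) f j * delayed h j n.
Proof.
rewrite /scaled_theta /theta /conv mulr_suml big_mkord; apply: eq_bigr => j _.
by rewrite /delayed_gdist -ltnS ltn_ord mulrA.
Qed.

Lemma scaled_theta_ge0 h n : 0 < h -> 0 <= scaled_theta h n.
Proof.
move=> h0; have [[th0 _] _ _] := theta_distr alpha_gt0 alpha_le1 nu_gt0 f_distr f0 (scaled_xi_gt0 alpha xi0_gt0 h0).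
by rewrite divr_ge0 ?(ltW h0).
Qed.

Lemma series_scaled_theta h : 0 < h -> series (scaled_theta h) @ \oo --> h^-1.
Proof.
move=> h0; have [[_ th1] _ _] := theta_distr alpha_gt0 alpha_le1 nu_gt0 f_distr f0 (scaled_xi_gt0 alpha xi0_gt0 h0).
have := cvg_seriesMl (k := h^-1) th1; rewrite mulr1.
apply: cvg_trans; apply: near_eq_cvg; near=> N.
by apply: eq_bigr => k _; rewrite /scaled_theta mulrC.
Unshelve. all: end_near. Qed.

Lemma integral_scaled_theta h : 0 < h ->
  (\int[mu]_(t in D) (scaled_theta h (step_index h t))%:E = 1)%E.
Proof.
move=> h0; rewrite (integral_step_cvg h0 _ (series_scaled_theta h0)).
  by rewrite mulfV ?gt_eqF.
by move=> n; exact: scaled_theta_ge0.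
Qed.

Lemma mean_dist_le2 h : 0 < h ->
  (\int[mu]_(t in D) (`|scaled_theta h (step_index h t) - p t|%:E) <= 2%:E)%E.
Proof.
move=> h0; apply: integral_dist_le => //; last exact: integral_scaled_theta.
- exact: measurable_step_pos.
- by move=> t _; exact: scaled_theta_ge0.
Qed.

Let dist j h : \bar R := (\int[mu]_(t in D) (`|delayed h j (step_index h t) - p t|%:E))%E.

Lemma dist_le2 j h : 0 < h -> (dist j h <= 2%:E)%E.
Proof.
move=> h0; apply: integral_dist_le => //; last exact: integral_delayed.
- exact: measurable_step_pos.
- by move=> t _; exact: delayed_ge0.
Qed.

Lemma dist_ge0 j h : (0 <= dist j h)%E.
Proof. by apply: integral_ge0 => t _; rewrite lee_fin. Qed.

Lemma dist_fin j h : 0 < h -> dist j h = (fine (dist j h))%:E.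
Proof.
move=> h0; rewrite fineK// fin_real//; apply/andP; split.
  exact: lt_le_trans (dist_ge0 j h).
by apply: le_lt_trans (dist_le2 j h0) _; rewrite ltry.
Qed.

Lemma cvg_dist (u : nat -> R) j : (forall n, 0 < u n) -> u n @[n --> \oo] --> (0 : R) ->
  dist j (u n) @[n --> \oo] --> 0%E.
Proof.
move=> u0 ul; apply: (@scheffe _ _ _ mu D mD p p0 mp ip (fun n t => delayed (u n) j (step_index (u n) t))).
- by move=> n; exact: measurable_step_pos.
- by move=> n t _; exact: delayed_ge0.
- by move=> n; exact: integral_delayed.
- move=> t /Dpos t0.
  have ur : u n @[n --> \oo] --> (0 : R)^'+ by apply: cvg_right0 => //; near=> n.
  exact: (@cvg_delayed _ _ alpha_gt0 alpha_le1 _ nu_gt0 _ xi0_gt0 _ \oo _ u t j t0 ur).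
Unshelve. all: end_near. Qed.

(** As f has mass 1, p t is the f-average of the constant p t, and the triangle inequality applies
    delay by delay. Delays beyond the current index have density 0 but still count with f j p t. *)
Lemma scaled_theta_dist_le h t : 0 < h ->
  (`|scaled_theta h (step_index h t) - p t|%:E <=
   \sum_(j <oo) (f j * `|delayed h j (step_index h t) - p t|)%:E)%E.
Proof.
move=> h0; have [fge0 fs] := f_distr.
set k := step_index h t.
have c : (`|scaled_theta h k - p t * series f N|%:E) @[N --> \oo] --> `|scaled_theta h k - p t|%:E.
  apply: cvg_EFin; first by near=> N.
  apply: cvg_norm; apply: cvgB; first exact: cvg_cst.
  by rewrite -[X in _ --> X]mulr1; exact: cvgMl_tmp.
apply: (cvge_to_le c); near=> N.
have kN : (k.+1 <= N)%N by near: N; exact: nbhs_infty_ge.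
have -> : scaled_theta h k = \sum_(0 <= j < N) f j * delayed h j k.
  rewrite scaled_theta_delayed [RHS](@big_cat_nat _ _ _ k.+1)//=.
  rewrite [X in _ = _ + X]big_nat [X in _ = _ + X]big1 ?addr0// => j /andP[kj _].
  by rewrite /delayed_gdist leqNgt kj mulr0.
rewrite /series /= mulr_sumr -sumrB.
apply: (@le_trans _ _ (\sum_(0 <= j < N) (f j * `|delayed h j k - p t|)%:E)%E).
  rewrite sumEFin lee_fin (le_trans (ler_norm_sum _ _ _))//.
  by apply: ler_sum => j _; rewrite [p t * _]mulrC -mulrBr normrM ger0_norm.
by apply: nneseries_lim_ge => j _ _; rewrite lee_fin mulr_ge0.
Unshelve. all: end_near. Qed.

(** For each delay the distance tends to 0 by Scheffe's lemma, with no uniformity in j; the majorant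
    2 f j is summable for every distribution f, so no tail assumption enters. *)
Lemma cvg_mean_dist (u : nat -> R) : (forall n, 0 < u n) -> u n @[n --> \oo] --> (0 : R) ->
  (\int[mu]_(t in D) (`|scaled_theta (u n) (step_index (u n) t) - p t|%:E))%E @[n --> \oo] --> 0%E.
Proof.
move=> u0 ul; have [fge0 fs] := f_distr.
have cf2 : cvgn (series (fun j => f j * 2)).
  apply/cvg_ex; exists (2 * 1); have := cvg_seriesMl (k := 2) fs.
  apply: cvg_trans; apply: near_eq_cvg; near=> N.
  by apply: eq_bigr => j _; rewrite mulrC.
have dn n j : 0 <= fine (dist j (u n)) by rewrite fine_ge0// dist_ge0.
have d2 n j : fine (dist j (u n)) <= 2.
  by rewrite -lee_fin -dist_fin// dist_le2.
have T : limn (series (fun j => f j * fine (dist j (u n)))) @[n --> \oo] --> limn (series (fun j : nat => 0 : R)).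
  apply: (tannery cf2).
  - by move=> j; rewrite normr0 mulr_ge0.
  - by near=> n => j; rewrite ger0_norm ?mulr_ge0// ler_wpM2l.
  - move=> j; rewrite -[X in _ --> X](mulr0 (f j)); apply: cvgMl_tmp.
    by have /fine_cvg := @cvg_dist u j u0 ul; exact.
have T0 : (limn (series (fun j => f j * fine (dist j (u n)))))%:E @[n --> \oo] --> 0%E.
  apply: cvg_EFin; first by near=> n.
  have E0 : limn (series (fun j : nat => 0 : R)) = 0.
    by rewrite (@lim_series_finite _ _ 0)// /series /= big_geq.
  by rewrite E0 in T.
apply: (squeeze_cvge _ (cvg_cst _) T0); near=> n; apply/andP; split.
  by apply: integral_ge0 => t _; rewrite lee_fin.
have cs : series (fun j => f j * fine (dist j (u n))) @ \oo --> limn (series (fun j => f j * fine (dist j (u n)))).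
  apply: (is_cvg_series_dominated cf2) => j.
  by rewrite ger0_norm ?mulr_ge0// ler_wpM2l.
rewrite -(nneseries_EFin cs).
have mS j : measurable_fun D (fun t => f j * `|delayed (u n) j (step_index (u n) t) - p t|).
  apply: measurable_funM => //; apply: measurableT_comp => //; apply: measurable_funB => //.
  exact: measurable_step_pos.
have mE j : measurable_fun D (fun t => (f j * `|delayed (u n) j (step_index (u n) t) - p t|)%:E).
  exact/measurable_EFinP.
have mfj j : measurable_fun D (fun t => `|delayed (u n) j (step_index (u n) t) - p t|).
  apply: measurableT_comp => //; apply: measurable_funB => //; exact: measurable_step_pos.
apply: (@le_trans _ _ (\int[mu]_(t in D) \sum_(j <oo) (f j * `|delayed (u n) j (step_index (u n) t) - p t|)%:E)%E).
  apply: ge0_le_integral => //.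
  - apply/measurable_EFinP; apply: measurableT_comp => //; apply: measurable_funB => //.
    exact: measurable_step_pos.
  - apply: ge0_emeasurable_sum; first by move=> j t _ _; rewrite lee_fin mulr_ge0.
    by move=> j _; exact: mE.
  - by move=> t _; exact: scaled_theta_dist_le.
rewrite integral_nneseries//; last by move=> j t _; rewrite lee_fin mulr_ge0.
rewrite le_eqVlt; apply/orP; left; apply/eqP; apply: eq_eseriesr => j _.
rewrite EFinM -dist_fin//; under eq_integral do rewrite EFinM.
have mfE : measurable_fun D (fun t => `|delayed (u n) j (step_index (u n) t) - p t|%:E).
  exact/measurable_EFinP.
by apply: ge0_integralZl_EFin.
Unshelve. all: end_near. Qed.

Lemma theta_limit_in_mean :
  limit_in_mean (fun h t => scaled_density h (theta alpha nu f (xi0 * h `^ alpha)) t) p.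
Proof.
rewrite /limit_in_mean.
pose I h := (\int[mu]_(t in D) (`|scaled_theta h (step_index h t) - p t|%:E))%E.
(* [cvg_at_rightP] passes to sequences of positive steps for real-valued functions; the integral, at
   most 2, is therefore first replaced by its finite value. *)
have IE h : 0 < h -> I h = (fine (I h))%:E.
  move=> h0; rewrite fineK// fin_real//; apply/andP; split.
    by apply: (@lt_le_trans _ _ 0%E) => //; apply: integral_ge0 => t _; rewrite lee_fin.
  by apply: le_lt_trans (mean_dist_le2 h0) _; rewrite ltry.
have c : (fine (I h))%:E @[h --> (0 : R)^'+] --> 0%E.
  apply: cvg_EFin; first by near=> h.
  apply/cvg_at_rightP => u [u0 ul].
  by have /fine_cvg := cvg_mean_dist u0 ul; exact.
apply: cvg_trans c; apply: near_eq_cvg; near=> h.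
have h0 : 0 < h by near: h; exact: nbhs_right_gt.
rewrite -IE//; apply: eq_integral => t /set_mem /Dpos t0.
by rewrite floor_step_index ?(ltW t0)// scaled_densityE.
Unshelve. all: end_near. Qed.

End mean_convergence.

Lemma dist_mul_le (R : realDomainType) (a b x y M : R) : 0 <= b <= M -> 0 <= x ->
  `|a * b - x * y| <= M * `|a - x| + x * `|b - y|.
Proof.
move=> /andP[b0 bM] x0; rewrite (_ : _ - _ = (a - x) * b + x * (b - y)); last by ring.
apply: le_trans (ler_normD _ _) _; rewrite !normrM (ger0_norm x0) lerD2r mulrC.
by rewrite ler_wpM2r// ger0_norm.
Qed.

(** * Weak convergence *)

Section weak_convergence.
Context {R : realType} (alpha : R) (alpha_gt0 : 0 < alpha) (alpha_le1 : alpha <= 1).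
Context (nu : R) (nu_gt0 : 0 < nu) (xi0 : R) (xi0_gt0 : 0 < xi0).
Context (f : nat -> R) (f_distr : is_distribution f) (f0 : f 0%N = 0).
Notation mu := (@lebesgue_measure R).
Notation w := (scaled_theta alpha nu xi0 f).
Let p := prabhakar_ML_density alpha nu xi0.
Let D : set R := `]0, +oo[%classic.
Let mD : measurable D. Proof. exact: measurable_itv. Qed.
Let Dpos t : D t -> 0 < t. Proof. by rewrite /D /= in_itv /= andbT. Qed.
Let mp : measurable_fun D p. Proof. exact: measurable_density. Qed.
Let p0 t : D t -> 0 <= p t. Proof. by move=> /Dpos; exact: density_ge0. Qed.
Let ip : (\int[mu]_(t in D) (p t)%:E = 1)%E. Proof. exact: integral_density. Qed.
Let intp : mu.-integrable D (EFin \o p). Proof. exact: integrable_density. Qed.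

Let mE (q : R -> R) : measurable_fun D q -> measurable_fun D (fun t => (q t)%:E).
Proof. by move=> mq; exact/measurable_EFinP. Qed.

Section bounded_nonnegative.
Context (phi : R -> R) (cphi : continuous phi) (M : R) (phi0M : forall t, 0 <= phi t <= M).

Let phi0 t : 0 <= phi t. Proof. by have /andP[] := phi0M t. Qed.
Let phiM t : phi t <= M. Proof. by have /andP[] := phi0M t. Qed.
Let M0 : 0 <= M. Proof. by apply: le_trans (phiM 0). Qed.
Let mphi : measurable_fun D phi.
Proof. by apply: measurable_funTS; exact: continuous_measurable_fun. Qed.

Lemma cvg_series_weak h : 0 < h ->
  series (fun k => w h k * phi (k%:R * h)) @ \oo --> limn (series (fun k => w h k * phi (k%:R * h))).
Proof.
move=> h0; have w0 k : 0 <= w h k by exact: scaled_theta_ge0.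
have cw : cvgn (series (fun k => M * w h k)).
  by apply/cvg_ex; exists (M * h^-1); apply: cvg_seriesMl; exact: series_scaled_theta.
apply: (is_cvg_series_dominated cw) => k.
have wp : 0 <= w h k * phi (k%:R * h) by apply: mulr_ge0; [exact: w0|exact: phi0].
by rewrite ger0_norm// [leLHS]mulrC ler_wpM2r.
Qed.

(** With psi the test function sampled at the left end of each step, |W psi - p phi| <= M |W - p| +
    p |psi - phi|. The first term is controlled by convergence in mean, the second by dominated
    convergence with majorant M p. *)
Lemma cvg_weak_seq (u : nat -> R) : (forall n, 0 < u n) -> u n @[n --> \oo] --> (0 : R) ->
  u n * limn (series (fun k => w (u n) k * phi (k%:R * u n))) @[n --> \oo] -->
  \int[mu]_(t in D) (p t * phi t).
Proof.
move=> u0 ul.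
pose psi n t := phi ((step_index (u n) t)%:R * u n).
pose W n t := w (u n) (step_index (u n) t).
have W0 n t : 0 <= W n t by exact: scaled_theta_ge0.
have mW n : measurable_fun D (W n) by exact: measurable_step_pos.
have mpsi n : measurable_fun D (psi n).
  exact: (@measurable_step_pos _ _ _ (u n) (fun k => phi (k%:R * u n))).
have ur : u n @[n --> \oo] --> (0 : R)^'+ by apply: cvg_right0 => //; near=> n.
have Ap n : (\int[mu]_(t in D) (W n t * psi n t)%:E =
    (u n * limn (series (fun k => w (u n) k * phi (k%:R * u n))))%:E)%E.
  apply: (@integral_step_cvg _ (u n) (fun k => w (u n) k * phi (k%:R * u n))) => //.
    by move=> k; rewrite mulr_ge0// scaled_theta_ge0.
  exact: cvg_series_weak.
pose e1 n : \bar R := (\int[mu]_(t in D) (`|W n t - p t|%:E))%E.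
pose e2 n : \bar R := (\int[mu]_(t in D) (p t * `|psi n t - phi t|)%:E)%E.
have c1 : e1 n @[n --> \oo] --> 0%E by exact: cvg_mean_dist.
have md n : measurable_fun D (fun t => p t * `|psi n t - phi t|).
  by apply: measurable_funM => //; apply: measurableT_comp => //; exact: measurable_funB.
have c2 : e2 n @[n --> \oo] --> 0%E.
  have -> : (0 = \int[mu]_(t in D) (0 : R)%:E)%E by rewrite integral0.
  apply: (@dominated_cvg _ _ _ mu D mD (fun n t => (p t * `|psi n t - phi t|)%:E) (fun=> 0%:E)
    (fun t => M%:E * (p t)%:E)%E) => //.
  - by move=> n; exact: mE.
  - move=> t /Dpos t0; apply: cvg_EFin; first by near=> n.
    rewrite -(mulr0 (p t)); apply: cvgMl_tmp.
    rewrite -(normr0 R) -(subrr (phi t)); apply: cvg_norm; apply: cvgB; last exact: cvg_cst.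
    apply: (@cvg_continuous_comp _ _ _ _ (fun n => (step_index (u n) t)%:R * u n) phi t _).
      exact: cphi.
    have [_ h] := @cvg_step_index _ _ _ _ _ t 0%N t0 ur.
    apply: cvg_trans h; apply: near_eq_cvg; near=> n.
    by rewrite subn0 mulrC.
  - exact: (@integrableZl _ _ _ mu D mD M _ intp).
  - move=> n t Dt; rewrite abse_EFin ger0_norm; last by rewrite mulr_ge0 ?p0.
    rewrite -EFinM lee_fin mulrC ler_wpM2r ?p0// /psi ler_norml.
    have := phi0M ((step_index (u n) t)%:R * u n); have := phi0M t.
    by move: (phi _) (phi _) => a b /andP[? ?] /andP[? ?]; apply/andP; split; lra.
pose e n : \bar R := (M%:E * e1 n + e2 n)%E.
have c : e n @[n --> \oo] --> 0%E.
  rewrite -[X in _ --> X]adde0 -{1}(mule0 M%:E); apply: cvgeD => //.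
  exact: cvgeZl.
have md1 n : measurable_fun D (fun t => `|W n t - p t|).
  by apply: measurableT_comp => //; exact: measurable_funB.
have md2 n : measurable_fun D (fun t => M * `|W n t - p t|) by exact: measurable_funM.
have md3 n : measurable_fun D (fun t => M * `|W n t - p t| + p t * `|psi n t - phi t|).
  exact: measurable_funD.
have mWpsi n : measurable_fun D (fun t => W n t * psi n t) by exact: measurable_funM.
have mpphi : measurable_fun D (fun t => p t * phi t) by exact: measurable_funM.
have ee n : e n = (\int[mu]_(t in D) (M * `|W n t - p t| + p t * `|psi n t - phi t|)%:E)%E.
  under eq_integral do rewrite EFinD.
  rewrite ge0_integralD//.
  - congr (_ + _)%E; rewrite /e1; under [RHS]eq_integral do rewrite EFinM.
    by rewrite ge0_integralZl_EFin//; exact: mE.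
  - by move=> t _; rewrite lee_fin mulr_ge0.
  - exact: mE.
  - by move=> t Dt; rewrite lee_fin mulr_ge0// p0.
  - exact: mE.
have key n t : D t ->
    `|W n t * psi n t - p t * phi t| <= M * `|W n t - p t| + p t * `|psi n t - phi t|.
  by move=> Dt; apply: dist_mul_le; [exact: phi0M|exact: p0].
have pz t : D t -> 0 <= p t * phi t by move=> Dt; apply: mulr_ge0; [exact: p0|exact: phi0].
have Wz n t : D t -> 0 <= W n t * psi n t by move=> _; apply: mulr_ge0; [exact: W0|exact: phi0].
have ez n t : D t -> 0 <= M * `|W n t - p t| + p t * `|psi n t - phi t|.
  by move=> Dt; apply: addr_ge0; apply: mulr_ge0 => //; exact: p0.
pose B := (\int[mu]_(t in D) (p t * phi t)%:E)%E.
have BM : (B <= M%:E)%E.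
  apply: (@le_trans _ _ (\int[mu]_(t in D) (M%:E * (p t)%:E))%E).
    apply: ge0_le_integral => //.
    - exact: mE.
    - by apply: (@mE (fun t => M * p t)); exact: measurable_funM.
    - by move=> t Dt; rewrite -EFinM lee_fin mulrC ler_wpM2r// p0.
  rewrite ge0_integralZl_EFin ?ip ?mule1//; exact: mE.
have B0 : (0 <= B)%E by apply: integral_ge0 => t Dt; rewrite lee_fin mulr_ge0// p0.
have Bfin : B \is a fin_num by rewrite ge0_fin_numE// (le_lt_trans BM)// ltry.
have up n : ((u n * limn (series (fun k => w (u n) k * phi (k%:R * u n))))%:E <= B + e n)%E.
  rewrite -Ap ee -ge0_integralD//; last 3 first.
  - exact: mE.
  - by move=> t Dt; rewrite lee_fin; exact: ez.
  - exact: mE.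
  apply: ge0_le_integral => //.
  - by move=> t Dt; rewrite lee_fin; exact: Wz.
  - exact: mE.
  - by apply: emeasurable_funD; exact: mE.
  - move=> t Dt; rewrite -EFinD lee_fin; have := key n t Dt.
    by rewrite ler_norml => /andP[_]; rewrite lerBlDl.
have lo n : (B <= (u n * limn (series (fun k => w (u n) k * phi (k%:R * u n))))%:E + e n)%E.
  rewrite -Ap ee -ge0_integralD//; last 4 first.
  - by move=> t Dt; rewrite lee_fin; exact: Wz.
  - exact: mE.
  - by move=> t Dt; rewrite lee_fin; exact: ez.
  - exact: mE.
  apply: ge0_le_integral => //.
  - exact: mE.
  - by apply: emeasurable_funD; exact: mE.
  - move=> t Dt; rewrite -EFinD lee_fin; have := key n t Dt.
    by rewrite ler_norml => /andP[+ _]; set x := W n t * _; set y := p t * phi t; move=> ?; lra.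
have [ef ec] := (fine_cvgP _ _).1 c.
have -> : \int[mu]_(t in D) (p t * phi t) = fine B by [].
have h1 : fine B - fine (e n) @[n --> \oo] --> fine B.
  by rewrite -[X in _ --> X]subr0; apply: cvgB; [exact: cvg_cst|exact: ec].
have h2 : fine B + fine (e n) @[n --> \oo] --> fine B.
  by rewrite -[X in _ --> X]addr0; apply: cvgD; [exact: cvg_cst|exact: ec].
apply: (squeeze_cvgr _ h1 h2); near=> n.
have enf : e n \is a fin_num by near: n; exact: ef.
have := up n; have := lo n; rewrite -(fineK Bfin) -(fineK enf) -!EFinD !lee_fin.
by move=> ? ?; apply/andP; split; rewrite ?lerBlDr.
Unshelve. all: end_near. Qed.

End bounded_nonnegative.

(** Adding M to phi makes the test function nonnegative. The added constant contributes exactly M on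
    both sides, as the lattice density and p both have mass 1. *)
Lemma theta_limit_weak :
  limit_weak (fun h t => scaled_density h (theta alpha nu f (xi0 * h `^ alpha)) t) p.
Proof.
move=> phi cphi [M phiM].
pose phi' t := phi t + M.
have cphi' : continuous phi' by move=> t; apply: cvgD; [exact: cphi|exact: cvg_cst].
have phi0M t : 0 <= phi' t <= 2 * M.
  by have := phiM t; rewrite /phi' ler_norml => /andP[? ?]; apply/andP; split; lra.
have M0 : 0 <= M by apply: le_trans (phiM 0).
have mphi : measurable_fun D phi.
  by apply: measurable_funTS; exact: continuous_measurable_fun.
have c : h * limn (series (fun k => w h k * phi' (k%:R * h))) - M @[h --> (0 : R)^'+] -->
    \int[mu]_(t in D) (p t * phi t).
  have -> : \int[mu]_(t in D) (p t * phi t) = \int[mu]_(t in D) (p t * phi' t) - M.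
    have i1 : mu.-integrable D (EFin \o (fun t => p t * phi t)).
      apply: (@le_integrable _ _ _ mu D mD _ (fun t => M%:E * (p t)%:E)%E).
      - by apply: mE; exact: measurable_funM.
      - move=> t Dt; rewrite -EFinM !abse_EFin lee_fin !normrM mulrC (ger0_norm M0).
        by rewrite ler_wpM2r.
      - exact: (@integrableZl _ _ _ mu D mD M _ intp).
    have i2 : mu.-integrable D (EFin \o (fun t => M * p t)).
      exact: (@integrableZl _ _ _ mu D mD M _ intp).
    have -> : \int[mu]_(t in D) (p t * phi' t) = \int[mu]_(t in D) (p t * phi t + M * p t).
      by apply: eq_Rintegral => t _; rewrite /phi'; ring.
    rewrite RintegralD// (@RintegralZl _ _ _ mu D p M mD intp).
    by rewrite [X in M * X]/Rintegral ip /= mulr1 addrK.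
  apply: cvgB; last exact: cvg_cst.
  apply/cvg_at_rightP => u [u0 ul]; exact: (cvg_weak_seq cphi' phi0M).
apply: cvg_trans c; apply: near_eq_cvg; near=> h.
have h0 : 0 < h by near: h; exact: nbhs_right_gt.
have E : series (fun k => w h k * phi' (k%:R * h)) =
    (fun N => series (fun k => w h k * phi (k%:R * h)) N + M * series (w h) N).
  apply/funext => N; rewrite /series /= mulr_sumr -big_split; apply: eq_bigr => k _ /=.
  by rewrite /phi'; ring.
have c1 := cvg_series_weak phi0M h0.
have c2 := series_scaled_theta alpha_gt0 alpha_le1 nu_gt0 xi0_gt0 f_distr f0 h0.
have c3 : series (fun k => w h k * phi (k%:R * h)) @ \oo -->
    limn (series (fun k => w h k * phi' (k%:R * h))) - M * h^-1.
  pose proof (cvgB c1 (cvgMl_tmp (a := M) c2)) as c3.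
  apply: cvg_trans c3; apply: near_eq_cvg; near=> N.
  by rewrite E /= addrK.
have -> : (fun k => scaled_density h (theta alpha nu f (xi0 * h `^ alpha)) (k%:R * h) * phi (k%:R * h)) =
    (fun k => w h k * phi (k%:R * h)).
  by apply/funext => k; rewrite scaled_densityE.
by rewrite (cvg_lim (@Rhausdorff R) c3) mulrBr [h * (M * _)]mulrC divfK// gt_eqF.
Unshelve. all: end_near. Qed.

End weak_convergence.

Lemma bernoulli_le (R : realDomainType) (x : R) n : 0 <= x <= 1 -> 1 - n%:R * x <= (1 - x) ^+ n.
Proof.
move=> /andP[x0 x1]; elim: n => [|n IH]; first by rewrite mul0r subr0 expr0.
have x1' : 0 <= 1 - x by lra.
rewrite exprS -natr1; apply: le_trans (ler_wpM2l x1' IH).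
have : 0 <= n%:R * (x * x) by rewrite !mulr_ge0.
by move=> ?; rewrite (_ : (1 - x) * _ = 1 - (n%:R + 1) * x + n%:R * (x * x)); [rewrite lerDl|ring].
Qed.

(** * Pointwise convergence *)

Section pointwise_convergence.
Context {R : realType} (alpha : R) (alpha_gt0 : 0 < alpha) (alpha_le1 : alpha <= 1).
Context (nu : R) (nu_gt0 : 0 < nu) (xi0 : R) (xi0_gt0 : 0 < xi0).
Context (f : nat -> R) (f_distr : is_distribution f) (f0 : f 0%N = 0).
Context (t : R) (t_gt0 : 0 < t).
Notation w := (scaled_theta alpha nu xi0 f).
Notation delayed := (delayed_gdist alpha nu xi0).
Let g (h : R) := gdist alpha nu (xi0 * h `^ alpha).
Let p := prabhakar_ML_density alpha nu xi0.
Let F := within [set h | exists k : nat, t = k%:R * h] (0 : R)^'+.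

(** The steps t / (n + 1) divide t and accumulate at 0+. *)
Lemma lattice_proper : ProperFilter F.
Proof.
apply: Build_ProperFilter => Fe.
pose u n : R := t * n.+1%:R^-1.
have ur : u n @[n --> \oo] --> (0 : R)^'+.
  apply: cvg_right0; first by near=> n; rewrite mulr_gt0// invr_gt0.
  by rewrite -(mulr0 t); apply: cvgMl_tmp; exact: cvg_harmonic.
near \oo => n.
have : ~ (exists k : nat, t = k%:R * u n).
  by near: n; apply: (ur _ Fe).
by apply; exists n.+1; rewrite mulrC mulfVK.
Unshelve. all: end_near. Qed.

Let FF : ProperFilter F := lattice_proper.

Let h0 : h @[h --> F] --> (0 : R)^'+.
Proof. exact: cvg_within. Qed.

Let k (h : R) := step_index h t.

Lemma lattice_gt0 : \forall h \near F, 0 < h.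
Proof. exact: (@near_h_gt0 _ _ F _ h0). Qed.

Lemma lattice_le e : 0 < e -> \forall h \near F, h <= e.
Proof. exact: (@near_h_le _ _ F _ h0). Qed.

Lemma lattice_eq : \forall h \near F, (k h)%:R * h = t.
Proof.
have H : \forall h \near F, exists n : nat, t = n%:R * h by apply: withinT.
near=> h; have h_gt0 : 0 < h by near: h; exact: lattice_gt0.
have [n tn] : exists n : nat, t = n%:R * h by near: h.
rewrite /k (@step_index_eq _ h t n)// tn lexx /=.
by rewrite ltr_pM2r// ltr_nat.
Unshelve. all: end_near. Qed.

Lemma lattice_value : \forall h \near F,
  scaled_density h (theta alpha nu f (xi0 * h `^ alpha)) t = w h (k h).
Proof.
near=> h; have h_gt0 : 0 < h by near: h; exact: lattice_gt0.
have E : (k h)%:R * h = t by near: h; exact: lattice_eq.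
by rewrite -[in LHS]E scaled_densityE.
Unshelve. all: end_near. Qed.

(** The terms of the average over delays that the selection P keeps: all of them when alpha nu >= 1,
    otherwise those leaving a remaining time bounded away from 0. *)
Let main (P : R -> nat -> bool) h j := if P h j then f j * delayed h j (k h) else 0.

Lemma main_finite (P : R -> nat -> bool) h : limn (series (main P h)) = series (main P h) (k h).+1.
Proof.
apply: lim_series_finite => j kj; rewrite /main; case: ifP => // _.
by rewrite /delayed_gdist leqNgt kj mulr0.
Qed.

(** Dominated convergence over the delays: the kept ones have uniformly bounded density, and every
    fixed delay is eventually kept. *)
Lemma cvg_main (P : R -> nat -> bool) K : (\forall h \near F, forall j, P h j -> delayed h j (k h) <= K) ->
  (forall j, \forall h \near F, P h j) -> limn (series (main P h)) @[h --> F] --> p t.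
Proof.
move=> PK Pj; have [fge0 fs] := f_distr.
have pt0 : 0 <= p t by exact: density_ge0.
(* The majorant must also dominate the limit terms f j p t. *)
pose K' := Num.max K (p t).
have K'0 : 0 <= K' by rewrite le_max pt0 orbT.
have cM : cvgn (series (fun j => f j * K')).
  apply/cvg_ex; exists (K' * 1); have := cvg_seriesMl (k := K') fs.
  apply: cvg_trans; apply: near_eq_cvg; near=> N.
  by apply: eq_bigr => j _; rewrite mulrC.
have lp : limn (series (fun j => f j * p t)) = p t.
  apply: (cvg_lim (@Rhausdorff R)).
  have := cvg_seriesMl (k := p t) fs; rewrite mulr1.
  apply: cvg_trans; apply: near_eq_cvg; near=> N.
  by apply: eq_bigr => j _; rewrite mulrC.
rewrite -[X in _ --> X]lp; apply: (tannery cM).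
- move=> j; have fp : 0 <= f j * p t by apply: mulr_ge0.
  by rewrite ger0_norm//; apply: ler_wpM2l => //; rewrite le_max lexx orbT.
- near=> h => j; have h_gt0 : 0 < h by near: h; exact: lattice_gt0.
  have PKh : forall j, P h j -> delayed h j (k h) <= K by near: h.
  rewrite /main; case: ifP => [Phj|_]; last by rewrite normr0 mulr_ge0.
  have s0 : 0 <= delayed h j (k h) by exact: delayed_ge0.
  by rewrite ger0_norm ?mulr_ge0// ler_wpM2l// le_max PKh.
- move=> j; pose proof (cvgMl_tmp (a := f j) (@cvg_delayed _ _ alpha_gt0 alpha_le1 _ nu_gt0 _ xi0_gt0 _ F FF _ t j t_gt0 h0)) as c.
  apply: cvg_trans c; apply: near_eq_cvg; near=> h.
  by rewrite /main ifT//; near: h; exact: Pj.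
Unshelve. all: end_near. Qed.

(** y is the effective time of [gdist_le] after the delay j. Its upper bound is what matters for a
    nonnegative exponent alpha nu - 1, its lower bound for a negative one. *)
Lemma delayed_le : exists c C : R, [/\ 1 <= c, 0 <= C & \forall h \near F, forall j,
  (j <= k h)%N -> exists y : R, [/\ delayed h j (k h) <= C * y `^ (alpha * nu - 1),
    h * (k h - j)%N%:R / c <= y, 0 < y & y <= t + 2]].
Proof.
have T0 : 0 < t + 1 by rewrite addr_gt0.
have [c [C [e [c1 C0 e0 H]]]] := gdist_le alpha_gt0 alpha_le1 nu_gt0 xi0_gt0 T0.
have c0 : 0 < c by exact: lt_le_trans c1.
exists c, C; split => //; near=> h => j jk.
have h_gt0 : 0 < h by near: h; exact: lattice_gt0.
have he : h <= e by near: h; exact: lattice_le.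
have h1 : h <= 1 by near: h; exact: lattice_le.
have E : (k h)%:R * h = t by near: h; exact: lattice_eq.
set i := (k h - j)%N.
have it : h * i%:R <= t by rewrite -E mulrC ler_pM2r// ler_nat leq_subr.
have iT : h * i.+1%:R <= t + 1 by rewrite -natr1 mulrDr mulr1 lerD.
exists (h * (1 + i.+1%:R / c)); split.
- by rewrite /delayed_gdist jk; exact: H.
- by rewrite mulrDr mulr1 mulrA ler_wpDl ?(ltW h_gt0)// ler_pM2r ?invr_gt0// ler_pM2l// ler_nat.
- by rewrite mulr_gt0// addr_gt0// divr_gt0.
- rewrite mulrDr mulr1 mulrA (_ : t + 2 = 1 + (t + 1)); last by ring.
  by rewrite lerD// ler_pdivrMr// (le_trans iT)// ler_peMr// ltW.
Unshelve. all: end_near. Qed.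

(** With a nonnegative exponent, y <= t + 2 bounds all delayed densities at once, so every delay is
    kept. *)
Lemma limit_at_monotone : 1 <= alpha * nu ->
  limit_at (fun h t => scaled_density h (theta alpha nu f (xi0 * h `^ alpha)) t) p t.
Proof.
move=> an; have [c [C [c1 C0 H]]] := delayed_le.
have c' : limn (series (main (fun _ _ => true) h)) @[h --> F] --> p t.
  apply: (@cvg_main _ (C * (t + 2) `^ (alpha * nu - 1))); last by move=> j; near=> h.
  near=> h => j _; have h_gt0 : 0 < h by near: h; exact: lattice_gt0.
  have [jk|jk] := leqP j (k h); last first.
    by rewrite /delayed_gdist leqNgt jk /= mulr_ge0// powR_ge0.
  have Hh : forall j, (j <= k h)%N -> exists y : R, [/\ delayed h j (k h) <= C * y `^ (alpha * nu - 1),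
    h * (k h - j)%N%:R / c <= y, 0 < y & y <= t + 2] by near: h.
  have [y [ys _ y0 y2]] := Hh j jk.
  apply: (le_trans ys); rewrite ler_wpM2l// ge0_ler_powR ?nnegrE ?subr_ge0 ?(ltW y0)//.
  by rewrite addr_ge0// ltW.
apply: cvg_trans c'; apply: near_eq_cvg; near=> h.
have -> : scaled_density h (theta alpha nu f (xi0 * h `^ alpha)) t = w h (k h).
  by near: h; exact: lattice_value.
by rewrite main_finite scaled_theta_delayed.
Unshelve. all: end_near. Qed.

(** [s1] makes xi0 / s^alpha equal to d^(1 / nu); the requirement s >= 1 / (2 t) is there to make
    the later [eps] at most 1/2. *)
Lemma laplace_vanishes (d : R) : 0 < d -> exists2 s : R, (2 * t)^-1 <= s &
  (xi0 / (xi0 + s `^ alpha)) `^ nu <= d.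
Proof.
move=> d0; have d1 : 0 < d `^ nu^-1 by rewrite powR_gt0.
pose s1 := (xi0 / d `^ nu^-1) `^ alpha^-1.
have s10 : 0 < s1 by rewrite powR_gt0// divr_gt0.
pose s := Num.max s1 (2 * t)^-1.
have s0 : 0 < s by rewrite lt_max s10.
exists s; first by rewrite le_max lexx orbT.
have sa : xi0 / d `^ nu^-1 <= s `^ alpha.
  apply: (@le_trans _ _ (s1 `^ alpha)).
    by rewrite /s1 -powRrM mulVf ?gt_eqF// powRr1 ?divr_ge0 ?(ltW xi0_gt0) ?(ltW d1).
  by rewrite ge0_ler_powR ?nnegrE ?(ltW s10) ?(ltW s0) ?(ltW alpha_gt0)// le_max lexx.
have -> : d = (d `^ nu^-1) `^ nu by rewrite -powRrM mulVf ?gt_eqF// powRr1 ?(ltW d0).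
have sp : 0 < xi0 + s `^ alpha by rewrite addr_gt0// powR_gt0.
rewrite ge0_ler_powR ?nnegrE ?divr_ge0 ?(ltW xi0_gt0) ?(ltW sp) ?(ltW nu_gt0) ?(ltW d1)//.
rewrite ler_pdivrMr// mulrC -ler_pdivrMr// (le_trans sa)// lerDr.
exact: ltW.
Qed.

(** By Bernoulli's inequality the weight (1 - h s)^N in [lower_tail] is at least 1/2. *)
Lemma early_mass (s h : R) N : 0 < s -> 0 < h -> h * s < 1 -> N%:R * (h * s) <= 2^-1 ->
  series (g h) N <= 2 * (xi0 / (xi0 + s `^ alpha)) `^ nu.
Proof.
move=> s0 h_gt0 hs1 Nhs.
have lt := lower_tail alpha_gt0 alpha_le1 nu_gt0 xi0_gt0 N h_gt0 s0 hs1.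
have hs : 0 <= h * s <= 1 by rewrite mulr_ge0 ?(ltW h_gt0) ?(ltW s0)//= ltW.
have b := bernoulli_le N hs.
have S0 : 0 <= series (g h) N.
  by apply: sumr_ge0 => i _; apply: gdist_ge0 => //; exact: scaled_xi_gt0.
have b2 : 2^-1 <= (1 - h * s) ^+ N by apply: le_trans b; lra.
have := le_trans (ler_wpM2r S0 b2) lt.
by rewrite ler_pdivrMl.
Qed.

Lemma sum_truncated_le (a : nat -> R) (N n : nat) : (forall i, 0 <= a i) ->
  \sum_(0 <= i < n) (if (i < N)%N then a i else 0) <= series a N.
Proof.
move=> a0; have [Nn|nN] := leqP N n.
  rewrite (@big_cat_nat _ _ _ N)//= [X in _ + X]big_nat [X in _ + X]big1 ?addr0.
    by rewrite /series /=; apply: ler_sum_nat => i /andP[_ ->].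
  by move=> i /andP[Ni _]; rewrite ltnNge Ni.
rewrite /series /= [leRHS](@big_cat_nat _ _ _ n) ?(ltnW nN)//= -[leLHS]addr0 lerD ?sumr_ge0//.
by apply: ler_sum_nat => i _; case: ifP.
Qed.

(** The delays are cut at distance eps k from k. The kept ones leave a time at least eps t, where
    the density is bounded; the others are weighted by values of f of order h, against the mass of g
    in its first N steps, which is small when eps is. *)
Lemma limit_at_tail_bound : (exists M : R, forall j : nat, j%:R * f j <= M) ->
  limit_at (fun h t => scaled_density h (theta alpha nu f (xi0 * h `^ alpha)) t) p t.
Proof.
move=> [M fM]; have [fge0 fs] := f_distr.
have M0 : 0 <= M by apply: le_trans (fM 0%N); rewrite mul0r.
have [c [C [c1 C0 H]]] := delayed_le.
have c0 : 0 < c by exact: lt_le_trans c1.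
apply/cvgrPdist_le => e e0.
(* Chosen so that (2 M / t) (2 d) = M / (M + 1) (e / 2) <= e / 2; M + 1 avoids a division by
   zero. *)
pose d := e * t / (8 * (M + 1)).
have M1 : 0 < M + 1 by rewrite ltr_wpDl.
have d0 : 0 < d by rewrite divr_gt0 ?mulr_gt0.
have [s st sd] := laplace_vanishes d0.
have t2 : 0 < 2 * t by rewrite mulr_gt0.
have s0 : 0 < s by apply: lt_le_trans st; rewrite invr_gt0.
(* Makes 2 eps t s = 1/2, the threshold of [early_mass], when N steps last at most 2 eps t. *)
pose eps := (4 * s * t)^-1.
have st4 : 0 < 4 * s * t by rewrite !mulr_gt0.
have eps0 : 0 < eps by rewrite invr_gt0.
have eps2 : eps <= 2^-1.
  rewrite lef_pV2 ?posrE// (_ : 4 * s * t = 2 * (s * (2 * t))); last by ring.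
  by rewrite ler_peMr// -ler_pdivrMr// mul1r.
have et : eps * t * s = 4^-1 by rewrite /eps; field; rewrite !gt_eqF.
have et0 : 0 < eps * t by rewrite mulr_gt0.
pose P h j := (j <= k h)%N && (eps * (k h)%:R <= (k h - j)%N%:R).
have cm : limn (series (main P h)) @[h --> F] --> p t.
  apply: (@cvg_main _ (C * ((eps * t / c) `^ (alpha * nu - 1) + (t + 2) `^ (alpha * nu - 1)))).
    near=> h => j /andP[jk Phj].
    have h_gt0 : 0 < h by near: h; exact: lattice_gt0.
    have E : (k h)%:R * h = t by near: h; exact: lattice_eq.
    have Hh : forall j, (j <= k h)%N -> exists y : R, [/\ delayed h j (k h) <= C * y `^ (alpha * nu - 1),
      h * (k h - j)%N%:R / c <= y, 0 < y & y <= t + 2] by near: h.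
    have [y [ys yl y0 y2]] := Hh j jk.
    apply: (le_trans ys); rewrite ler_wpM2l// powR_mono_or// ?divr_gt0//.
    apply: le_trans yl; rewrite ler_pM2r ?invr_gt0// -[X in eps * X]E mulrA mulrC ler_pM2l//.
  move=> j; have [jk hk] := @cvg_step_index _ _ F FF _ t j t_gt0 h0.
  have hk' : \forall h \near F, eps * t <= h * (k h - j)%N%:R.
    by apply: (cvgr_ge _ hk); rewrite gtr_pMl// (le_lt_trans eps2)// invf_lt1// ltr1n.
  near=> h; have h_gt0 : 0 < h by near: h; exact: lattice_gt0.
  have E : (k h)%:R * h = t by near: h; exact: lattice_eq.
  rewrite /P; apply/andP; split; first by near: h.
  rewrite -(ler_pM2l h_gt0) mulrCA [h * (k h)%:R]mulrC E.
  by near: h.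
have e2 : 0 < e / 2 by rewrite divr_gt0.
have cm2 : \forall h \near F, `|p t - limn (series (main P h))| <= e / 2.
  by move/cvgrPdist_le: cm => /(_ _ e2).
near=> h.
have h_gt0 : 0 < h by near: h; exact: lattice_gt0.
have E : (k h)%:R * h = t by near: h; exact: lattice_eq.
have het : h <= eps * t by near: h; exact: lattice_le.
have m2 : `|p t - limn (series (main P h))| <= e / 2 by near: h.
have -> : scaled_density h (theta alpha nu f (xi0 * h `^ alpha)) t = w h (k h).
  by near: h; exact: lattice_value.
have g0 i : 0 <= g h i by apply: gdist_ge0 => //; exact: scaled_xi_gt0.
(* The successor ensures that k - j <= eps k implies k - j < N. Its cost is one more step, absorbed
   by h <= eps t in N h <= 2 eps t. *)
pose N := (Num.truncn (eps * (k h)%:R)).+1.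
have hs1 : h * s < 1.
  by apply: (@le_lt_trans _ _ (eps * t * s)); [rewrite ler_pM2r|rewrite et invf_lt1// ltr1n].
have Ns : N%:R * (h * s) <= 2^-1.
  have ek0 : 0 <= eps * (k h)%:R by rewrite mulr_ge0// ltW.
  have Nk : N%:R <= eps * (k h)%:R + 1.
    by have /andP[+ _] := truncn_itv ek0; rewrite /N -natr1 lerD2r.
  have hs0 : 0 <= h * s by rewrite ltW// mulr_gt0.
  apply: le_trans (ler_wpM2r hs0 Nk) _.
  rewrite (_ : _ * (h * s) = (eps * ((k h)%:R * h) + h) * s); last by ring.
  rewrite E (_ : 2^-1 = (eps * t + eps * t) * s); last by rewrite mulrDl et; field.
  by rewrite ler_pM2r// lerD2l.
have em := le_trans (early_mass s0 h_gt0 hs1 Ns) (ler_wpM2l (ler0n _ 2) sd).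
(* j >= k / 2 for the remaining delays, hence f j / h <= 2 M / t *)
have rem : `|limn (series (main P h)) - w h (k h)| <= 2 * M / t * series (g h) N.
  rewrite main_finite scaled_theta_delayed /series /= distrC -sumrB.
  apply: le_trans (ler_norm_sum _ _ _) _.
  pose a i := if (i < N)%N then g h i else 0.
  apply: (@le_trans _ _ (\sum_(0 <= j < (k h).+1) 2 * M / t * a (k h - j)%N)).
    apply: ler_sum_nat => j /andP[_ jk]; rewrite ltnS in jk.
    have a0 : 0 <= a (k h - j)%N by rewrite /a; case: ifP.
    have Ma : 0 <= 2 * M / t * a (k h - j)%N by rewrite !mulr_ge0// invr_ge0 ltW.
    rewrite /main; case: ifPn => [_|nP]; first by rewrite subrr normr0.
    have lt : (k h - j)%N%:R < eps * (k h)%:R by move: nP; rewrite /P jk /= -ltNge.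
    have iN : (k h - j < N)%N.
      by rewrite /N ltnS truncn_ge_nat ?mulr_ge0 ?(ltW eps0)// ltW.
    have s_ge0 : 0 <= delayed h j (k h) by exact: delayed_ge0.
    rewrite subr0 ger0_norm ?mulr_ge0// /delayed_gdist jk /a iN.
    rewrite mulrCA [leRHS]mulrC ler_wpM2l//; first exact: g0.
    rewrite ler_pdivrMr// mulrAC ler_pdivlMr//.
    have jk2 : t <= 2 * j%:R * h.
      rewrite -[leLHS]E ler_pM2r//.
      have : (k h - j)%N%:R <= 2^-1 * (k h)%:R :> R.
        by apply: ltW; apply: (lt_le_trans lt); rewrite ler_wpM2r.
      by rewrite natrB// => ?; lra.
    apply: le_trans (ler_wpM2l (fge0 j) jk2) _.
    rewrite (_ : f j * _ = 2 * (j%:R * f j) * h); last by ring.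
    by rewrite ler_pM2r// ler_pM2l.
  rewrite -mulr_sumr ler_wpM2l//; first by rewrite !mulr_ge0// invr_ge0 ltW.
  rewrite big_nat_rev /= (_ : \sum_(0 <= i < _) _ = \sum_(0 <= i < (k h).+1) a i).
    exact: sum_truncated_le.
  apply: eq_big_nat => i /andP[_ ik]; congr a.
  by rewrite add0n subSS subKn.
have -> : p t - w h (k h) = (p t - limn (series (main P h))) + (limn (series (main P h)) - w h (k h)).
  by rewrite addrA subrK.
apply: le_trans (ler_normD _ _) _.
rewrite [e in leRHS](splitr e); apply: lerD => //.
apply: (le_trans rem).
have Mt : 0 <= 2 * M / t by rewrite !mulr_ge0// invr_ge0 ltW.
apply: le_trans (ler_wpM2l Mt em) _.
rewrite (_ : 2 * M / t * (2 * d) = M / (M + 1) * (e / 2)); last first.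
  by rewrite /d; field; rewrite !gt_eqF.
by rewrite ler_piMl ?(ltW e2)// ler_pdivrMr// mul1r lerDl.
Unshelve. all: end_near. Qed.

End pointwise_convergence.

Unset Implicit Arguments.

Theorem mainTheorem3 (R : realType) (alpha nu xi0 : R) (f : nat -> R)
    (alpha_gt0 : 0 < alpha) (alpha_le1 : alpha <= 1) (nu_gt0 : 0 < nu)
    (xi0_gt0 : 0 < xi0) (f_distr : is_distribution f) (f0 : f 0%N = 0) :
  exists theta : R -> nat -> R,
    (forall xi : R, 0 < xi ->
      [/\ is_distribution (theta xi), theta xi 0%N = 0
        & is_genfun (theta xi) (theta_bar alpha nu f xi)]) /\
    let w (h t : R) := scaled_density h (theta (xi0 * h `^ alpha)) t in
    let p := prabhakar_ML_density alpha nu xi0 in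
    [/\ limit_weak w p,
        limit_in_mean w p
      & (1 <= alpha * nu \/ exists M : R, forall k : nat, k%:R * f k <= M) ->
        forall t : R, 0 < t -> limit_at w p t].
Proof.
exists (theta alpha nu f); split; first by move=> xi; exact: theta_distr.
split.
- exact: theta_limit_weak.
- exact: theta_limit_in_mean.
- move=> [an|fM] t t_gt0; first exact: limit_at_monotone.
  exact: limit_at_tail_bound.
Qed.
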